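(* Let $n\geq 1$, $\alpha>0$ and $s>1$ be such that $\alpha s\leq n$. For any $q>(n-\alpha)/n$ there is a constant $A=A(n,\alpha,s,q)$ such that for any measurable and q.e. defined function $f$ on $\mathbb{R}^n$, $$\int_{\mathbb{R}^n} ({\bf M}^{\rm loc} f)^q\, d\,{\rm Cap}_{\alpha,s}\leq A\int_{\mathbb{R}^n}|f|^q\, d\,{\rm Cap}_{\alpha,s}.$$
   Context: $G_\alpha$ denotes the Bessel kernel of order $\alpha>0$ on $\mathbb{R}^n$, $G_\alpha(x)=\mathcal{F}^{-1}[(1+|\xi|^2)^{-\alpha/2}](x)$, where $\mathcal{F}$ is the Fourier transform in $\mathbb{R}^n$. The Bessel capacity of an arbitrary set $E\subset\mathbb{R}^n$ is $${\rm Cap}_{\alpha,s}(E)=\inf\Big\{\|f\|_{L^s(\mathbb{R}^n)}^s : f\geq 0,\ G_\alpha*f\geq 1 \text{ on } E\Big\}.$$ A function with values in $[-\infty,+\infty]$ is defined quasieverywhere (q.e.) if it is defined at every point of $\mathbb{R}^n$ except on a set of zero capacity ${\rm Cap}_{\alpha,s}$. For a q.e. defined function $w:\mathbb{R}^n\to[0,\infty]$, the Choquet integral is $$\int_{\mathbb{R}^n} w\, d\,{\rm Cap}_{\alpha,s}=\int_0^\infty {\rm Cap}_{\alpha,s}(\{x\in\mathbb{R}^n: w(x)>t\})\,dt.$$ The (centered) local Hardy-Littlewood maximal function is $${\bf M}^{\rm loc} f(x)=\sup_{0<r\leq 1}\frac{1}{|B_r(x)|}\int_{B_r(x)}|f(y)|\,dy,\qquad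 x\in\mathbb{R}^n,$$ with values in $[0,\infty]$, for measurable $f$ defined almost everywhere. *)

(* Defs.v *)
From HB Require Import structures.
From mathcomp Require Import all_boot all_order all_algebra.
From mathcomp Require Import all_classical all_reals all_analysis.
From mathcomp Require Import measurable_realfun complex.

Set Implicit Arguments.
Unset Strict Implicit.
Unset Printing Implicit Defensive.

Import Order.TTheory GRing.Theory Num.Theory.
Import numFieldNormedType.Exports.

Local Open Scope classical_set_scope.
Local Open Scope ring_scope.

(* Points of R^n are n-tuples, which carry the product Borel sigma-algebra;
   the norm that the library puts on 'rV[R]_n is the sup norm. *)
Notation Rn R n := (n.-tuple (measurableTypeR R)).

Section Euclidean.
Context {R : realType} {n : nat}.
Implicit Types x y : Rn R n.

Definition dotv x y : R := \sum_(i < n) (tnth x i : R) * tnth y i.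

Definition subv x y : Rn R n := [tuple (tnth x i : R) - tnth y i | i < n].

Definition enorm x : R := Num.sqrt (dotv x x).

Definition eball x (r : R) : set (Rn R n) := [set y | enorm (subv y x) < r].

End Euclidean.

Section LebesgueRn.
Context {R : realType}.

Definition cons_Rn n (p : measurableTypeR R * Rn R n) : Rn R n.+1 :=
  [tuple of p.1 :: p.2].

Lemma measurable_cons_Rn n : measurable_fun [set: _] (@cons_Rn n).
Proof.
apply: measurable_cons; [exact: measurable_fst|exact: measurable_snd].
Qed.

Section step.
Variables (n : nat) (mu : {sigma_finite_measure set (Rn R n) -> \bar R}).

Definition lebesgue_step : set (Rn R n.+1) -> \bar R :=
  pushforward (@lebesgue_measure R \x mu)%E (@cons_Rn n).

Let step0 : lebesgue_step set0 = 0%E.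
Proof. by rewrite /lebesgue_step /pushforward preimage_set0 measure0. Qed.

Let step_ge0 A : (0 <= lebesgue_step A)%E.
Proof. by rewrite /lebesgue_step /pushforward; exact: measure_ge0. Qed.

Let step_sigma_additive : semi_sigma_additive lebesgue_step.
Proof.
move=> F mF tF mUF; rewrite /lebesgue_step /pushforward preimage_bigcup.
apply: measure_semi_sigma_additive.
- by move=> k; rewrite -[X in measurable X]setTI; exact: measurable_cons_Rn.
- apply/trivIsetP => /= i j _ _ ij; rewrite -preimage_setI.
  by move/trivIsetP : tF => /(_ _ _ _ _ ij) ->//; rewrite preimage_set0.
- by rewrite -preimage_bigcup -[X in measurable X]setTI;
    exact: measurable_cons_Rn.
Qed.

HB.instance Definition _ := isMeasure.Build _ _ _
  lebesgue_step step0 step_ge0 step_sigma_additive.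

Let step_sigma_finite : sigma_finite [set: Rn R n.+1] lebesgue_step.
Proof.
have [F FT Foo] : sigma_finite setT (@lebesgue_measure R \x mu)%E.
  have /sigma_finiteP[F [TF ndF Foo]] := sigma_finiteT (@lebesgue_measure R).
  have /sigma_finiteP[G [TG ndG Goo]] := sigma_finiteT mu.
  exists (fun k => F k `*` G k).
    rewrite -setXTT TF TG predeqE => -[x y]; split.
      move=> [/= [i _ Fix] [k _ Gky]]; exists (maxn i k) => //; split.
      - by move: x Fix; exact/subsetPset/ndF/leq_maxl.
      - by move: y Gky; exact/subsetPset/ndG/leq_maxr.
    by move=> [i _ []/= ? ?]; split; exists i.
  move=> k; have [? ?] := Foo k; have [? ?] := Goo k.
  split; first exact: measurableX.
  by rewrite product_measure1E// lte_mul_pinfty// ge0_fin_numE.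
pose h (x : Rn R n.+1) : measurableTypeR R * Rn R n :=
  (thead x, [tuple of behead x]).
have hK : cancel h (@cons_Rn n).
  by move=> x; rewrite /cons_Rn /h /= [RHS]tuple_eta; apply: val_inj.
have cK : cancel (@cons_Rn n) h.
  move=> [a t]; rewrite /h /cons_Rn; congr pair; exact: val_inj.
have mh : measurable_fun [set: Rn R n.+1] h.
  apply/measurable_fun_pairP; split.
    exact: measurable_tnth.
  exact: measurable_behead.
exists (fun k => h @^-1` F k).
  by rewrite -preimage_bigcup -FT preimage_setT.
move=> k; have [mF Fk] := Foo k; split.
  by rewrite -[X in measurable X]setTI; exact: mh.
rewrite /lebesgue_step /pushforward.
suff -> : @cons_Rn n @^-1` (h @^-1` F k) = F k by [].
by apply/seteqP; split=> p /=; rewrite cK.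
Qed.

HB.instance Definition _ := Measure_isSigmaFinite.Build _ _ _
  lebesgue_step step_sigma_finite.

End step.

(* Lebesgue measure on the Borel sets of R^n, as the n-fold product of
   [lebesgue_measure]. *)
Fixpoint lebesgue_Rn (n : nat) : {sigma_finite_measure set (Rn R n) -> \bar R} :=
  match n with
  | 0 => \d_[tuple]
  | n'.+1 => lebesgue_step (lebesgue_Rn n')
  end.

End LebesgueRn.

(* Measurability of sets and functions with respect to the completion of
   [lebesgue_Rn n]. *)
Definition lebesgue_measurable {R : realType} {n : nat} (A : set (Rn R n)) :=
  exists2 B : set (Rn R n), measurable B &
    (lebesgue_Rn n).-negligible (A `+` B).

Definition lebesgue_measurable_fun {R : realType} {n : nat}
    (D : set (Rn R n)) (f : Rn R n -> \bar R) :=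
  forall U : set (\bar R), measurable U -> lebesgue_measurable (D `&` f @^-1` U).

Section BesselCapacity.
Context {R : realType} {n : nat}.
Local Notation mu := (@lebesgue_Rn R n).

(* F g (xi) = \int e^{- i x . xi} g(x) dx; this is the normalization for which
   (1 + |xi|^2)^(- alpha / 2) is the symbol of (1 - Delta)^(- alpha / 2). *)
Definition fourier (g : Rn R n -> R) (xi : Rn R n) : R[i] :=
  Complex (\int[mu]_x (cos (dotv x xi) * g x))
          (- \int[mu]_x (sin (dotv x xi) * g x)).

(* The symbol need not be integrable, so its inverse Fourier transform is in
   general not given by an absolutely convergent integral: it is the function
   in L^1, unique up to null sets, whose Fourier transform is the symbol.
   [xget] selects a representative; null sets do not matter below, where the
   kernel only occurs in convolutions. *)
Definition bessel_kernel (alpha : R) : Rn R n -> R :=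
  xget (cst 0) [set G : Rn R n -> R | mu.-integrable setT (EFin \o G) /\
    forall xi, fourier G xi = ((1 + enorm xi ^+ 2) `^ (- (alpha / 2)))%:C%C].

Local Open Scope ereal_scope.

Definition bessel_potential (alpha : R) (f : Rn R n -> \bar R) (x : Rn R n) :
    \bar R :=
  \int[mu]_y ((bessel_kernel alpha (subv x y))%:E * f y).

(* Every class in L^s has a Borel representative, and the potential does not
   depend on the representative. *)
Definition bessel_cap (alpha s : R) (E : set (Rn R n)) : \bar R :=
  ereal_inf [set 'N[mu]_s%:E[f] `^ s | f in
    [set f : Rn R n -> \bar R | [/\ measurable_fun setT f,
       (forall y, 0 <= f y) &
       (forall x, E x -> 1 <= bessel_potential alpha f x)]]].

(* A partial function is a total function together with its domain [D]. *)
Definition qe_domain (alpha s : R) (D : set (Rn R n)) : Prop :=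
  bessel_cap alpha s (~` D) = 0.

Definition choquet (alpha s : R) (D : set (Rn R n)) (w : Rn R n -> \bar R) :
    \bar R :=
  \int[@lebesgue_measure R]_(t in `[0%R, +oo[)
    bessel_cap alpha s (D `&` [set x | t%:E < w x]).

(* The integrand is only measurable for the completed measure; since the
   library's integral of a nonnegative function is a supremum over the simple
   functions below it, this is still its Lebesgue integral. *)
Definition loc_maximal (D : set (Rn R n)) (f : Rn R n -> \bar R) (x : Rn R n) :
    \bar R :=
  ereal_sup [set (mu (eball x r))^-1 * \int[mu]_(y in eball x r `&` D) `|f y|
            | r in `]0%R, 1%R] ].

End BesselCapacity.

(* Main.v *)
Require Import Defs.
From mathcomp Require Import all_boot all_order all_algebra.
From mathcomp Require Import all_classical all_reals all_analysis.
From mathcomp Require Import measurable_realfun complex ring lra zify.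

(* The kernel of order alpha is comparable, near the origin, with the dyadic sum
   K(x, y) = sum_i 2^{-alpha i} 1[y in N_i x] / |N_i x|, where N_i x is the union
   of the 3^n dyadic cubes of side 2^{-i} around x; the lower bound G >= c K is
   global, and G <= C (K + K * eta) for an integrable eta.  So Cap can be computed
   with the dyadic potential U g (x) = sum_i 2^{-alpha i} avg_{N_i x} g.

   For the dyadic potential the theorem rests on two facts.
   - Capacitary strong type: int Cap {(U g)^s > t} dt <= C ||g||_s^s.  The set
     {U g > b t} is tested with psi_t = C (1_{M g > c t} + t^{-1} M g 1_{t < U g <= C' t}),
     and the layers t < U g <= C' t overlap boundedly when t varies, so that Tonelli
     in (x, t) concludes.
   - Means of powers: if 1 < m and 1 <= p < n / (n - alpha), then the mean over N_k x
     of (U g)^{m p} is at most C (U psi (x))^{m p}, with psi = g + (M g^m)^{1/m}, by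
     Young's inequality for the part of the potential that is near x.
   Given f, choose near-optimal g_j for the sets {|f|^q > 2^j} and
   g = sup_j 2^{(j+1)/s} g_j: then |f|^q <= (U g)^s on the domain of f and ||g||_s^s is
   at most a multiple of the Choquet integral of |f|^q.  The second fact, with p
   between max(1, 1/q) and n / (n - alpha) and s / q <= m p < p s, gives
   (M f)^q <= C (U psi)^s, where ||psi||_s <= C ||g||_s because m < s, and the first
   fact bounds the Choquet integral of (U psi)^s.

   The kernel itself is identified by subordination,
   G = c^{-1} int_0^oo t^{alpha - 1} e^{- t^2 / 2} p_t dt with p_t the Gaussian density
   of variance t^2, and by the injectivity of the Fourier transform on L^1. *)

Import Order.TTheory GRing.Theory Num.Theory.
Import numFieldNormedType.Exports.

Set Implicit Arguments.
Unset Strict Implicit.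
Unset Printing Implicit Defensive.

Local Open Scope classical_set_scope.
Local Open Scope ring_scope.

(** * Integrals of nonnegative functions *)

(** The threshold on q is a convergence condition. When p-th powers of the potential are averaged
    over a neighbourhood, successive finer scales contribute in the ratio 2^(n (p - 1) - alpha p),
    which is below 1 exactly when p < n / (n - alpha); a p in this range with p q > 1 exists exactly
    when q > (n - alpha) / n. This range need not reach the exponent s / q of the majorant (U
    g)^(s/q) of |f|. The extra factor m < s is won from the integrability of g^m, and the term (M
    g^m)^{1/m} is its price. The potential starts at cells of side 1, but the grid has two coarser
    generations: moving a mean to a neighbouring point costs one generation, and they give the room
    for it. Level sets and their capacities come without measurability in t or x. Choquet integrals
    are therefore compared by monotonicity only, and the strong type inequality delivers a
    measurable majorant of t -> Cap {(U g)^s > t}, whose integral Tonelli can compute. *)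

Lemma tangent_powR (R : realType) (p c z : R) : (1 <= p)%R -> (0 < c)%R -> (0 <= z)%R ->
  (p * c `^ (p - 1) * z <= z `^ p + (p - 1) * c `^ p)%R.
Proof.
rewrite le_eqVlt => /predU1P[<- c0 z0|p1 c0 z0].
  by rewrite subrr powRr0 powRr1// mul0r addr0 !mul1r.
have p0 : (0 < p)%R by lra.
have p10 : (0 < p - 1)%R by lra.
(* Young's inequality for z and c^(p-1), with exponents p and p/(p-1). Equality holds at z = c, so
   the bound is the tangent of z^p at c. *)
have := @conjugate_powR R z (c `^ (p - 1)) p (p / (p - 1)) z0 (powR_ge0 _ _) p0.
rewrite divr_gt0// => /(_ isT).
rewrite -powRrM.
have -> : ((p - 1) * (p / (p - 1)) = p)%R by field; lra.
have -> : (p^-1 + (p / (p - 1))^-1 = 1)%R by field; lra.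
move=> /(_ erefl) h.
have {h} := ler_wpM2l (ltW p0) h.
rewrite mulrDr [X in (_ <= X + _)%R]mulrCA divff ?gt_eqF// mulr1.
suff -> : (p * (c `^ p / (p / (p - 1))) = (p - 1) * c `^ p)%R by move=> h; lra.
by field; lra.
Qed.

Section nonneg_integral.
Local Open Scope ereal_scope.
Context d (T : measurableType d) (R : realType).
Variable mu : {measure set T -> \bar R}.

(** The integral of a nonnegative function is a supremum over the simple functions below it, hence
    monotone for arbitrary functions. This form serves for capacities of level sets, as functions of
    the level, and for [f] itself. *)
Lemma le_integral_nonmeas (D : set T) (f g : T -> \bar R) :
  (forall x, D x -> 0 <= f x) -> (forall x, D x -> f x <= g x) ->
  \int[mu]_(x in D) f x <= \int[mu]_(x in D) g x.
Proof.
move=> f0 fg; rewrite !(integral_mkcond D).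
have f0' x : 0 <= (f \_ D) x by exact: erestrict_ge0.
have fg' x : (f \_ D) x <= (g \_ D) x by exact: lee_restrict.
have g0' x : 0 <= (g \_ D) x by rewrite (le_trans (f0' x)).
rewrite !ge0_integralTE//; apply: ereal_sup_le => _ [h hf <-].
by exists h => // x; rewrite (le_trans (hf x)).
Qed.

Lemma tangent_poweR (p c : R) (z : \bar R) : (1 <= p)%R -> (0 < c)%R -> 0 <= z ->
  (p * c `^ (p - 1))%:E * z <= z `^ p + ((p - 1) * c `^ p)%:E.
Proof.
move=> p1 c0; case: z => [z| |//] z0.
  by rewrite poweR_EFin -EFinM -EFinD lee_fin tangent_powR.
rewrite poweRyr; last by rewrite gt_eqF//; lra.
by rewrite addye ?leey.
Qed.

Lemma measurable_mule (f g : T -> \bar R) : measurable_fun setT f ->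
  measurable_fun setT g -> measurable_fun setT (fun x => f x * g x).
Proof. by move=> mf mg; exact: emeasurable_funM. Qed.

Lemma measurable_adde (f g : T -> \bar R) : measurable_fun setT f ->
  measurable_fun setT g -> measurable_fun setT (fun x => f x + g x).
Proof. by move=> mf mg; exact: emeasurable_funD. Qed.

Lemma measurable_poweR_fun (f : T -> \bar R) p : measurable_fun setT f ->
  measurable_fun setT (fun x => f x `^ p).
Proof. by move=> mf; exact: (measurableT_comp (@measurable_poweR R p)). Qed.

Lemma poweR_mono (p : R) (x y : \bar R) : (0 <= p)%R -> 0 <= x -> x <= y ->
  x `^ p <= y `^ p.
Proof.
move=> p0 x0 xy; apply: gt0_ler_poweR => //; rewrite in_itv/= leey andbT//.
exact: le_trans xy.
Qed.

Lemma poweRK (p : R) (x : \bar R) : (0 < p)%R -> 0 <= x ->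
  (x `^ p) `^ p^-1 = x.
Proof. by move=> p0 x0; rewrite -poweRrM divff ?gt_eqF// poweRe1. Qed.

Lemma poweRVK (p : R) (x : \bar R) : (0 < p)%R -> 0 <= x ->
  (x `^ p^-1) `^ p = x.
Proof. by move=> p0 x0; rewrite -poweRrM mulVf ?gt_eqF// poweRe1. Qed.

Lemma poweR_addl (p : R) (x y : \bar R) : (0 <= p)%R -> 0 <= x -> 0 <= y ->
  (x + y) `^ p <= (2 `^ p)%:E * (x `^ p + y `^ p).
Proof.
move=> p0; wlog xy : x y / x <= y.
  move=> H x0 y0; have [|/ltW] := leP x y; first by move=> h; exact: H.
  by move=> h; rewrite addeC [in leRHS]addeC; exact: H.
move=> x0 y0; rewrite (@le_trans _ _ ((2%:E * y) `^ p))//.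
  rewrite poweR_mono ?adde_ge0//.
  have -> : (2 : R)%:E = 1 + 1 by rewrite -EFinD.
  by rewrite ge0_muleDl// mul1e leeD2r.
rewrite poweRM// poweR_EFin lee_pmul// ?poweR_ge0 ?lee_fin ?powR_ge0//.
by rewrite leeDr// poweR_ge0.
Qed.

(* The bound is obtained by integrating the tangent inequality of [z `^ p]
   at the mean value. *)
Lemma jensen_poweR (k f : T -> \bar R) (b p : R) :
  measurable_fun setT k -> measurable_fun setT f ->
  (forall x, 0 <= k x) -> (forall x, 0 <= f x) -> (1 <= p)%R -> (0 < b)%R ->
  \int[mu]_x k x <= b%:E ->
  (\int[mu]_x (k x * f x)) `^ p <=
  (b `^ (p - 1))%:E * \int[mu]_x (k x * f x `^ p).
Proof.
move=> mk mf k0 f0 p1 b0 kb.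
have p0 : (0 < p)%R by lra.
have I0 : 0 <= \int[mu]_x (k x * f x `^ p).
  by apply: integral_ge0 => x _; rewrite mule_ge0 ?poweR_ge0.
have tan c : (0 < c)%R -> (p * c `^ (p - 1))%:E * \int[mu]_x (k x * f x) <=
    \int[mu]_x (k x * f x `^ p) + ((p - 1) * c `^ p * b)%:E.
  move=> c0; have pc0 : (0 <= p * c `^ (p - 1))%R by rewrite mulr_ge0 ?powR_ge0 ?ltW.
  have pc1 : (0 <= (p - 1) * c `^ p)%R by rewrite mulr_ge0 ?powR_ge0//; lra.
  rewrite -ge0_integralZl//; last 2 first.
  - exact: measurable_mule.
  - by move=> x _; rewrite mule_ge0.
  apply: (@le_trans _ _ (\int[mu]_x (k x * f x `^ p + ((p - 1) * c `^ p)%:E * k x))).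
    apply: ge0_le_integral => //.
    - by move=> x _; rewrite !mule_ge0// lee_fin.
    - by apply: measurable_mule => //; exact: measurable_mule.
    - apply: measurable_adde; apply: measurable_mule => //.
      exact: measurable_poweR_fun.
    - move=> x _; rewrite muleCA [X in _ + X]muleC -ge0_muleDr ?poweR_ge0 ?lee_fin//.
      by rewrite lee_wpmul2l// tangent_poweR.
  rewrite ge0_integralD//; first last.
  - exact: measurable_mule.
  - by move=> x _; rewrite mule_ge0// lee_fin.
  - by apply: measurable_mule => //; exact: measurable_poweR_fun.
  - by move=> x _; rewrite mule_ge0// poweR_ge0.
  rewrite leeD2l// ge0_integralZl//.
  by rewrite [leRHS]EFinM lee_wpmul2l.
have J0 : 0 <= \int[mu]_x (k x * f x).
  by apply: integral_ge0 => x _; rewrite mule_ge0.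
move: I0 tan J0.
case: (\int[mu]_x (k x * f x `^ p)) => [I| |//] I0 tan; last first.
  by move=> _; rewrite mulry gtr0_sg ?mul1e ?leey// powR_gt0.
(* If the integral on the left were infinite, the tangent inequality at c = 1 would make the one on
   the right infinite too, and that case is already settled. *)
case: (\int[mu]_x (k x * f x)) tan => [J| |//] tan J0; last first.
  have := tan 1%R ltr01; rewrite powR1 mulr1 mulry gtr0_sg// mul1e.
  by rewrite -EFinD leye_eq.
rewrite poweR_EFin -EFinM lee_fin.
rewrite lee_fin in J0; move: J0; rewrite le_eqVlt => /predU1P[<-|J0].
  rewrite powR0 ?gt_eqF//; rewrite lee_fin in I0.
  by rewrite mulr_ge0 ?powR_ge0.
have c0 : (0 < J / b)%R by rewrite divr_gt0.
have {tan} := tan _ c0; rewrite -EFinM -EFinD lee_fin.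
set c := (J / b)%R; have -> : J = (c * b)%R by rewrite /c divfK ?gt_eqF.
have cp : (c `^ (p - 1) * c = c `^ p)%R.
  rewrite -[X in (_ * X)%R](@powRr1 _ c) ?ltW// -powRD; last first.
    by rewrite (gt_eqF c0) implybT.
  by congr (_ `^ _)%R; lra.
have bp : (b `^ p = b `^ (p - 1) * b)%R.
  rewrite -[X in (_ * X)%R](@powRr1 _ b) ?ltW// -powRD; last first.
    by rewrite (gt_eqF b0) implybT.
  by congr (_ `^ _)%R; lra.
have -> : (p * c `^ (p - 1) * (c * b) = p * c `^ p * b)%R by rewrite -cp; ring.
move=> h; rewrite powRM ?(ltW b0) ?(ltW c0)// bp mulrCA.
by apply: ler_wpM2l; [exact: powR_ge0|lra].
Qed.

Lemma integralZl_ge0 (c : \bar R) (f : T -> \bar R) : 0 <= c ->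
  measurable_fun setT f -> (forall x, 0 <= f x) ->
  \int[mu]_x (c * f x) = c * \int[mu]_x f x.
Proof. by move=> c0 mf f0; rewrite ge0_integralZl. Qed.

Lemma integral_indicM (A : set T) (f : T -> \bar R) :
  \int[mu]_(x in A) f x = \int[mu]_x ((\1_A x)%:E * f x).
Proof.
rewrite integral_mkcond; apply: eq_integral => x _.
by rewrite patchE indicE; case: ifPn => _; rewrite ?mul1e ?mul0e.
Qed.

Lemma integral_setT_indic (A : set T) : measurable A ->
  \int[mu]_x (\1_A x)%:E = mu A.
Proof. by move=> mA; rewrite integral_indic// setIT. Qed.

End nonneg_integral.

(** * Integrals over the sections of a measurable relation *)

Section relation_mass.
Local Open Scope ereal_scope.
Context d (T : measurableType d) (R : realType).
Variable mu : {sigma_finite_measure set T -> \bar R}.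
Implicit Types (S : T -> set T) (f g : T -> \bar R).

Definition mass S f (x : T) : \bar R := \int[mu]_y ((\1_(S x) y)%:E * f y).

Lemma mass_ge0 S f x : (forall y, 0 <= f y) -> 0 <= mass S f x.
Proof. by move=> f0; apply: integral_ge0 => y _; rewrite mule_ge0// lee_fin. Qed.

Lemma le_mass S S' f g x x' : (forall y, 0 <= f y) -> (forall y, 0 <= g y) ->
  (forall y, S x y -> S' x' y /\ f y <= g y) -> mass S f x <= mass S' g x'.
Proof.
move=> f0 g0 H; apply: le_integral_nonmeas => y _.
  by rewrite mule_ge0// lee_fin.
rewrite !indicE; have [/set_mem/H[Sy fg]|_] := boolP (y \in S x).
  by rewrite mem_set// !mul1e.
by rewrite mul0e mule_ge0// lee_fin.
Qed.

Lemma eq_mass S S' f g x x' : (forall y, 0 <= f y) -> (forall y, 0 <= g y) ->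
  (forall y, S x y <-> S' x' y) -> (forall y, S x y -> f y = g y) ->
  mass S f x = mass S' g x'.
Proof.
move=> f0 g0 SS fg; apply/eqP; rewrite eq_le; apply/andP; split.
  by apply: le_mass => // y Sy; split; [exact/SS|rewrite fg].
by apply: le_mass => // y /SS Sy; split => //; rewrite fg.
Qed.

Section measurable_relation.
Variable S : T -> set T.
Hypothesis mS : measurable [set z : T * T | S z.1 z.2].

Lemma measurable_rel x : measurable (S x).
Proof.
have := measurable_xsection x mS; congr (measurable _).
by apply/seteqP; split => y; rewrite /xsection/= inE.
Qed.

Lemma measurable_mass_pair f : measurable_fun setT f ->
  measurable_fun setT (fun z : T * T => (\1_(S z.1) z.2)%:E * f z.2).
Proof.
move=> mf; apply: measurable_mule; last exact: measurableT_comp.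
apply/measurable_EFinP.
by rewrite (_ : (fun z => _) = \1_[set z : T * T | S z.1 z.2]).
Qed.

Lemma measurable_mass f : measurable_fun setT f -> (forall y, 0 <= f y) ->
  measurable_fun setT (mass S f).
Proof.
move=> mf f0.
apply: (measurable_fun_fubini_tonelli_F
  (fun z : T * T => (\1_(S z.1) z.2)%:E * f z.2)).
  exact: measurable_mass_pair.
by move=> z; rewrite mule_ge0// lee_fin.
Qed.

(** Tonelli on the graph of [S], with [S'] the converse relation. For a symmetric relation it makes
    the averaging operators self-adjoint, which is how integrals of means are computed below. *)
Lemma mass_swap S' f g : (forall x y, S x y <-> S' y x) ->
  measurable_fun setT f -> measurable_fun setT g ->
  (forall y, 0 <= f y) -> (forall y, 0 <= g y) ->
  \int[mu]_x (f x * mass S g x) = \int[mu]_y (g y * mass S' f y).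
Proof.
move=> SS mf mg f0 g0.
transitivity (\int[mu]_x \int[mu]_y (f x * ((\1_(S x) y)%:E * g y))).
  apply: eq_integral => x _; rewrite ge0_integralZl//.
    apply: measurable_mule => //; apply/measurable_EFinP.
    exact/measurable_indic/measurable_rel.
  by move=> y _; rewrite mule_ge0// lee_fin.
rewrite (fubini_tonelli
  (fun z : T * T => f z.1 * ((\1_(S z.1) z.2)%:E * g z.2)))//=; first last.
- by move=> z; rewrite !mule_ge0// lee_fin.
- apply: measurable_mule; first exact: measurableT_comp.
  exact: measurable_mass_pair.
apply: eq_integral => y _; rewrite -ge0_integralZl//; last 2 first.
- apply: measurable_mule => //; apply/measurable_EFinP.
  apply: measurable_indic.
  have := measurable_ysection y mS; congr (measurable _).
  by apply/seteqP; split => x; rewrite /ysection/= inE; move/SS.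
- by move=> x _; rewrite mule_ge0// lee_fin.
apply: eq_integral => x _; rewrite muleCA muleA muleC; congr (_ * (_ * _)).
rewrite !indicE; suff -> : (y \in S x) = (x \in S' y) by [].
by apply/idP/idP => /set_mem/SS/mem_set.
Qed.

Lemma massZ (c : R) f x : (0 <= c)%R -> measurable_fun setT f ->
  (forall y, 0 <= f y) -> mass S (fun y => c%:E * f y) x = c%:E * mass S f x.
Proof.
move=> c0 mf f0; rewrite /mass -ge0_integralZl ?lee_fin//; last 2 first.
- apply: measurable_mule => //; apply/measurable_EFinP.
  exact/measurable_indic/measurable_rel.
- by move=> y _; rewrite mule_ge0// lee_fin.
by apply: eq_integral => y _; rewrite muleCA.
Qed.

Lemma massD f g x : measurable_fun setT f -> (forall y, 0 <= f y) ->
  measurable_fun setT g -> (forall y, 0 <= g y) ->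
  mass S (fun y => f y + g y) x = mass S f x + mass S g x.
Proof.
move=> mf f0 mg g0.
have m h : measurable_fun setT h ->
    measurable_fun setT (fun y => (\1_(S x) y)%:E * h y).
  move=> mh; apply: measurable_mule => //; apply/measurable_EFinP.
  exact/measurable_indic/measurable_rel.
rewrite /mass -ge0_integralD//; first last.
- exact: m.
- by move=> y _; rewrite mule_ge0// lee_fin.
- exact: m.
- by move=> y _; rewrite mule_ge0// lee_fin.
by apply: eq_integral => y _; rewrite ge0_muleDr.
Qed.

Lemma mass_cst x : mass S (cst 1) x = mu (S x).
Proof.
rewrite /mass; under eq_integral do rewrite mule1.
by rewrite integral_indic ?setIT//; exact: measurable_rel.
Qed.

Lemma mass_poweR (b p : R) f x : measurable_fun setT f -> (forall y, 0 <= f y) ->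
  (1 <= p)%R -> (0 < b)%R -> mu (S x) <= b%:E ->
  mass S f x `^ p <= (b `^ (p - 1))%:E * mass S (fun y => f y `^ p) x.
Proof.
move=> mf f0 p1 b0 Sb; apply: jensen_poweR => //.
  exact/measurable_EFinP/measurable_indic/measurable_rel.
by rewrite integral_indic ?setIT//; exact: measurable_rel.
Qed.

End measurable_relation.
End relation_mass.

(** * Layer-cake formulas *)

Section layer_cake.
Local Open Scope ereal_scope.
Context (R : realType).
Notation leb := (@lebesgue_measure R).

Lemma integral_powR_le (a X : R) : (0 < a)%R -> (0 < X)%R ->
  \int[leb]_(t in `]0%R, X]) (t `^ (a - 1))%:E <= (a^-1 * X `^ a)%:E.
Proof.
move=> a0 X0.
(* For a < 1 the integrand is unbounded at 0, so the interval is exhausted by compact ones. The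
   shift [k.+2] keeps the left end strictly below [X] already for k = 0, as the fundamental theorem
   of calculus asks. *)
pose F k : set (measurableTypeR R) := `[(X / k.+2%:R)%R, X]%classic.
have Xk (k : nat) : (0 < X / k.+2%:R)%R by rewrite divr_gt0.
have UF : `]0%R, X]%classic = \bigcup_k F k.
  apply/seteqP; split => [t /=|t [k _]].
    rewrite in_itv/= => /andP[t0 tX].
    have [k kt] : exists k : nat, (X / t <= k%:R)%R.
      exists (Num.bound (X / t)).
      by apply: ltW; apply: archi_boundP; rewrite divr_ge0 ?ltW.
    exists k => //; rewrite /F/= in_itv/= tX andbT ler_pdivrMr// mulrC -ler_pdivrMr//.
    by rewrite (le_trans kt)// ler_nat; lia.
  rewrite /F/= !in_itv/= => /andP[h ->]; rewrite andbT.
  exact: lt_le_trans h.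
have mf : measurable_fun setT (fun t : measurableTypeR R => (t `^ (a - 1))%:E).
  by apply/measurable_EFinP; exact: measurable_powR.
have ndF : nondecreasing_seq F.
  move=> i j ij; apply/subsetPset => t; rewrite /F/= !in_itv/= => /andP[h ->].
  rewrite andbT (le_trans _ h)// ler_pM2l// lef_pV2 ?posrE// ler_nat; lia.
rewrite UF.
have cv : \int[leb]_(t in F k) (t `^ (a - 1))%:E @[k --> \oo] -->
    \int[leb]_(t in \bigcup_k F k) (t `^ (a - 1))%:E.
  apply: ge0_nondecreasing_set_cvg_integral => //.
  - by move=> i; exact: measurable_itv.
  - by move=> i; exact: measurable_funTS.
  - by move=> i t _; rewrite lee_fin powR_ge0.
rewrite -(cvg_lim _ cv)//; apply: lime_le; first by apply/cvg_ex; eexists; exact: cv.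
apply: nearW => k.
have dF (t : R) : (0 < t)%R ->
    is_derive t 1%R (fun t : R => a^-1 * t `^ a)%R (t `^ (a - 1))%R.
  move=> t0; have h := is_derive1_powR a t0.
  have -> : (t `^ (a - 1) = a^-1 *: (a * t `^ (a - 1)))%R.
    by rewrite /GRing.scale/= mulrA mulVf ?mul1r// gt_eqF.
  exact: is_deriveZ.
have kX : (X / k.+2%:R < X)%R by rewrite ltr_pdivrMr// ltr_pMr// ltr1n.
have ct (g : R -> R) : (forall t, (0 < t)%R -> derivable g t 1%R) ->
    {within `[(X / k.+2%:R)%R, X], continuous g}%R.
  move=> dg; apply: derivable_within_continuous => t.
  rewrite in_itv/= => /andP[h _]; apply: dg; exact: lt_le_trans h.
rewrite (@continuous_FTC2 _ _ (fun t => a^-1 * t `^ a)%R).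
- by rewrite -EFinB lee_fin gerBl mulr_ge0 ?powR_ge0// invr_ge0 ltW.
- exact: kX.
- apply: ct => t t0; apply: ex_derive; exact: is_derive1_powR.
- have cF := ct _ (fun t t0 => @ex_derive _ _ _ _ _ _ _ (dF t t0)).
  have [_ cl cr] := (continuous_within_itvP _ kX).1 cF.
  split => //.
  move=> t; rewrite in_itv/= => /andP[h _].
  exact: (@ex_derive _ _ _ _ _ _ _ (dF t (lt_trans (Xk k) h))).
- move=> t; rewrite in_itv/= => /andP[h _].
  rewrite derive1E; exact: (@derive_val _ _ _ _ _ _ _ (dF t (lt_trans (Xk k) h))).
Qed.

Lemma measure_below (Y : \bar R) : 0 <= Y ->
  leb [set t | (0 < t)%R /\ t%:E < Y] = Y.
Proof.
case: Y => [r| |//] r0.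
- rewrite (_ : [set t | _] = `]0%R, r[%classic); last first.
    by apply/seteqP; split => t/=; rewrite in_itv/= lte_fin => /andP.
  rewrite lebesgue_measure_itv/= lte_fin; case: ltP => h.
    by rewrite -EFinD subr0.
  by congr (_%:E); apply/eqP; rewrite eq_le h andbT.
- rewrite (_ : [set t | _] = `]0%R, +oo[%classic).
    by rewrite lebesgue_measure_itv/= ltry.
  apply/seteqP; split => t/=; rewrite in_itv/= andbT; first by case.
  by rewrite ltry.
Qed.

(** The inner integral of the Marcinkiewicz argument in [maxf_strong_type]. There t is the p-th
    power of a height, so that the factor 1/height of the weak type bound reads t^(-1/p). *)
Lemma integral_powR_below (p : R) (y : \bar R) : (1 < p)%R -> 0 <= y ->
  \int[leb]_t ((\1_[set u : R | (0 < u)%R /\ (u%:E < y `^ p)%E] t)%:E * (t `^ (- p^-1))%:E)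
  <= ((1 - p^-1)^-1)%:E * y `^ (p - 1).
Proof.
move=> p1 y0; have p0 : (0 < p)%R by exact: lt_trans p1.
have a0 : (0 < 1 - p^-1)%R by rewrite subr_gt0 invf_lt1.
case: y y0 => [y y0| _|//]; last first.
  by rewrite [X in _ * X]poweRyr ?subr_eq0 ?gt_eqF// mulry gtr0_sg ?invr_gt0// mul1e leey.
rewrite !poweR_EFin; rewrite lee_fin le_eqVlt in y0; case/predU1P: y0 => [<-|y0].
  rewrite integral0_eq; first by rewrite mule_ge0// lee_fin ?invr_ge0 ?powR_ge0// ltW.
  move=> t _; rewrite indicE memNset ?mul0e//= => -[t0].
  by rewrite powR0 ?gt_eqF// lte_fin => /(lt_trans t0); rewrite ltxx.
have X0 : (0 < y `^ p)%R by exact: powR_gt0.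
rewrite -integral_indicM.
apply: (@le_trans _ _ (\int[leb]_(t in `]0%R, (y `^ p)%R]) (t `^ (1 - p^-1 - 1))%:E)).
  have -> : (1 - p^-1 - 1 = - p^-1)%R by rewrite addrAC subrr add0r.
  rewrite [leLHS]integral_mkcond [leRHS]integral_mkcond.
  apply: le_integral_nonmeas => t _; rewrite !patchE.
    by case: ifPn => // _; rewrite lee_fin powR_ge0.
  case: ifPn => [/set_mem/= [t0 ty]|_].
    by rewrite mem_set//= in_itv/= t0/= ltW.
  by case: ifPn => // _; rewrite lee_fin powR_ge0.
apply: le_trans (integral_powR_le a0 X0) _.
rewrite -EFinM lee_fin -powRrM.
suff -> : (p * (1 - p^-1) = p - 1)%R by [].
by rewrite mulrBr mulr1 divff ?gt_eqF.
Qed.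

Context d (T : measurableType d) (mu : {sigma_finite_measure set T -> \bar R}).

Lemma measurable_below (Y : T -> \bar R) : measurable_fun setT Y ->
  measurable [set z : measurableTypeR R * T | (0 < z.1)%R /\ z.1%:E < Y z.2].
Proof.
move=> mY; apply: measurableI.
  have := @measurable_fst _ _ (measurableTypeR R) T measurableT _ (measurable_itv `]0%R, +oo[).
  congr (measurable _); apply/seteqP.
  by split => z /=; rewrite in_itv/= andbT; [case|split].
rewrite -[X in measurable X]setTI; apply: measurable_lte => //=.
  by apply/measurable_EFinP; exact: measurable_fst.
exact: (measurableT_comp mY).
Qed.

(** [A] is a set of pairs (height, point). The strong type bounds for [maxf] and for the capacity
    both rest on this exchange, with weights [h] of the form t^(-1/p) and 1/t; [layer_cake] is the
    case of constant weights. *)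
Lemma layer_tonelli (h : R -> \bar R) (g : T -> \bar R) (A : set (measurableTypeR R * T)) :
  measurable_fun setT (h : measurableTypeR R -> \bar R) -> measurable_fun setT g ->
  (forall t, 0 <= h t) -> (forall x, 0 <= g x) -> measurable A ->
  \int[leb]_t (h t * \int[mu]_x ((\1_A (t, x))%:E * g x)) =
  \int[mu]_x (g x * \int[leb]_t ((\1_A (t, x))%:E * h t)).
Proof.
move=> mh mg h0 g0 mA.
have mA1 t : measurable_fun setT (fun x => (\1_A (t, x))%:E : \bar R).
  apply/measurable_EFinP.
  exact: (measurableT_comp (measurable_indic mA) (measurable_pair1 t)).
have mA2 x : measurable_fun setT (fun t : measurableTypeR R => (\1_A (t, x))%:E : \bar R).
  apply/measurable_EFinP.
  exact: (measurableT_comp (measurable_indic mA) (measurable_pair2 x)).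
transitivity (\int[leb]_t \int[mu]_x (h t * ((\1_A (t, x))%:E * g x))).
  apply: eq_integral => t _; rewrite integralZl_ge0//; first exact: measurable_mule.
  by move=> x; rewrite mule_ge0// lee_fin.
rewrite (@fubini_tonelli _ _ _ _ _ leb mu
  (fun z => h z.1 * ((\1_A z)%:E * g z.2)))//=; first last.
- by move=> z; rewrite !mule_ge0// lee_fin.
- apply: measurable_mule; first exact: (measurableT_comp mh).
  apply: measurable_mule; last exact: (measurableT_comp mg).
  exact/measurable_EFinP/measurable_indic.
apply: eq_integral => x _; rewrite -integralZl_ge0//; last 2 first.
- exact: measurable_mule.
- by move=> t; rewrite mule_ge0// lee_fin.
by apply: eq_integral => t _; rewrite muleCA muleA muleC.
Qed.

Lemma layer_cake (Y : T -> \bar R) : measurable_fun setT Y -> (forall x, 0 <= Y x) ->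
  \int[mu]_x Y x = \int[leb]_(t in `]0%R, +oo[) mu [set x | t%:E < Y x].
Proof.
move=> mY Y0; pose A := [set z : measurableTypeR R * T | (0 < z.1)%R /\ z.1%:E < Y z.2].
have := @layer_tonelli (cst 1) (cst 1) A (measurable_cst _) (measurable_cst _)
  (fun=> lee01) (fun=> lee01) (measurable_below mY).
under eq_integral do under eq_integral do rewrite mule1.
under [RHS]eq_integral do rewrite mul1e.
move=> H; transitivity (\int[mu]_x \int[leb]_t ((\1_A (t, x))%:E * 1)).
  apply: eq_integral => x _; under eq_integral do rewrite mule1.
  rewrite -[LHS](measure_below (Y0 x)) -integral_setT_indic//.
  rewrite -[X in measurable X]setTI.
  exact: (measurable_pair2 x measurableT (measurable_below mY)).
apply: (etrans (esym H)); rewrite [RHS]integral_mkcond.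
apply: eq_integral => t _; rewrite mul1e patchE.
case: ifPn => [/set_mem/=|/negP t0].
  rewrite in_itv/= andbT => t0; rewrite -integral_setT_indic.
    apply: eq_integral => x _; rewrite !indicE.
    suff -> : ((t, x) \in A) = (x \in [set y | t%:E < Y y]) by [].
    apply/idP/idP => /set_mem/= h; apply/mem_set; first by case: h.
    by split.
  rewrite -[X in measurable X]setTI; exact: emeasurable_fun_o_infty.
rewrite integral0_eq// => x _; rewrite indicE memNset// => -[/= h _]; apply: t0.
by apply/mem_set; rewrite /= in_itv/= andbT.
Qed.

End layer_cake.

(** * Dyadic potentials and capacities *)

Section dyadic.
Local Open Scope ereal_scope.
Context d (T : measurableType d) (R : realType).
Variable mu : {sigma_finite_measure set T -> \bar R}.
(** [Q k x] is the cell of generation [k] containing [x], and [N k x] its union with the adjacent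
    cells. [W] is the measure of a cell of generation 0, [D] the ratio of measures between
    generations and [B] the number of cells in a neighbourhood; on R^n they are 4^n, 2^n and 3^n.
    [N_comp] plays the part of the triangle inequality: two steps at one generation make a single
    step at the next coarser one. *)
Variables (Q N : nat -> T -> set T) (W D B : R).
Hypothesis mQ : forall k, measurable [set z : T * T | Q k z.1 z.2].
Hypothesis mN : forall k, measurable [set z : T * T | N k z.1 z.2].
Hypothesis Q_sym : forall k x y, Q k x y -> Q k y x.
Hypothesis Q_trans : forall k x y z, Q k x y -> Q k y z -> Q k x z.
Hypothesis Q_nested : forall k x y, Q k.+1 x y -> Q k x y.
Hypothesis N_refl : forall k x, N k x x.
Hypothesis N_sym : forall k x y, N k x y -> N k y x.
Hypothesis N_Q : forall k x y z, N k x y -> Q k y z -> N k x z.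
Hypothesis N_comp : forall k x y z, N k.+1 x y -> N k.+1 y z -> N k x z.
Hypothesis W_gt0 : (0 < W)%R.
Hypothesis D_ge1 : (1 <= D)%R.
Hypothesis B_ge1 : (1 <= B)%R.
Hypothesis mu_Q : forall k x, mu (Q k x) = (W / D ^+ k)%:E.
Hypothesis mu_N : forall k x, mu (N k x) = (B * (W / D ^+ k))%:E.

Let w k : R := (W / D ^+ k)%R.
Let v k : R := (B * w k)%R.

Let D_gt0 : (0 < D)%R. Proof. exact: lt_le_trans D_ge1. Qed.
Let B_gt0 : (0 < B)%R. Proof. exact: lt_le_trans B_ge1. Qed.
Let w_gt0 k : (0 < w k)%R. Proof. by rewrite divr_gt0// exprn_gt0. Qed.
Let v_gt0 k : (0 < v k)%R. Proof. by rewrite mulr_gt0. Qed.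
Let vS k : (v k = D * v k.+1)%R.
Proof. by rewrite /v /w exprS; field; rewrite ?gt_eqF ?exprn_gt0. Qed.

Definition avg k f x : \bar R := locked ((v k)^-1%:E * mass mu (N k) f x).

Lemma avgE k f x : avg k f x = (v k)^-1%:E * mass mu (N k) f x.
Proof. by rewrite /avg -lock. Qed.

Lemma avg_ge0 k f x : (forall y, 0 <= f y) -> 0 <= avg k f x.
Proof.
by move=> f0; rewrite avgE mule_ge0 ?mass_ge0// lee_fin invr_ge0 ltW.
Qed.

Lemma measurable_avg k f : measurable_fun setT f -> (forall y, 0 <= f y) ->
  measurable_fun setT (avg k f).
Proof.
move=> mf f0; rewrite (_ : avg k f = fun x => (v k)^-1%:E * mass mu (N k) f x).
  by apply: measurable_mule => //; exact: measurable_mass.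
by apply/funext => x; exact: avgE.
Qed.

Lemma mass_avg k f x : mass mu (N k) f x = (v k)%:E * avg k f x.
Proof. by rewrite avgE muleA -EFinM divff ?mul1e// gt_eqF. Qed.

Lemma N_nested k x y : N k.+1 x y -> N k x y.
Proof. by move/N_comp; exact. Qed.

Lemma N_le k j x y : (k <= j)%N -> N j x y -> N k x y.
Proof.
elim: j => [|j IH]; first by rewrite leqn0 => /eqP ->.
by rewrite leq_eqVlt => /predU1P[->//|kj /N_nested]; exact: IH.
Qed.

Lemma Q_le k j x y : (k <= j)%N -> Q j x y -> Q k x y.
Proof.
elim: j => [|j IH]; first by rewrite leqn0 => /eqP ->.
by rewrite leq_eqVlt => /predU1P[->//|kj /Q_nested]; exact: IH.
Qed.

Lemma le_avg k f g x : (forall y, 0 <= f y) -> (forall y, 0 <= g y) ->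
  (forall y, N k x y -> f y <= g y) -> avg k f x <= avg k g x.
Proof.
move=> f0 g0 fg; rewrite !avgE lee_wpmul2l ?lee_fin ?invr_ge0 ?(ltW (v_gt0 _))//.
by apply: le_mass => // y Ny; split => //; exact: fg.
Qed.

Lemma eq_avg k f g x : (forall y, 0 <= f y) -> (forall y, 0 <= g y) ->
  (forall y, N k x y -> f y = g y) -> avg k f x = avg k g x.
Proof.
by move=> f0 g0 fg; rewrite !avgE; congr (_ * _); exact: eq_mass.
Qed.

Lemma avgZ k (c : R) f x : (0 <= c)%R -> measurable_fun setT f ->
  (forall y, 0 <= f y) -> avg k (fun y => c%:E * f y) x = c%:E * avg k f x.
Proof. by move=> c0 mf f0; rewrite !avgE massZ// muleCA. Qed.

Lemma avgD k f g x : measurable_fun setT f -> (forall y, 0 <= f y) ->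
  measurable_fun setT g -> (forall y, 0 <= g y) ->
  avg k (fun y => f y + g y) x = avg k f x + avg k g x.
Proof. by move=> mf f0 mg g0; rewrite !avgE massD// ge0_muleDr ?mass_ge0. Qed.

Lemma avg_cst k (c : R) x : (0 <= c)%R -> avg k (cst c%:E) x = c%:E.
Proof.
move=> c0; rewrite (_ : cst c%:E = fun y => c%:E * cst 1 y); last first.
  by apply/funext => y; rewrite /= mule1.
rewrite avgZ// avgE mass_cst// mu_N -!EFinM.
by rewrite -/(w k) -/(v k) mulVf ?mulr1// gt_eqF.
Qed.

Lemma avg_poweR k f x p : measurable_fun setT f -> (forall y, 0 <= f y) ->
  (1 <= p)%R -> avg k f x `^ p <= avg k (fun y => f y `^ p) x.
Proof.
move=> mf f0 p1; rewrite !avgE poweRM ?mass_ge0// ?lee_fin ?invr_ge0 ?(ltW (v_gt0 _))//.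
have := @mass_poweR _ _ _ mu _ (mN k) (v k) p f x mf f0 p1 (v_gt0 k).
rewrite mu_N => /(_ (lexx _)) h.
rewrite poweR_EFin (le_trans (lee_wpmul2l _ h)) ?lee_fin ?powR_ge0//.
rewrite muleA -EFinM lee_wpmul2r ?mass_ge0// => [y|]; first exact: poweR_ge0.
rewrite lee_fin -powR_inv1 ?(ltW (v_gt0 _))// -powRrM -powRD ?(gt_eqF (v_gt0 k)) ?implybT//.
by apply: eq_refl || (rewrite le_eqVlt; apply/orP; left; apply/eqP; congr (_ `^ _)%R; lra).
Qed.

(** By [N_comp], [N k.+1 x] lies in [N k y], and [D] is the ratio of their measures. This is the
    comparison used each time a mean is moved to a nearby point, at the price of one generation. *)
Lemma avg_comp k f x y : (forall y, 0 <= f y) -> N k.+1 x y ->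
  avg k.+1 f x <= D%:E * avg k f y.
Proof.
move=> f0 xy; rewrite !avgE muleA -EFinM.
have -> : (D * (v k)^-1 = (v k.+1)^-1)%R.
  by rewrite vS invfM mulrA divff ?mul1r// gt_eqF.
rewrite lee_wpmul2l ?lee_fin ?invr_ge0 ?(ltW (v_gt0 _))//.
apply: le_mass => // z xz; split => //.
by apply: N_comp xz; exact: N_sym.
Qed.

Lemma avg_swap k f g : measurable_fun setT f -> measurable_fun setT g ->
  (forall y, 0 <= f y) -> (forall y, 0 <= g y) ->
  \int[mu]_x (f x * avg k g x) = \int[mu]_x (g x * avg k f x).
Proof.
move=> mf mg f0 g0.
have vi : 0 <= (v k)^-1%:E by rewrite lee_fin invr_ge0 ltW.
under eq_integral do rewrite avgE muleCA.
under [RHS]eq_integral do rewrite avgE muleCA.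
have mm h : measurable_fun setT h -> (forall y, 0 <= h y) ->
    measurable_fun setT (mass mu (N k) h) by move=> mh h0; exact: measurable_mass.
have E h1 h2 : measurable_fun setT h1 -> measurable_fun setT h2 ->
    (forall y, 0 <= h1 y) -> (forall y, 0 <= h2 y) ->
    \int[mu]_x ((v k)^-1%:E * (h1 x * mass mu (N k) h2 x)) =
    (v k)^-1%:E * \int[mu]_x (h1 x * mass mu (N k) h2 x).
  move=> mh1 mh2 h10 h20; apply: integralZl_ge0 vi _ _.
    by apply: measurable_mule => //; exact: mm.
  by move=> x; rewrite mule_ge0 ?mass_ge0.
rewrite (E f g mf mg f0 g0) (E g f mg mf g0 f0).
by congr (_ * _); apply: mass_swap => // x y; split; exact: N_sym.
Qed.

(** * The dyadic maximal function *)

Definition maxf f x : \bar R := ereal_sup (range (fun k => avg k f x)).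

Lemma maxf_ge k f x : avg k f x <= maxf f x.
Proof. by apply: ereal_sup_ubound; exists k. Qed.

Lemma maxf_ge0 f x : (forall y, 0 <= f y) -> 0 <= maxf f x.
Proof. by move=> f0; rewrite (le_trans _ (maxf_ge 0 f x))// avg_ge0. Qed.

Lemma measurable_maxf f : measurable_fun setT f -> (forall y, 0 <= f y) ->
  measurable_fun setT (maxf f).
Proof.
move=> mf f0.
rewrite (_ : maxf f = fun x => esups (fun k => avg k f x) 0%N).
  by apply: measurable_fun_esups => k; exact: measurable_avg.
apply/funext => x; congr ereal_sup.
by apply/seteqP; split => _ [k _ <-]; exists k.
Qed.

(* Calderon-Zygmund stopping: the cells of [S k] are the largest ones on which
   the mean exceeds [l], and the level set of [maxf f] lies in the union over
   [k] of the [N k]-neighbourhoods of [S k]. *)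
Lemma maxf_weak_type f (l : R) : measurable_fun setT f -> (forall y, 0 <= f y) ->
  (0 < l)%R ->
  l%:E * mu [set x | l%:E < maxf f x] <= B%:E * \int[mu]_x f x.
Proof.
move=> mf f0 l0.
have l0' : 0 <= l%:E by rewrite lee_fin ltW.
have mmQ h k : measurable_fun setT h -> (forall y, 0 <= h y) ->
    measurable_fun setT (mass mu (Q k) h) by move=> mh h0; exact: measurable_mass.
have mmN h k : measurable_fun setT h -> (forall y, 0 <= h y) ->
    measurable_fun setT (mass mu (N k) h) by move=> mh h0; exact: measurable_mass.
pose P j := [set x | (l * w j)%:E < mass mu (Q j) f x].
pose S k := P k `&` ~` (\bigcup_(j in `I_k) P j).
have mP j : measurable (P j).
  by rewrite -[P j]setTI; apply: emeasurable_fun_o_infty => //; exact: mmQ.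
have mS k : measurable (S k).
  apply: measurableI => //; apply: measurableC.
  by apply: bigcup_measurable => j _.
have mIS k : measurable_fun setT (fun x => (\1_(S k) x)%:E : \bar R).
  exact/measurable_EFinP/measurable_indic.
have IS0 k x : 0 <= (\1_(S k) x)%:E :> \bar R by rewrite lee_fin.
have tS : trivIset setT S.
  apply/trivIsetP => i j _ _; rewrite neq_ltn.
  wlog ij : i j / (i < j)%N.
    move=> H /orP[ij|ji]; first by apply: H => //; rewrite ij.
    by rewrite setIC; apply: H => //; rewrite ji.
  move=> _; apply/seteqP; split => // x [[Pi _] [_]]; apply.
  by exists i.
have QP j x y : Q j x y -> P j x -> P j y.
  rewrite /P/= => xy; congr (_ < _); apply: eq_mass => // z.
  by split; [apply: Q_trans; exact: Q_sym|exact: Q_trans].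
have QS k x y : Q k x y -> S k x -> S k y.
  move=> xy [Pk nP]; split; first exact: QP Pk.
  move=> [j/= jk Pj]; apply: nP; exists j => //; apply: QP Pj.
  by apply: Q_sym; apply: Q_le xy; exact: ltnW.
(* The stopping inequality is integrated over [S k] and the order of integration is exchanged. Since
   [S k] is a union of cells, the mass of [S k] in [Q k x] is [w k] for [x] in [S k] and 0
   elsewhere. *)
have H1 k : l%:E * mu (S k) <= \int[mu]_(x in S k) f x.
  rewrite integral_indicM.
  have wk : 0 <= (w k)%:E by rewrite lee_fin ltW.
  rewrite -(@lee_pmul2l _ (w k)%:E) ?lte_fin//.
  rewrite -(integral_setT_indic mu (mS k)).
  have lw : 0 <= (w k * l)%:E by rewrite lee_fin; exact/ltW/mulr_gt0.
  rewrite muleA -EFinM -integralZl_ge0//.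
  rewrite -integralZl_ge0//; last 2 first.
  - exact: measurable_mule.
  - by move=> x; rewrite mule_ge0.
  apply: (@le_trans _ _ (\int[mu]_x ((\1_(S k) x)%:E * mass mu (Q k) f x))).
    apply: le_integral_nonmeas => x _.
      exact: mule_ge0.
    rewrite indicE; have [/set_mem[Pk _]|_] := boolP (x \in S k).
      by rewrite mul1e mule1 mulrC ltW.
    by rewrite mule0 mul0e.
  rewrite (@mass_swap _ _ _ mu _ (mQ k) (Q k))//; last by move=> x y; split; exact: Q_sym.
  apply: le_integral_nonmeas => x _; first by rewrite mule_ge0// mass_ge0.
  rewrite muleA [leRHS]muleC lee_wpmul2l//.
  have [xS|xS] := boolP (x \in S k).
    rewrite [\1_(S k) x]indicE xS mule1 -(mu_Q k x) -(mass_cst _ (mQ k)).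
    apply: le_mass => // y Qy; split => //=; rewrite lee_fin indicE.
    by case: (_ \in _).
  rewrite [\1_(S k) x]indicE (negbTE xS) mule0 /mass integral0_eq// => y _.
  rewrite !indicE; have [/set_mem Qxy|_] := boolP (y \in Q k x); last by rewrite mul0e.
  rewrite memNset ?mule0// => Sy; move/negP: xS; apply; apply/mem_set.
  by apply: QS Sy; exact: Q_sym.
(* The points whose neighbourhood meets [S k]. A neighbourhood that meets [S k] contains a whole
   cell of it, so the condition can be put on the measure of the intersection, which is measurable
   in [x]. *)
pose F k := [set x | (w k)%:E <= mass mu (N k) (fun y => (\1_(S k) y)%:E) x].
have mF k : measurable (F k).
  by rewrite -[F k]setTI; apply: emeasurable_fun_c_infty => //; exact: mmN.
have H2 k : mu (F k) <= B%:E * mu (S k).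
  rewrite -(@lee_pmul2l _ (w k)%:E) ?lte_fin//.
  apply: (@le_trans _ _ (\int[mu]_x (cst 1 x * mass mu (N k) (fun y => (\1_(S k) y)%:E) x))).
    rewrite -(integral_setT_indic mu (mF k)) -integralZl_ge0 ?lee_fin ?(ltW (w_gt0 _))//; last first.
      exact/measurable_EFinP/measurable_indic.
    apply: le_integral_nonmeas => x _; first by rewrite mule_ge0 ?lee_fin ?(ltW (w_gt0 _)).
    rewrite mul1e indicE; have [/set_mem Fx|_] := boolP (x \in F k).
      by rewrite mule1.
    by rewrite mule0 mass_ge0.
  rewrite (@mass_swap _ _ _ mu _ (mN k) (N k))//; last by move=> x y; split; exact: N_sym.
  under eq_integral do rewrite mass_cst// mu_N muleC.
  rewrite integralZl_ge0//; last by rewrite lee_fin; exact/ltW/v_gt0.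
  by rewrite integral_setT_indic// muleA -EFinM mulrC.
have H3 : [set x | l%:E < maxf f x] `<=` \bigcup_k F k.
  move=> x /= /ereal_sup_gt[_ [k _ <-] lk].
  have [z [xz Pz]] : exists z, N k x z /\ P k z.
    apply: contrapT => nz; move: lk; apply/negP; rewrite -leNgt.
    rewrite -(@lee_pmul2l _ (v k)%:E) ?lte_fin// -mass_avg.
    (* [N k x] is a union of cells, so [f] may be replaced by its cell means there; if none of them
       exceeded [l], neither would the mean over [N k x]. *)
    apply: (@le_trans _ _ (\int[mu]_y ((w k)^-1%:E * ((\1_(N k x) y)%:E * mass mu (Q k) f y)))).
      rewrite integralZl_ge0 ?lee_fin ?invr_ge0 ?(ltW (w_gt0 _))//; last 2 first.
      - apply: measurable_mule; last exact: mmQ.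
        exact/measurable_EFinP/measurable_indic/measurable_rel.
      - by move=> y; rewrite mule_ge0 ?mass_ge0 ?lee_fin.
      rewrite (@mass_swap _ _ _ mu _ (mQ k) (Q k))//; first last.
      - exact/measurable_EFinP/measurable_indic/measurable_rel.
      - by move=> y z; split; exact: Q_sym.
      have m1 : measurable_fun setT (fun y => (\1_(N k x) y)%:E : \bar R).
        exact/measurable_EFinP/measurable_indic/measurable_rel.
      rewrite -integralZl_ge0 ?lee_fin ?invr_ge0 ?(ltW (w_gt0 _))//; last 2 first.
      - by apply: measurable_mule => //; apply: mmQ => // y; rewrite lee_fin.
      - by move=> y; rewrite mule_ge0 ?mass_ge0// => z; rewrite lee_fin.
      apply: le_integral_nonmeas => y _; first by rewrite mule_ge0 ?lee_fin.
      rewrite [leRHS]muleCA [leLHS]muleC lee_wpmul2l//.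
      rewrite indicE; have [/set_mem Nxy|_] := boolP (y \in N k x); last first.
        by rewrite mule_ge0 ?mass_ge0 ?lee_fin ?invr_ge0 ?(ltW (w_gt0 _))// => z; rewrite lee_fin.
      rewrite (@eq_mass _ _ _ _ (Q k) (Q k) _ (cst 1) y y)//; last first.
        by move=> z Qz; rewrite indicE mem_set//; exact: N_Q Qz.
      by rewrite mass_cst// mu_Q -EFinM mulVf// gt_eqF// (w_gt0 k).
    apply: (@le_trans _ _ (\int[mu]_y (l%:E * (\1_(N k x) y)%:E))).
      apply: le_integral_nonmeas => y _.
        by rewrite !mule_ge0 ?mass_ge0 ?lee_fin ?invr_ge0 ?(ltW (w_gt0 _)).
      rewrite indicE; have [/set_mem Nxy|_] := boolP (y \in N k x); last first.
        by rewrite mul0e !mule0.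
      rewrite mul1e mule1 lee_pdivrMl ?(w_gt0 k)// -EFinM mulrC leNgt.
      by apply/negP => Py; apply: nz; exists y.
    rewrite integralZl_ge0//; last first.
      exact/measurable_EFinP/measurable_indic/measurable_rel.
    have mNx : measurable (N k x) by exact: measurable_rel.
    have -> : \int[mu]_y (\1_(N k x) y)%:E = (v k)%:E.
      by rewrite (integral_setT_indic mu mNx); exact: mu_N.
    by rewrite muleC.
  (* The coarsest generation at which the cell of [z] has mean above [l]. It is at most [k], so that
     [N k x] is contained in [N j x]. *)
  have [j Pj jmin] := ex_minnP (ex_intro (fun j => `[< P j z >]) k (asboolT Pz)).
  have jk : (j <= k)%N by apply: jmin; apply/asboolP.
  have Sj : S j z.
    split; first exact/asboolP.
    move=> [i/= ij Pi]; have := jmin i (asboolT Pi).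
    by rewrite leqNgt ij.
  exists j => //; rewrite /F/= -(mu_Q j z) -(mass_cst _ (mQ j)).
  apply: le_mass => // y Qy; split.
    by apply: N_Q Qy; exact: N_le jk xz.
  by rewrite indicE mem_set//; exact: QS Sj.
have mM : measurable [set x | l%:E < maxf f x].
  rewrite -[X in measurable X]setTI; apply: emeasurable_fun_o_infty => //.
  exact: measurable_maxf.
have B0' : 0 <= B%:E by rewrite lee_fin ltW.
apply: (@le_trans _ _ (l%:E * \sum_(k <oo) mu (F k))).
  by rewrite lee_wpmul2l//; exact: measure_sigma_subadditive.
apply: (@le_trans _ _ (l%:E * \sum_(k <oo) (B%:E * mu (S k)))).
  by rewrite lee_wpmul2l//; apply: lee_nneseries.
rewrite nneseriesZl// muleCA lee_wpmul2l// -nneseriesZl//.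
apply: (@le_trans _ _ (\sum_(k <oo) \int[mu]_(x in S k) f x)).
  by apply: lee_nneseries => // k _; rewrite mule_ge0.
rewrite -ge0_integral_bigcup//; last exact: measurable_funTS.
by apply: ge0_subset_integral => //; exact: bigcup_measurable.
Qed.

(** Marcinkiewicz interpolation of the weak type bound with the trivial bound by the supremum. In
    the constant, 2 B comes from the weak type bound at half the height and the rest from
    [integral_powR_below] at [2 * f]. *)
Lemma maxf_strong_type p : (1 < p)%R -> exists2 C : R, (0 < C)%R &
  forall f, measurable_fun setT f -> (forall y, 0 <= f y) ->
  \int[mu]_x (maxf f x `^ p) <= C%:E * \int[mu]_x (f x `^ p).
Proof.
move=> p1; have p0 : (0 < p)%R by exact: lt_trans p1.
have a0 : (0 < 1 - p^-1)%R by rewrite subr_gt0 invf_lt1.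
exists (2 * B * ((1 - p^-1)^-1 * 2 `^ (p - 1)))%R.
  by rewrite !mulr_gt0// ?invr_gt0// powR_gt0.
move=> f mf f0.
have mM := measurable_maxf mf f0.
rewrite layer_cake; last 2 first.
- exact: measurable_poweR_fun.
- by move=> x; exact: poweR_ge0.
have m2f : measurable_fun setT (fun x => (2%:E * f x) `^ p).
  by apply: measurable_poweR_fun; exact: measurable_mule.
have f20 x : 0 <= 2%:E * f x by rewrite mule_ge0.
pose A := [set z : measurableTypeR R * T | (0 < z.1)%R /\ z.1%:E < (2%:E * f z.2) `^ p].
have mA : measurable A := measurable_below m2f.
pose h (t : R) : \bar R := (t `^ (- p^-1))%:E.
have mh : measurable_fun setT (h : measurableTypeR R -> \bar R).
  by apply/measurable_EFinP; exact: measurable_powR.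
have h0 t : 0 <= h t by rewrite lee_fin powR_ge0.
have step1 (t : R) : (0 < t)%R -> mu [set x | t%:E < maxf f x `^ p] <=
    (2 * B)%:E * (h t * \int[mu]_x ((\1_A (t, x))%:E * f x)).
  (* [t] is the p-th power of the height 2 l. The values of [f] up to [l] raise the maximal function
     by at most [l], so only [g], the part of [f] above [l], has to push it past [l]. *)
  move=> t0; pose l := (t `^ p^-1 / 2)%R.
  have l0 : (0 < l)%R by rewrite divr_gt0// powR_gt0.
  have tl : ((2 * l) `^ p = t)%R.
    rewrite /l mulrC divfK ?pnatr_eq0// -powRrM mulVf ?gt_eqF// powRr1// ltW//.
  pose g x := (\1_A (t, x))%:E * f x.
  have mg : measurable_fun setT g.
    apply: measurable_mule => //; apply/measurable_EFinP.
    exact: (measurableT_comp (measurable_indic mA) (measurable_pair1 t)).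
  have g0 x : 0 <= g x by rewrite mule_ge0// lee_fin.
  have fg x : f x <= l%:E + g x.
    rewrite /g indicE; have [_|/negP fA] := boolP ((t, x) \in A).
      by rewrite mul1e leeDr// lee_fin ltW.
    rewrite mul0e adde0 leNgt; apply/negP => lf; apply: fA; apply/mem_set.
    split => //=; rewrite -tl -poweR_EFin.
    rewrite ltNge; apply/negP => /(poweR_mono (p := p^-1)).
    rewrite invr_ge0 (ltW p0) poweR_ge0 => /(_ isT isT).
    have l20 : 0 <= (2 * l)%:E by rewrite lee_fin mulr_ge0// ltW.
    rewrite (poweRK p0 (f20 x)) (poweRK p0 l20) EFinM leNgt.
    by rewrite lte_pmul2l// lf.
  have sub : [set x | t%:E < maxf f x `^ p] `<=` [set x | l%:E < maxf g x].
    move=> x /= tM; rewrite ltNge; apply/negP => Mg; move: tM; apply/negP.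
    rewrite -leNgt -tl -poweR_EFin; apply: poweR_mono; first exact: ltW.
      exact: maxf_ge0.
    apply: ge_ereal_sup => _ [k _ <-].
    apply: (@le_trans _ _ (avg k (fun y => cst l%:E y + g y) x)).
      by apply: le_avg => // y; rewrite adde_ge0// lee_fin ltW.
    rewrite avgD//; last by move=> y; rewrite lee_fin ltW.
    rewrite avg_cst ?(ltW l0)//.
    have -> : (2 * l)%:E = l%:E + l%:E by rewrite -EFinD mulr2n mulrDl !mul1r.
    by rewrite leeD2l// (le_trans (maxf_ge k g x)).
  apply: (@le_trans _ _ (mu [set x | l%:E < maxf g x])).
    apply: le_measure => //; rewrite inE -[X in measurable X]setTI;
      apply: emeasurable_fun_o_infty => //; last exact: measurable_maxf.
    exact: measurable_poweR_fun.
  rewrite -(@lee_pmul2l _ l%:E) ?lte_fin//.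
  apply: le_trans (maxf_weak_type mg g0 l0) _.
  rewrite muleA muleA -!EFinM lee_wpmul2r ?integral_ge0// lee_fin.
  rewrite /h powRN (_ : l * (2 * B) * (t `^ p^-1)^-1 = B)%R//.
  rewrite /l; field.
  by rewrite ?gt_eqF// powR_gt0.
have B20 : 0 <= (2 * B)%:E by rewrite lee_fin mulr_ge0// ltW.
apply: (@le_trans _ _ (\int[lebesgue_measure]_t
    ((2 * B)%:E * (h t * \int[mu]_x ((\1_A (t, x))%:E * f x))))).
  rewrite integral_mkcond; apply: le_integral_nonmeas => t _; rewrite patchE.
    by case: ifPn.
  have J0 : 0 <= \int[mu]_x ((\1_A (t, x))%:E * f x).
    by apply: integral_ge0 => x _; rewrite mule_ge0// lee_fin.
  case: ifPn => [/set_mem/=|_]; last by rewrite !mule_ge0.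
  by rewrite in_itv/= andbT; exact: step1.
have mI : measurable_fun setT ((fun t => \int[mu]_x ((\1_A (t, x))%:E * f x)) : measurableTypeR R -> \bar R).
  apply: (measurable_fun_fubini_tonelli_F (fun z => (\1_A z)%:E * f z.2)).
    apply: measurable_mule; last exact: (measurableT_comp mf).
    exact/measurable_EFinP/measurable_indic.
  by move=> z; rewrite mule_ge0// lee_fin.
have I0 t : 0 <= \int[mu]_x ((\1_A (t, x))%:E * f x).
  by apply: integral_ge0 => x _; rewrite mule_ge0// lee_fin.
rewrite integralZl_ge0//; last 2 first.
- exact: measurable_mule.
- by move=> t; rewrite mule_ge0.
rewrite layer_tonelli//.
rewrite [X in _ <= X * _]EFinM -muleA lee_wpmul2l//.
rewrite -integralZl_ge0//; last 3 first.
- by rewrite lee_fin mulr_ge0// ?invr_ge0 ?powR_ge0// ltW.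
- exact: measurable_poweR_fun.
- by move=> x; exact: poweR_ge0.
apply: le_integral_nonmeas => x _.
  by rewrite mule_ge0// integral_ge0// => t _; rewrite mule_ge0// lee_fin.
apply: (@le_trans _ _ (f x * (((1 - p^-1)^-1)%:E * (2%:E * f x) `^ (p - 1)))).
  rewrite lee_wpmul2l//; apply: le_trans (integral_powR_below p1 (f20 x)).
  by apply: le_integral_nonmeas => t _; [rewrite mule_ge0// lee_fin|exact: lexx].
have p10 : (0 < p - 1)%R by rewrite subr_gt0.
rewrite muleCA EFinM -muleA lee_wpmul2l ?lee_fin ?invr_ge0 ?(ltW a0)//.
rewrite poweRM// poweR_EFin muleCA lee_wpmul2l ?lee_fin ?powR_ge0//.
case: (f x) (f0 x) => [y y0|_|//]; last by rewrite !poweRyr ?gt_eqF// leey.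
rewrite !poweR_EFin -EFinM lee_fin.
rewrite lee_fin le_eqVlt in y0; case/predU1P: y0 => [<-|y0].
  by rewrite mul0r powR_ge0.
rewrite -[X in (X * _)%R]powRr1 ?(ltW y0)// -powRD ?(gt_eqF y0) ?implybT//.
by rewrite addrC subrK.
Qed.

(** * The dyadic potential and means of its powers *)

Variable rho : R.
Hypothesis rho_gt0 : (0 < rho)%R.
Hypothesis rho_lt1 : (rho < 1)%R.

Let rho_ge0 : (0 <= rho)%R. Proof. exact: ltW. Qed.
Let rhoX_ge0 k : (0 <= rho ^+ k)%R. Proof. exact: exprn_ge0. Qed.
Let D_ge0 : (0 <= D)%R. Proof. exact: ltW. Qed.

Lemma geometric_eseries (a : R) : (0 <= a)%R -> (a < 1)%R ->
  \sum_(j <oo) (a ^+ j)%:E = ((1 - a)^-1)%:E.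
Proof.
move=> a0 a1; have := @cvg_geometric_series R 1%R a.
rewrite ger0_norm// => /(_ a1) h.
apply/cvg_lim => //.
have -> : (fun n => \sum_(0 <= j < n) (a ^+ j)%:E) = EFin \o series (geometric 1%R a).
  apply/funext => n /=; rewrite /series /= sumEFin; congr (_%:E).
  by apply: eq_bigr => i _; rewrite /geometric/= mul1r.
apply: cvg_EFin; first by exact: nearW.
by have -> : ((1 - a)^-1 = 1 / (1 - a))%R by rewrite mul1r.
Qed.

Lemma avg_int k f : measurable_fun setT f -> (forall y, 0 <= f y) ->
  \int[mu]_x avg k f x = \int[mu]_x f x.
Proof.
move=> mf f0.
transitivity (\int[mu]_x (cst 1 x * avg k f x)).
  by apply: eq_integral => x _; rewrite mul1e.
rewrite avg_swap//; apply: eq_integral => x _.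
by rewrite avg_cst// mule1.
Qed.

(** The sum starts at generation 2. Generations 0 and 1 are kept as larger neighbourhoods, for
    example for the mean [avg 1 f x] in [far_upper] and for the bound of [maxf] by [avg 0] in
    [pot_csi_fun]. *)
Definition pot f x : \bar R := \sum_(i <oo) (rho ^+ i)%:E * avg i.+2 f x.

Let term_ge0 f x i : (forall y, 0 <= f y) -> 0 <= (rho ^+ i)%:E * avg i.+2 f x.
Proof. by move=> f0; rewrite mule_ge0 ?avg_ge0 ?lee_fin. Qed.

Lemma pot_ge0 f x : (forall y, 0 <= f y) -> 0 <= pot f x.
Proof. by move=> f0; apply: nneseries_ge0 => i _ _; exact: term_ge0. Qed.

Lemma measurable_pot f : measurable_fun setT f -> (forall y, 0 <= f y) ->
  measurable_fun setT (pot f).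
Proof.
move=> mf f0; apply: (@ge0_emeasurable_sum _ _ _ setT
    (fun i x => (rho ^+ i)%:E * avg i.+2 f x) xpredT).
  by move=> i x _ _; exact: term_ge0.
by move=> i _; apply: measurable_mule => //; exact: measurable_avg.
Qed.

Lemma le_pot f g x : (forall y, 0 <= f y) -> (forall y, 0 <= g y) ->
  (forall y, f y <= g y) -> pot f x <= pot g x.
Proof.
move=> f0 g0 fg; apply: lee_nneseries => [i _ _|i _]; first exact: term_ge0.
by rewrite lee_wpmul2l ?lee_fin//; apply: le_avg.
Qed.

Lemma potD f g x : measurable_fun setT f -> (forall y, 0 <= f y) ->
  measurable_fun setT g -> (forall y, 0 <= g y) ->
  pot (fun y => f y + g y) x = pot f x + pot g x.
Proof.
move=> mf f0 mg g0; rewrite /pot -nneseriesD; last 2 first.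
- by move=> i _ _; exact: term_ge0.
- by move=> i _ _; exact: term_ge0.
by apply: eq_eseriesr => i _; rewrite avgD// ge0_muleDr ?avg_ge0.
Qed.

Lemma potZ (c : R) f x : (0 <= c)%R -> measurable_fun setT f ->
  (forall y, 0 <= f y) -> pot (fun y => c%:E * f y) x = c%:E * pot f x.
Proof.
move=> c0 mf f0; rewrite /pot -nneseriesZl; last by move=> i _; exact: term_ge0.
by apply: eq_eseriesr => i _; rewrite avgZ// muleCA.
Qed.

Lemma pot_ge_sum m f x : (forall y, 0 <= f y) ->
  \sum_(0 <= i < m) (rho ^+ i)%:E * avg i.+2 f x <= pot f x.
Proof. by move=> f0; apply: nneseries_lim_ge => i _ _; exact: term_ge0. Qed.

Lemma pot_ge_term i f x : (forall y, 0 <= f y) ->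
  (rho ^+ i)%:E * avg i.+2 f x <= pot f x.
Proof.
move=> f0; apply: le_trans (pot_ge_sum i.+1 x f0).
rewrite big_nat_recr//= leeDr//; apply: sume_ge0 => j _; exact: term_ge0.
Qed.

(** The terms of [pot] finer than [N m.+2 x]. For points of [N m.+2 x] they see [f] only inside
    [N m.+1 x], whereas the coarser terms can be compared between two such points. *)
Definition near_pot m f x : \bar R :=
  \sum_(j <oo) (rho ^+ (m.+1 + j))%:E * avg (m.+1 + j).+2 f x.

Lemma near_pot_ge0 m f x : (forall y, 0 <= f y) -> 0 <= near_pot m f x.
Proof. by move=> f0; apply: nneseries_ge0 => i _ _; exact: term_ge0. Qed.

Lemma measurable_near_pot m f : measurable_fun setT f -> (forall y, 0 <= f y) ->
  measurable_fun setT (near_pot m f).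
Proof.
move=> mf f0; apply: (@ge0_emeasurable_sum _ _ _ setT
    (fun j x => (rho ^+ (m.+1 + j))%:E * avg (m.+1 + j).+2 f x) xpredT).
  by move=> i x _ _; exact: term_ge0.
by move=> i _; apply: measurable_mule => //; exact: measurable_avg.
Qed.

Lemma pot_split m f x : (forall y, 0 <= f y) ->
  pot f x = \sum_(0 <= i < m.+1) (rho ^+ i)%:E * avg i.+2 f x + near_pot m f x.
Proof.
move=> f0; rewrite /pot (nneseries_split 0 m.+1); last first.
  by move=> k _; exact: term_ge0.
rewrite add0n.
suff -> : \sum_(m.+1 <= i <oo) (rho ^+ i)%:E * avg i.+2 f x = near_pot m f x by [].
rewrite -(nneseries_addn (f := fun i => (rho ^+ i)%:E * avg i.+2 f x)); last first.
  by move=> k; exact: term_ge0.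
by apply: eq_eseriesr => j _; rewrite addnC.
Qed.

(** Moving from [z] to [x] costs one generation: the term [i] at [z] is bounded by the term [i - 1]
    at [x], and the term 0 by the mean at generation 1, which lies outside the potential and appears
    separately. *)
Lemma far_upper m f x z : (forall y, 0 <= f y) -> N m.+2 x z ->
  \sum_(0 <= i < m.+1) (rho ^+ i)%:E * avg i.+2 f z <=
  D%:E * (avg 1 f x + \sum_(0 <= i < m) (rho ^+ i)%:E * avg i.+2 f x).
Proof.
move=> f0 xz; have zx := N_sym xz.
have step i : (i <= m)%N -> avg i.+2 f z <= D%:E * avg i.+1 f x.
  by move=> im; apply: avg_comp => //; apply: N_le zx.
rewrite big_nat_recl// expr0 mul1e ge0_muleDr ?avg_ge0//; last first.
  by apply: sume_ge0 => i _; exact: term_ge0.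
apply: leeD; first exact: step.
rewrite ge0_sume_distrr; last by move=> i _; exact: term_ge0.
rewrite !big_nat; apply: lee_sum => i /andP[_ im].
rewrite [leRHS]muleCA; apply: lee_pmul; rewrite ?lee_fin ?avg_ge0//.
  by rewrite exprS ler_piMl// ltW.
exact: step.
Qed.

Lemma far_lower m f x z : (forall y, 0 <= f y) -> N m.+2 x z ->
  \sum_(0 <= i < m.+1) (rho ^+ i)%:E * avg i.+2 f x <=
  avg 2 f x + D%:E * pot f z.
Proof.
move=> f0 xz; rewrite big_nat_recl// expr0 mul1e leeD2l//.
apply: (@le_trans _ _ (D%:E * \sum_(0 <= i < m) (rho ^+ i)%:E * avg i.+2 f z)); last first.
  by rewrite lee_wpmul2l ?lee_fin ?pot_ge_sum.
rewrite ge0_sume_distrr; last by move=> i _; exact: term_ge0.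
rewrite !big_nat; apply: lee_sum => i /andP[_ im].
rewrite [leRHS]muleCA; apply: lee_pmul; rewrite ?lee_fin ?avg_ge0//.
  by rewrite exprS ler_piMl// ltW.
by apply: avg_comp => //; apply: N_le xz.
Qed.

Definition local m (f : T -> \bar R) x : T -> \bar R := fun y => (\1_(N m.+1 x) y)%:E * f y.

Lemma local_ge0 m f x y : (forall y, 0 <= f y) -> 0 <= local m f x y.
Proof. by move=> f0; rewrite mule_ge0// lee_fin. Qed.

Lemma measurable_local m f x : measurable_fun setT f ->
  measurable_fun setT (local m f x).
Proof.
move=> mf; apply: measurable_mule => //.
exact/measurable_EFinP/measurable_indic/measurable_rel.
Qed.

Lemma avg_local m j f x z : (forall y, 0 <= f y) -> N m.+2 x z ->
  avg (m.+1 + j).+2 f z = avg (m.+1 + j).+2 (local m f x) z.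
Proof.
move=> f0 xz; apply: eq_avg => // [y|y zy]; first exact: local_ge0.
rewrite /local indicE mem_set ?mul1e//; apply: N_comp xz _.
by apply: N_le zy; lia.
Qed.

Lemma int_local m f x : \int[mu]_y local m f x y = (v m.+1)%:E * avg m.+1 f x.
Proof. by rewrite -mass_avg. Qed.

Lemma vD m j : (v m = D ^+ j * v (m + j))%R.
Proof.
elim: j => [|j IH]; first by rewrite expr0 mul1r addn0.
by rewrite IH (vS (m + j)) addnS exprS; ring.
Qed.

(** Averaging preserves the integral, by [avg_int], so the terms of the tail have integrals in
    geometric progression. The factor [D] is the ratio of the measures of [N m.+1 x] and
    [N m.+2 x]. *)
Lemma near_mean m f x : measurable_fun setT f -> (forall y, 0 <= f y) ->
  avg m.+2 (near_pot m f) x <=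
  (D * (1 - rho)^-1)%:E * ((rho ^+ m)%:E * avg m.+1 f x).
Proof.
move=> mf f0; have mL := measurable_local m x mf.
have L0 y : 0 <= local m f x y by exact: local_ge0.
apply: (@le_trans _ _ ((v m.+2)^-1%:E *
    \int[mu]_z \sum_(j <oo) (rho ^+ (m.+1 + j))%:E * avg (m.+1 + j).+2 (local m f x) z)).
  rewrite avgE lee_wpmul2l ?lee_fin ?invr_ge0 ?(ltW (v_gt0 _))//.
  apply: le_integral_nonmeas => z _.
    by rewrite mule_ge0 ?near_pot_ge0// lee_fin.
  rewrite indicE; have [/set_mem xz|_] := boolP (z \in N m.+2 x); last first.
    by rewrite mul0e; apply: nneseries_ge0 => i _ _; exact: term_ge0.
  rewrite mul1e /near_pot le_eqVlt; apply/orP; left; apply/eqP.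
  by apply: eq_eseriesr => j _; rewrite (avg_local _ f0 xz).
rewrite integral_nneseries//; last 2 first.
- by move=> j; apply: measurable_mule => //; exact: measurable_avg.
- by move=> j z _; exact: term_ge0.
have -> : \sum_(j <oo) \int[mu]_z ((rho ^+ (m.+1 + j))%:E * avg (m.+1 + j).+2 (local m f x) z)
   = \sum_(j <oo) ((rho ^+ m.+1)%:E * \int[mu]_y local m f x y) * (rho ^+ j)%:E.
  apply: eq_eseriesr => j _; rewrite integralZl_ge0 ?lee_fin//; last 2 first.
  - exact: measurable_avg.
  - by move=> z; exact: avg_ge0.
  by rewrite avg_int// exprD EFinM muleAC.
have J0 : 0 <= (rho ^+ m.+1)%:E * \int[mu]_y local m f x y.
  by rewrite mule_ge0 ?lee_fin// integral_ge0.
have -> : \sum_(j <oo) ((rho ^+ m.+1)%:E * \int[mu]_y local m f x y) * (rho ^+ j)%:E =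
    ((rho ^+ m.+1)%:E * \int[mu]_y local m f x y) * ((1 - rho)^-1)%:E.
  rewrite -geometric_eseries//.
  move: J0; case: ((rho ^+ m.+1)%:E * _) => [r| |//] r0; first by rewrite nneseriesZl// => i _; rewrite lee_fin.
  rewrite geometric_eseries// mulyr gtr0_sg ?invr_gt0 ?subr_gt0// mul1e.
  apply: (nneseries_pinfty (k := 0%N)) => //; last by rewrite expr0 mule1.
  by move=> i _; rewrite mule_ge0// lee_fin.
rewrite int_local (vS m.+1) exprS.
have A0 : 0 <= avg m.+1 f x by exact: avg_ge0.
move: (avg m.+1 f x) A0 => A A0 {J0}.
rewrite (_ : ((v m.+2)^-1)%:E * _ = (D * (1 - rho)^-1 * rho)%:E * ((rho ^+ m)%:E * A)).
  rewrite lee_wpmul2r ?mule_ge0 ?lee_fin//.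
  by rewrite ler_piMr ?mulr_ge0 ?invr_ge0 ?subr_ge0// ltW.
rewrite [X in _ * X = _]muleAC !muleA -!EFinM; congr (_%:E * _).
have r1 : (1 - rho != 0)%R by rewrite gt_eqF// subr_gt0.
have := v_gt0 m.+2; move: (v m.+2) => c c0.
by field; rewrite r1 (gt_eqF c0).
Qed.

(** Every [X j] is at most the P-th root of the sum on the right, so the left-hand series is
    dominated by a geometric one. The argument is uniform in P > 0, below 1 as well as above. *)
Lemma weighted_series_poweR (a P : R) (X : nat -> \bar R) :
  (0 <= a)%R -> (a < 1)%R -> (0 < P)%R -> (forall j, 0 <= X j) ->
  (\sum_(j <oo) (a ^+ j)%:E * X j) `^ P <=
  ((1 - a)^-1 `^ P)%:E * \sum_(j <oo) X j `^ P.
Proof.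
move=> a0 a1 P0 X0; set Y := \sum_(j <oo) X j `^ P.
have Y0 : 0 <= Y by apply: nneseries_ge0 => j _ _; exact: poweR_ge0.
have a10 : (0 < (1 - a)^-1)%R by rewrite invr_gt0 subr_gt0.
have XY j : X j <= Y `^ P^-1.
  rewrite -(poweRK P0 (X0 j)); apply: poweR_mono; rewrite ?poweR_ge0 ?invr_ge0 ?(ltW P0)//.
  apply: (@le_trans _ _ (\sum_(0 <= i < j.+1) X i `^ P)).
    by rewrite big_nat_recr//= leeDr// sume_ge0// => i _; exact: poweR_ge0.
  by apply: nneseries_lim_ge => i _ _; exact: poweR_ge0.
move: Y0 XY; case: Y => [y| |//] y0 XY; last first.
  by rewrite mulry gtr0_sg ?powR_gt0// mul1e leey.
rewrite poweR_EFin in XY.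
apply: (@le_trans _ _ ((((1 - a)^-1)%:E * (y `^ P^-1)%:E) `^ P)).
  apply: poweR_mono; first exact: ltW.
    by apply: nneseries_ge0 => j _ _; rewrite mule_ge0// lee_fin exprn_ge0.
  rewrite -geometric_eseries// muleC -nneseriesZl; last first.
    by move=> i _; rewrite lee_fin exprn_ge0.
  apply: lee_nneseries => [j _ _|j _]; first by rewrite mule_ge0// lee_fin exprn_ge0.
  by rewrite [leRHS]muleC lee_wpmul2l ?lee_fin ?exprn_ge0.
rewrite -EFinM poweR_EFin powRM ?powR_ge0 ?(ltW a10)// -powRrM mulVf ?gt_eqF//.
by rewrite powRr1.
Qed.

Lemma poweR_pred (y : \bar R) (p : R) : 0 <= y -> (1 <= p)%R ->
  y `^ p = y `^ (p - 1) * y.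
Proof.
move=> y0; rewrite le_eqVlt => /predU1P[<-|p1].
  by rewrite subrr poweRe0 mul1e poweRe1.
have p0 : (0 < p)%R by exact: lt_trans p1.
have p10 : (0 < p - 1)%R by rewrite subr_gt0.
case: y y0 => [y y0| _|//]; last by rewrite !poweRyr ?gt_eqF// mulyy.
rewrite !poweR_EFin -EFinM; rewrite lee_fin le_eqVlt in y0.
case/predU1P: y0 => [<-|y0]; first by rewrite powR0 ?gt_eqF// mulr0.
rewrite -[X in (_ * X)%R](@powRr1 _ y) ?(ltW y0)// -powRD; last first.
  by rewrite (gt_eqF y0) implybT.
by rewrite subrK.
Qed.

Lemma exprn_powR (a P : R) j : (0 <= a)%R -> ((a ^+ j) `^ P = (a `^ P) ^+ j)%R.
Proof.
move=> a0; elim: j => [|j IH]; first by rewrite !expr0 powR1.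
by rewrite !exprS powRM ?exprn_ge0// IH.
Qed.

(** Young's inequality carried out scale by scale, with g^m restricted to [N k.+1 x] as the
    integrable function. Of the p-th power of its mean, one factor is integrated and the other p - 1
    are bounded by the total integral over the measure of a neighbourhood, which gains D^(p-1) per
    generation. Against the weight rho^p this leaves the ratio rho^p D^(p-1) of the hypothesis. *)
Lemma near_pot_poweR (m p : R) : (1 < m)%R -> (1 <= p)%R ->
  (rho `^ p * D `^ (p - 1) < 1)%R ->
  exists2 C : R, (0 < C)%R & forall k g x, measurable_fun setT g ->
  (forall y, 0 <= g y) ->
  avg k.+2 (fun z => near_pot k g z `^ (m * p)) x <=
  C%:E * ((rho ^+ k)%:E * avg k.+1 (fun y => g y `^ m) x `^ m^-1) `^ (m * p).
Proof.
move=> m1 p1 kap1.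
have m0 : (0 < m)%R by exact: lt_trans m1.
have p0 : (0 < p)%R by exact: lt_le_trans p1.
have p10 : (0 <= p - 1)%R by rewrite subr_ge0.
set P := (m * p)%R; have P0 : (0 < P)%R by rewrite mulr_gt0.
set kap := (rho `^ p * D `^ (p - 1))%R in kap1.
have kap0 : (0 < kap)%R by rewrite mulr_gt0 ?powR_gt0.
(* The weight is split as rho = sig * beta. The powers of [sig] pay for taking the power [P] inside
   the series, and those of [beta], once raised to P = m p, are powers of rho^p. *)
pose beta := (rho `^ m^-1)%R; pose sig := (rho `^ (1 - m^-1))%R.
have beta0 : (0 < beta)%R by exact: powR_gt0.
have sig0 : (0 < sig)%R by exact: powR_gt0.
have sb : (sig * beta = rho)%R.
  rewrite /sig /beta -powRD ?(gt_eqF rho_gt0) ?implybT//.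
  by rewrite subrK powRr1// ltW.
have sig1 : (sig < 1)%R.
  have q0 : (0 < 1 - m^-1)%R by rewrite subr_gt0 invf_lt1.
  have := @gt0_ltr_powR R _ q0 rho 1%R.
  by rewrite !nnegrE ler01 rho_ge0 powR1; apply.
have bP : (beta `^ P = rho `^ p)%R.
  by rewrite /beta -powRrM mulrA mulVf ?gt_eqF// mul1r.
pose S := ((1 - sig)^-1 `^ P)%R.
have S0 : (0 < S)%R by rewrite powR_gt0// invr_gt0 subr_gt0.
pose C0 := (rho `^ P * ((D ^+ 2) `^ (p - 1) * D) * (1 - kap)^-1)%R.
have C00 : (0 < C0)%R.
  by rewrite !mulr_gt0 ?powR_gt0 ?invr_gt0 ?subr_gt0 ?exprn_gt0.
exists (S * C0)%R; first exact: mulr_gt0.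
move=> k g x mg g0.
have mgm : measurable_fun setT (fun y => g y `^ m) by exact: measurable_poweR_fun.
have gm0 y : 0 <= g y `^ m by exact: poweR_ge0.
pose h := local k (fun y => g y `^ m) x.
have mh : measurable_fun setT h by exact: measurable_local.
have h0 y : 0 <= h y by exact: local_ge0.
have Hh : \int[mu]_y h y = (v k.+1)%:E * avg k.+1 (fun y => g y `^ m) x.
  exact: int_local.
move: Hh; have : 0 <= avg k.+1 (fun y => g y `^ m) x by exact: avg_ge0.
case: (avg k.+1 (fun y => g y `^ m) x) => [a a0 Hh| _ _|//]; last first.
  rewrite poweRyr ?invr_eq0 ?gt_eqF// mulry gtr0_sg ?exprn_gt0// mul1e.
  have -> : (S * C0)%:E * +oo `^ P = +oo; last exact: leey.
  by rewrite poweRyr ?gt_eqF// mulry gtr0_sg ?mul1e// mulr_gt0.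
rewrite lee_fin in a0.
pose c j := ((sig ^+ k.+1 * beta ^+ (k.+1 + j)) `^ P)%R.
pose e j := ((D ^+ j.+2 * a) `^ (p - 1))%R.
have c0 j : (0 <= c j)%R by exact: powR_ge0.
have e0 j : (0 <= e j)%R by exact: powR_ge0.
have ptw z : N k.+2 x z -> near_pot k g z `^ P <=
    \sum_(j <oo) (S * (c j * e j))%:E * avg (k.+1 + j).+2 h z.
  move=> xz.
  have -> : near_pot k g z = \sum_(j <oo) (sig ^+ j)%:E *
      ((sig ^+ k.+1 * beta ^+ (k.+1 + j))%:E * avg (k.+1 + j).+2 g z).
    apply: eq_eseriesr => j _; rewrite muleA -EFinM; congr (_%:E * _).
    by rewrite -[in LHS]sb exprMn exprD; ring.
  have X0 j : 0 <= (sig ^+ k.+1 * beta ^+ (k.+1 + j))%:E * avg (k.+1 + j).+2 g z.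
    by rewrite mule_ge0 ?avg_ge0// lee_fin mulr_ge0// exprn_ge0 ?(ltW sig0) ?(ltW beta0).
  apply: le_trans (weighted_series_poweR (ltW sig0) sig1 P0 X0) _.
  rewrite -/S -nneseriesZl; last by move=> j _; exact: poweR_ge0.
  apply: lee_nneseries => [j _ _|j _]; first by rewrite mule_ge0 ?poweR_ge0 ?lee_fin ?(ltW S0).
  rewrite [X in _ <= X * _]EFinM -muleA lee_wpmul2l ?lee_fin ?(ltW S0)//.
  rewrite poweRM ?avg_ge0//; last by rewrite lee_fin mulr_ge0// exprn_ge0 ?(ltW sig0) ?(ltW beta0).
  rewrite poweR_EFin -/(c j) [X in _ <= X * _]EFinM -muleA lee_wpmul2l ?lee_fin//.
  rewrite /P poweRrM.
  have hz0 : 0 <= avg (k.+1 + j).+2 h z by exact: avg_ge0.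
  apply: (@le_trans _ _ (avg (k.+1 + j).+2 h z `^ p)).
    apply: poweR_mono; rewrite ?poweR_ge0 ?(ltW p0)//.
    by rewrite -(avg_local j gm0 xz); apply: avg_poweR => //; exact: ltW.
  rewrite poweR_pred// lee_wpmul2r// -poweR_EFin; apply: poweR_mono => //.
  (* For the p - 1 factors that are not integrated: the mean of [h] is at most its whole integral
     over the measure of the neighbourhood, that is, D^(j+2) a. *)
  apply: (@le_trans _ _ ((v (k.+1 + j).+2)^-1%:E * \int[mu]_y h y)).
    rewrite avgE lee_wpmul2l ?lee_fin ?invr_ge0 ?(ltW (v_gt0 _))//.
    apply: le_integral_nonmeas => y _; first by rewrite mule_ge0// lee_fin.
    by rewrite indicE; case: (_ \in _); rewrite ?mul1e ?mul0e.
  rewrite Hh -!EFinM lee_fin.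
  rewrite (@vD k.+1 j.+2).
  have -> : (k.+1 + j).+2 = (k.+1 + j.+2)%N by rewrite !addnS.
  have := v_gt0 (k.+1 + j.+2); move: (v (k.+1 + j.+2)) => V V0.
  rewrite le_eqVlt; apply/orP; left; apply/eqP.
  by field; rewrite gt_eqF.
rewrite avgE; apply: (@le_trans _ _ ((v k.+2)^-1%:E *
    \int[mu]_z \sum_(j <oo) (S * (c j * e j))%:E * avg (k.+1 + j).+2 h z)).
  rewrite lee_wpmul2l ?lee_fin ?invr_ge0 ?(ltW (v_gt0 _))//.
  apply: le_integral_nonmeas => z _; first by rewrite mule_ge0 ?poweR_ge0 ?lee_fin.
  rewrite indicE; have [/set_mem xz|_] := boolP (z \in N k.+2 x).
    by rewrite mul1e; exact: ptw.
  rewrite mul0e; apply: nneseries_ge0 => i _ _.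
  by rewrite mule_ge0 ?avg_ge0// lee_fin !mulr_ge0// ltW.
have Sce0 j : (0 <= S * (c j * e j))%R by rewrite !mulr_ge0// ltW.
rewrite integral_nneseries//; last 2 first.
- by move=> j; apply: measurable_mule => //; exact: measurable_avg.
- by move=> j z _; rewrite mule_ge0 ?avg_ge0// lee_fin.
pose K := (S * ((rho ^+ k.+1) `^ P * ((D ^+ 2) `^ (p - 1) * a `^ (p - 1)) * (v k.+1 * a)))%R.
have -> : \sum_(j <oo) \int[mu]_z ((S * (c j * e j))%:E * avg (k.+1 + j).+2 h z)
    = \sum_(j <oo) K%:E * (kap ^+ j)%:E.
  apply: eq_eseriesr => j _; rewrite integralZl_ge0 ?lee_fin//; last 2 first.
  - exact: measurable_avg.
  - by move=> z; exact: avg_ge0.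
  rewrite avg_int// Hh -!EFinM; congr (_%:E).
  have -> : c j = ((rho ^+ k.+1) `^ P * (rho `^ p) ^+ j)%R.
    rewrite /c exprD mulrA -exprMn sb powRM ?exprn_ge0 ?(ltW beta0) ?(ltW rho_gt0)//.
    by rewrite -bP exprn_powR// ltW.
  have -> : e j = ((D `^ (p - 1)) ^+ j * ((D ^+ 2) `^ (p - 1) * a `^ (p - 1)))%R.
    rewrite /e -addn2 exprD -mulrA powRM ?exprn_ge0 ?mulr_ge0 ?exprn_ge0//.
    rewrite powRM ?exprn_ge0//; congr (_ * _)%R.
    exact: exprn_powR.
  by rewrite /K /kap exprMn; ring.
have K0 : (0 <= K)%R.
  apply: (mulr_ge0 (ltW S0)); apply: mulr_ge0; last exact: (mulr_ge0 (ltW (v_gt0 _)) a0).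
  by apply: mulr_ge0; [exact: powR_ge0|apply: mulr_ge0; exact: powR_ge0].
rewrite nneseriesZl; last by move=> j _; rewrite lee_fin exprn_ge0// ltW.
rewrite geometric_eseries ?(ltW kap0)//.
rewrite poweR_EFin -EFinM poweR_EFin -!EFinM lee_fin.
rewrite powRM ?powR_ge0// -[in leRHS](@powRrM _ a) /P.
have -> : (m^-1 * (m * p) = p)%R by rewrite mulrA mulVf ?mul1r// gt_eqF.
rewrite -/P /K /C0 (vS k.+1).
have ap : (a `^ (p - 1) * a = a `^ p)%R.
  have := @poweR_pred a%:E p; rewrite lee_fin => /(_ a0 p1).
  by rewrite !poweR_EFin -EFinM => -[].
have rP : ((rho ^+ k.+1) `^ P = rho `^ P * (rho ^+ k) `^ P)%R.
  by rewrite exprS powRM.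
rewrite rP -ap.
have := v_gt0 k.+2; move: (v k.+2) => V V0.
rewrite le_eqVlt; apply/orP; left; apply/eqP.
field.
by rewrite (gt_eqF V0) gt_eqF// subr_gt0.
Qed.

Definition maxpow (m : R) (f : T -> \bar R) x := maxf (fun y => f y `^ m) x `^ m^-1.

Lemma maxpow_ge0 m f x : 0 <= maxpow m f x.
Proof. exact: poweR_ge0. Qed.

Lemma measurable_maxpow m f : measurable_fun setT f ->
  measurable_fun setT (maxpow m f).
Proof.
move=> mf; apply: measurable_poweR_fun; apply: measurable_maxf.
  exact: measurable_poweR_fun.
by move=> y; exact: poweR_ge0.
Qed.

Lemma avg_le_pow m k f x : (1 <= m)%R -> measurable_fun setT f ->
  (forall y, 0 <= f y) -> avg k f x <= avg k (fun y => f y `^ m) x `^ m^-1.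
Proof.
move=> m1 mf f0; have m0 : (0 < m)%R by exact: lt_le_trans m1.
rewrite -[leLHS](poweRK m0 (avg_ge0 k x f0)); apply: poweR_mono.
- by rewrite invr_ge0 ltW.
- exact: poweR_ge0.
- exact: avg_poweR.
Qed.

(** The mean on the left is at most [D] times the maximal function of f^m at every point of
    [N j.+2 x]. So its root is a lower bound for [maxpow m f] there, up to a constant, and a single
    term of the potential dominates it. This is the reason for adding [maxpow m g] to [g] in
    [avg_pot_poweR]. *)
Lemma avg_pow_le_pot m k j f x : (0 < m)%R -> measurable_fun setT f ->
  (forall y, 0 <= f y) -> (k < j.+2)%N ->
  (rho ^+ j)%:E * avg k.+1 (fun y => f y `^ m) x `^ m^-1 <=
  (D `^ m^-1)%:E * pot (maxpow m f) x.
Proof.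
move=> m0 mf f0 kj.
have mi0 : (0 <= m^-1)%R by rewrite invr_ge0 ltW.
have mM := measurable_maxpow m mf.
have g0 y : 0 <= f y `^ m by exact: poweR_ge0.
set Aa := avg k.+1 _ x; have A0 : 0 <= Aa by exact: avg_ge0.
have AM y : N j.+2 x y -> Aa `^ m^-1 <= (D `^ m^-1)%:E * maxpow m f y.
  move=> xy; rewrite -poweR_EFin -poweRM ?maxf_ge0 ?lee_fin//.
  apply: poweR_mono => //; apply: le_trans (avg_comp g0 (N_le kj xy)) _.
  by rewrite lee_wpmul2l ?lee_fin ?maxf_ge.
apply: (@le_trans _ _ ((rho ^+ j)%:E * ((D `^ m^-1)%:E * avg j.+2 (maxpow m f) x))); last first.
  rewrite muleCA lee_wpmul2l ?lee_fin ?powR_ge0//.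
  by apply: pot_ge_term => y; exact: maxpow_ge0.
rewrite lee_wpmul2l ?lee_fin//.
rewrite -avgZ ?powR_ge0//; last by move=> y; exact: maxpow_ge0.
have [Aoo|Aoo] := eqVneq (Aa `^ m^-1) +oo.
  rewrite Aoo in AM *.
  suff -> : avg j.+2 (fun y => (D `^ m^-1)%:E * maxpow m f y) x = +oo by [].
  apply/eqyP => r r0; rewrite -(@avg_cst j.+2 r x) ?(ltW r0)//.
  apply: le_avg => y; rewrite ?lee_fin ?(ltW r0)//.
    by rewrite mule_ge0 ?maxpow_ge0// lee_fin powR_ge0.
  by move=> /AM; rewrite leye_eq => /eqP ->; exact: leey.
have Afin : Aa `^ m^-1 \is a fin_num by rewrite ge0_fin_numE ?poweR_ge0// ltey.
rewrite -(fineK Afin) -(@avg_cst j.+2 (fine (Aa `^ m^-1)) x) ?fine_ge0 ?poweR_ge0//.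
apply: le_avg => y; rewrite ?lee_fin ?fine_ge0 ?poweR_ge0//.
  by rewrite mule_ge0 ?maxpow_ge0// lee_fin powR_ge0.
by move=> /AM; rewrite /= fineK.
Qed.

(* Far from [x] the potential is nearly constant, and near [x] Young's
   inequality gains integrability. *)
Lemma avg_pot_poweR (m p : R) : (1 < m)%R -> (1 <= p)%R ->
  (rho `^ p * D `^ (p - 1) < 1)%R ->
  exists2 C : R, (0 < C)%R & forall k g x, measurable_fun setT g ->
  (forall y, 0 <= g y) ->
  avg k.+2 (fun z => pot g z `^ (m * p)) x <=
  C%:E * pot (fun y => g y + maxpow m g y) x `^ (m * p).
Proof.
move=> m1 p1 kap1; have [C C0 HC] := near_pot_poweR m1 p1 kap1.
have m0 : (0 < m)%R by exact: lt_trans m1.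
have p0 : (0 < p)%R by exact: lt_le_trans p1.
set P := (m * p)%R; have P0 : (0 < P)%R by rewrite mulr_gt0.
pose Dm := (D `^ m^-1)%R; have Dm0 : (0 < Dm)%R by exact: powR_gt0.
(* [D] is the loss in [far_upper], [Dm] bounds the mean at generation 1 by the potential of
   [maxpow m g], and 1 stands for the remaining terms. *)
pose F := (D * (Dm + 1))%R; have F0 : (0 < F)%R by rewrite mulr_gt0// addr_gt0.
exists (2 `^ P * (F `^ P + C * Dm `^ P))%R.
  by rewrite mulr_gt0 ?powR_gt0// addr_gt0 ?powR_gt0// mulr_gt0// powR_gt0.
move=> k g x mg g0; set psi := fun y => g y + maxpow m g y.
have mM := measurable_maxpow m mg.
have mpsi : measurable_fun setT psi by exact: measurable_adde.
have psi0 y : 0 <= psi y by rewrite adde_ge0 ?maxpow_ge0.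
have gpsi y : g y <= psi y by rewrite leeDl ?maxpow_ge0.
have Mpsi y : maxpow m g y <= psi y by rewrite leeDr.
have potM : pot (maxpow m g) x <= pot psi x.
  by apply: le_pot => // y; exact: maxpow_ge0.
have potg : pot g x <= pot psi x by exact: le_pot.
have far z : N k.+2 x z ->
    \sum_(0 <= i < k.+1) (rho ^+ i)%:E * avg i.+2 g z <= F%:E * pot psi x.
  move=> xz; apply: le_trans (far_upper g0 xz) _.
  rewrite /F EFinM -muleA lee_wpmul2l ?lee_fin// EFinD ge0_muleDl ?lee_fin ?(ltW Dm0)//.
  apply: leeD; last by rewrite mul1e (le_trans _ potg)// pot_ge_sum.
  apply: (@le_trans _ _ (Dm%:E * pot (maxpow m g) x)).
    rewrite -[leLHS]mul1e -[1]/((rho ^+ 0)%:E).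
    apply: le_trans (avg_pow_le_pot x m0 mg g0 (isT : (0 < 2)%N)).
    by rewrite lee_wpmul2l ?lee_fin//; apply: avg_le_pow => //; exact: ltW.
  by rewrite lee_wpmul2l// lee_fin ltW.
move: (pot_ge0 x psi0) potM far; case: (pot psi x) => [y y0 potM far| _ _ _|//]; last first.
  rewrite (_ : _ * +oo `^ P = +oo) ?leey//.
  rewrite poweRyr ?gt_eqF// mulry gtr0_sg ?mul1e//.
  by rewrite mulr_gt0 ?powR_gt0// addr_gt0 ?powR_gt0// mulr_gt0// powR_gt0.
rewrite lee_fin in y0.
have Fy0 : (0 <= F * y)%R by rewrite mulr_ge0// ltW.
have mnear : measurable_fun setT (fun z => near_pot k g z `^ P).
  by apply: measurable_poweR_fun; exact: measurable_near_pot.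
apply: (@le_trans _ _ (avg k.+2 (fun z => (2 `^ P)%:E *
    (cst ((F * y) `^ P)%:E z + near_pot k g z `^ P)) x)).
  apply: le_avg => z; first exact: poweR_ge0.
    by rewrite mule_ge0 ?adde_ge0 ?poweR_ge0 ?lee_fin ?powR_ge0.
  move=> xz; rewrite (pot_split k z g0).
  apply: (@le_trans _ _ (((F * y)%:E + near_pot k g z) `^ P)).
    apply: poweR_mono; first exact: ltW.
      by rewrite adde_ge0 ?near_pot_ge0// sume_ge0// => i _; exact: term_ge0.
    by rewrite leeD2r// EFinM far.
  rewrite -poweR_EFin; apply: poweR_addl; rewrite ?near_pot_ge0 ?lee_fin//.
  exact: ltW.
rewrite avgZ ?powR_ge0//; last 2 first.
- exact: measurable_adde.
- by move=> z; rewrite adde_ge0 ?poweR_ge0 ?lee_fin ?powR_ge0.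
rewrite [X in _ <= X * _]EFinM -muleA lee_wpmul2l ?lee_fin ?powR_ge0//.
rewrite avgD//; last 2 first.
- by move=> z; rewrite lee_fin powR_ge0.
- by move=> z; exact: poweR_ge0.
rewrite avg_cst ?powR_ge0// EFinD ge0_muleDl ?lee_fin ?powR_ge0//; last first.
  by rewrite mulr_ge0 ?powR_ge0// ltW.
apply: leeD; first by rewrite poweR_EFin -EFinM powRM// ltW.
apply: le_trans (HC k g x mg g0) _.
rewrite EFinM -muleA lee_wpmul2l ?lee_fin ?(ltW C0)//.
rewrite -poweR_EFin -poweRM ?lee_fin ?(ltW Dm0)//.
apply: poweR_mono; first exact: ltW.
  by rewrite mule_ge0 ?poweR_ge0 ?lee_fin.
apply: le_trans (avg_pow_le_pot x m0 mg g0 (leqnSn k.+1)) _.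
by rewrite lee_wpmul2l// lee_fin ltW.
Qed.

(** * The capacitary strong type inequality *)

Definition csi_level (f : T -> \bar R) (K t : R) : set T :=
  [set x | t%:E < pot f x <= (K * t)%:E].

(** The two summands answer two ways for the potential to be large at a point: through a mean above
    [t] at generation 1, or through partial sums that climb across the layer. *)
Definition csi_fun (f : T -> \bar R) (K t : R) (x : T) : \bar R :=
  (\1_[set y | ((t / D)%:E < maxf f y)%E] x)%:E +
  (t^-1)%:E * ((\1_(csi_level f K t) x)%:E * maxf f x).

(** In units of [t]: the first summand bounds the coarse part of the potential in [csi_half], and
    the second is twice the bound of [near_mean], so that by Chebyshev the fine part exceeds it on
    at most half of the neighbourhood. *)
Let Kcsi : R := (D * (1 + 4 * D) + 2 * D * (1 - rho)^-1 * (4 * D))%R.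

Lemma Kcsi_gt0 : (0 < Kcsi)%R.
Proof.
have h : (0 < (1 - rho)^-1)%R by rewrite invr_gt0 subr_gt0.
by rewrite /Kcsi addr_gt0 ?mulr_gt0 ?addr_gt0 ?mulr_gt0.
Qed.

Lemma measurable_csi_level f t : measurable_fun setT f -> (forall y, 0 <= f y) ->
  measurable (csi_level f Kcsi t).
Proof.
move=> mf f0; have mp := measurable_pot mf f0.
rewrite (_ : csi_level _ _ _ = [set x | t%:E < pot f x] `&` [set x | pot f x <= (Kcsi * t)%:E]).
  apply: measurableI; rewrite -[X in measurable X]setTI.
    exact: emeasurable_fun_o_infty.
  exact: emeasurable_fun_infty_c.
by apply/seteqP; split => x /=; [move=> /andP[]|move=> [? ?]; apply/andP].
Qed.

Lemma csi_fun_ge0 f K t x : (0 < t)%R -> (forall y, 0 <= f y) -> 0 <= csi_fun f K t x.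
Proof.
move=> t0 f0; rewrite adde_ge0 ?lee_fin// mule_ge0 ?lee_fin ?invr_ge0 ?(ltW t0)//.
by rewrite mule_ge0 ?maxf_ge0// lee_fin.
Qed.

Lemma measurable_csi_fun f t : measurable_fun setT f -> (forall y, 0 <= f y) ->
  measurable_fun setT (csi_fun f Kcsi t).
Proof.
move=> mf f0; have mM := measurable_maxf mf f0; apply: measurable_adde.
  apply/measurable_EFinP/measurable_indic.
  by rewrite -[X in measurable X]setTI; exact: emeasurable_fun_o_infty.
apply: measurable_mule => //; apply: measurable_mule => //.
exact/measurable_EFinP/measurable_indic/measurable_csi_level.
Qed.

(* Half of [N m.+2 x] lies in the layer [t < pot f <= K t] at every scale [m]
   whose partial sum of [pot f x] is between [2 D t] and [4 D t]. *)
Lemma csi_half m f x t : measurable_fun setT f -> (forall y, 0 <= f y) ->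
  (0 < t)%R -> avg 1 f x <= t%:E ->
  (2 * D * t)%:E < \sum_(0 <= i < m.+1) (rho ^+ i)%:E * avg i.+2 f x ->
  \sum_(0 <= i < m) (rho ^+ i)%:E * avg i.+2 f x <= (4 * D * t)%:E ->
  (2^-1)%:E <= avg m.+2 (fun z => (\1_(csi_level f Kcsi t) z)%:E) x.
Proof.
move=> mf f0 t0 a1 lo up.
have D1 : (1 <= 4 * D)%R by have := D_ge1; lra.
have r0 : (0 < (1 - rho)^-1)%R by rewrite invr_gt0 subr_gt0.
pose E := (2 * D * (1 - rho)^-1 * (4 * D * t))%R.
have E0 : (0 < E)%R by rewrite !mulr_gt0.
have a1m : (rho ^+ m)%:E * avg m.+1 f x <= (4 * D * t)%:E.
  case: m {lo} up => [_|m up].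
    by rewrite expr0 mul1e (le_trans a1)// lee_fin; rewrite ler_peMl// ltW.
  apply: (@le_trans _ _ ((rho ^+ m)%:E * avg m.+2 f x)).
    by rewrite lee_wpmul2r ?avg_ge0// lee_fin exprS ler_piMl// ltW.
  apply: le_trans up; rewrite big_nat_recr//= leeDr// sume_ge0// => i _.
  exact: term_ge0.
(* The exceptional set of Chebyshev's inequality. [E] is twice the mean of the fine part, so [G]
   takes at most half of [N m.+2 x], and the rest is shown to lie in the layer. *)
pose G := [set z | E%:E < near_pot m f z].
have mn := measurable_near_pot m mf f0.
have mG : measurable G.
  by rewrite -[G]setTI; exact: emeasurable_fun_o_infty.
have mL := measurable_csi_level t mf f0.
have mIG : measurable_fun setT (fun z => (\1_G z)%:E : \bar R).
  exact/measurable_EFinP/measurable_indic.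
have mIL : measurable_fun setT (fun z => (\1_(csi_level f Kcsi t) z)%:E : \bar R).
  exact/measurable_EFinP/measurable_indic.
have IG0 z : 0 <= (\1_G z)%:E :> \bar R by rewrite lee_fin.
have IL0 z : 0 <= (\1_(csi_level f Kcsi t) z)%:E :> \bar R by rewrite lee_fin.
have avgG : avg m.+2 (fun z => (\1_G z)%:E) x <= (2^-1)%:E.
  rewrite -(@lee_pmul2l _ E%:E) ?lte_fin//.
  rewrite -avgZ ?(ltW E0)//.
  apply: (@le_trans _ _ (avg m.+2 (near_pot m f) x)).
    apply: le_avg => z; rewrite ?mule_ge0 ?lee_fin ?near_pot_ge0 ?(ltW E0)//.
    move=> _; rewrite indicE; have [/set_mem/ltW|_] := boolP (z \in G).
      by rewrite mule1.
    by rewrite mule0 near_pot_ge0.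
  apply: le_trans (near_mean m x mf f0) _.
  apply: (@le_trans _ _ ((D * (1 - rho)^-1)%:E * (4 * D * t)%:E)).
    by rewrite lee_wpmul2l// lee_fin mulr_ge0// ltW.
  rewrite -!EFinM lee_fin /E le_eqVlt; apply/orP; left; apply/eqP; field.
  by rewrite gt_eqF// subr_gt0.
have cover : 1 <= avg m.+2 (fun z => (\1_(csi_level f Kcsi t) z)%:E + (\1_G z)%:E) x.
  rewrite -(@avg_cst m.+2 1%R x)//; apply: le_avg => // z; first by rewrite adde_ge0.
  move=> xz /=; rewrite !indicE; have [_|/negP zG] := boolP (z \in G).
    by rewrite leeDr// lee_fin.
  rewrite mem_set ?adde0//.
  have ng : near_pot m f z <= E%:E.
    by rewrite leNgt; apply/negP => h; apply: zG; exact/mem_set.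
  apply/andP; split.
    (* If the potential at [z] were at most [t], [far_lower] would bound the partial sum at [x] by
       [avg 2 f x] plus D t, hence by 2 D t. This is what fixes the lower threshold 2 D t. *)
    rewrite ltNge; apply/negP => pz.
    have := far_lower f0 xz; apply/negP; rewrite -ltNge; apply: le_lt_trans lo.
    apply: (@le_trans _ _ ((D * t)%:E + D%:E * t%:E)).
      apply: leeD; last by rewrite lee_wpmul2l ?lee_fin.
      apply: le_trans (avg_comp f0 (N_refl 2 x)) _.
      by rewrite EFinM lee_wpmul2l ?lee_fin.
    by rewrite -EFinM -EFinD lee_fin; lra.
  rewrite (pot_split m z f0).
  apply: (@le_trans _ _ (D%:E * (t%:E + (4 * D * t)%:E) + E%:E)).
    apply: leeD => //; apply: le_trans (far_upper f0 xz) _.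
    by rewrite lee_wpmul2l ?lee_fin//; exact: leeD.
  have -> : D%:E * (t%:E + (4 * D * t)%:E) + E%:E = (D * (t + 4 * D * t) + E)%:E by [].
  by rewrite lee_fin /Kcsi /E; lra.
rewrite avgD// in cover.
rewrite leNgt; apply/negP => h.
have Gfin : avg m.+2 (fun z => (\1_G z)%:E) x \is a fin_num.
  by rewrite ge0_fin_numE ?avg_ge0// (le_lt_trans avgG)// ltry.
have := lte_leD Gfin h avgG; rewrite ltNge => /negP; apply; apply: le_trans cover.
by rewrite -EFinD lee_fin; lra.
Qed.

(** The terms that carry the partial sums from 2 D t past 4 D t add up to at least 2 D t. At each of
    their scales half of the neighbourhood lies in the layer, and there [maxf f] is at least 1/D
    times the mean at that scale. The potential of the layer part is thus at least 2 D t / (2 D) =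
    t, and the factor 1/t normalizes it. *)
Lemma pot_csi_fun f x t : measurable_fun setT f -> (forall y, 0 <= f y) ->
  (0 < t)%R -> (4 * D * t)%:E < pot f x -> 1 <= pot (csi_fun f Kcsi t) x.
Proof.
move=> mf f0 t0 up.
have mM := measurable_maxf mf f0.
have M0 y : 0 <= maxf f y by exact: maxf_ge0.
have mc := measurable_csi_fun t mf f0.
have c0 y : 0 <= csi_fun f Kcsi t y by exact: csi_fun_ge0.
have t10 : (0 <= t^-1)%R by rewrite invr_ge0 ltW.
have [a1|a1] := ltP t%:E (avg 1 f x).
  apply: le_trans (pot_ge_term 0 x c0); rewrite expr0 mul1e.
  rewrite -(@avg_cst 2 1%R x)//; apply: le_avg => // y xy.
  rewrite /csi_fun indicE mem_set; first by rewrite leeDl// mule_ge0 ?mule_ge0 ?lee_fin.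
  rewrite /= (@lt_le_trans _ _ (avg 0 f y))// ?maxf_ge//.
  rewrite -(@lte_pmul2l _ D%:E) ?lte_fin// -EFinM mulrC divfK ?gt_eqF//.
  apply: lt_le_trans a1 _; apply: avg_comp => //; exact: N_le xy.
pose s k := \sum_(0 <= i < k) (rho ^+ i)%:E * avg i.+2 f x.
have [k sk] : exists k, (4 * D * t)%:E < s k.
  apply: contrapT => ns; move: up; apply/negP; rewrite -leNgt.
  apply: lime_le; first by apply: is_cvg_nneseries => i _ _; exact: term_ge0.
  by apply: nearW => k; rewrite leNgt; apply/negP => h; apply: ns; exists k.
have [k2 sk2 kmin] := ex_minnP (ex_intro (fun k => (4 * D * t)%:E < s k) k sk).
have below j : (j < k2)%N -> s j <= (4 * D * t)%:E.
  by move=> jk; rewrite leNgt; apply/negP => /kmin; rewrite leqNgt jk.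
(* A scale is good once the partial sum that includes it exceeds 2 D t. The scales before that
   contribute at most 2 D t in total. *)
pose good j := (2 * D * t)%:E < s j.+1.
have sgood j : s j <= (2 * D * t)%:E +
    \sum_(0 <= i < j) (if good i then (rho ^+ i)%:E * avg i.+2 f x else 0).
  have S0 i : 0 <= \sum_(0 <= l < i) (if good l then (rho ^+ l)%:E * avg l.+2 f x else 0).
    by rewrite sume_ge0// => l _; case: ifP => // _; exact: term_ge0.
  have D0t : 0 <= (2 * D * t)%:E by rewrite lee_fin !mulr_ge0// ltW.
  elim: j => [|j IH]; first by rewrite /s !big_nat1 || rewrite /s !big_geq// adde0.
  rewrite [X in _ + X]big_nat_recr//=; case: ifPn => [_|].
    by rewrite /s big_nat_recr//= addeA leeD2r.
  by rewrite /good -leNgt adde0 => h; rewrite (le_trans h)// leeDl.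
have half j : (j < k2)%N -> good j ->
    (2 * D)^-1%:E * avg j.+2 f x <= avg j.+2 (fun z => (\1_(csi_level f Kcsi t) z)%:E * maxf f z) x.
  move=> jk gj; have h := csi_half mf f0 t0 a1 gj (below j jk).
  have mL := measurable_csi_level t mf f0.
  have mIL : measurable_fun setT (fun z => (\1_(csi_level f Kcsi t) z)%:E : \bar R).
    exact/measurable_EFinP/measurable_indic.
  have IL0 z : 0 <= (\1_(csi_level f Kcsi t) z)%:E :> \bar R by rewrite lee_fin.
  have lowM z : N j.+2 x z -> (D^-1)%:E * avg j.+2 f x <= maxf f z.
    move=> xz; apply: le_trans (maxf_ge j.+1 f z).
    rewrite -(@lee_pmul2l _ D%:E) ?lte_fin// muleA -EFinM divff ?gt_eqF// mul1e.
    exact: avg_comp.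
  (* The mean may be infinite while [avgZ] takes a real factor, so the bound is first proved for
     every real [r] below it. *)
  have main (r : R) : (0 <= r)%R -> r%:E <= (D^-1)%:E * avg j.+2 f x ->
      (2^-1 * r)%:E <= avg j.+2 (fun z => (\1_(csi_level f Kcsi t) z)%:E * maxf f z) x.
    move=> r0 rD; apply: (@le_trans _ _ (avg j.+2 (fun z => r%:E * (\1_(csi_level f Kcsi t) z)%:E) x)).
      by rewrite avgZ// mulrC EFinM lee_wpmul2l ?lee_fin.
    apply: le_avg => z; rewrite ?mule_ge0 ?lee_fin//.
    by move=> xz; rewrite muleC lee_wpmul2l// (le_trans rD)// lowM.
  have -> : (2 * D)^-1%:E * avg j.+2 f x = (2^-1)%:E * ((D^-1)%:E * avg j.+2 f x).
    by rewrite muleA -EFinM invfM.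
  move: main; have : 0 <= (D^-1)%:E * avg j.+2 f x by rewrite mule_ge0 ?avg_ge0 ?lee_fin ?invr_ge0.
  case: ((D^-1)%:E * avg j.+2 f x) => [r r0 main| _ main|//].
    by rewrite -EFinM; apply: main.
  suff -> : avg j.+2 (fun z => (\1_(csi_level f Kcsi t) z)%:E * maxf f z) x = +oo by exact: leey.
  apply/eqyP => r r0.
  have := main (2 * r)%R; rewrite mulrA mulVf ?mul1r//; apply; last exact: leey.
  by rewrite mulr_ge0// ltW.
pose g z := (\1_(csi_level f Kcsi t) z)%:E * maxf f z.
have mg : measurable_fun setT g.
  apply: measurable_mule => //.
  exact/measurable_EFinP/measurable_indic/measurable_csi_level.
have g0 z : 0 <= g z by rewrite mule_ge0// lee_fin.
apply: (@le_trans _ _ ((t^-1)%:E * pot g x)); last first.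
  rewrite -potZ//; apply: le_pot => // y; rewrite ?mule_ge0 ?lee_fin//.
  by rewrite /csi_fun leeDr ?lee_fin.
rewrite -(@lee_pmul2l _ t%:E) ?lte_fin// mule1 muleA -EFinM divff ?gt_eqF// mul1e.
rewrite -(@lee_pmul2l _ (2 * D)%:E) ?lte_fin ?mulr_gt0//.
apply: (@le_trans _ _ (\sum_(0 <= i < k2) (if good i then (rho ^+ i)%:E * avg i.+2 f x else 0))).
  rewrite -(@leeD2lE _ (2 * D * t)%:E)//; apply: le_trans (sgood k2); apply: le_trans (ltW sk2).
  by rewrite -EFinM -EFinD lee_fin; lra.
apply: (@le_trans _ _ ((2 * D)%:E * \sum_(0 <= i < k2) (rho ^+ i)%:E * avg i.+2 g x)); last first.
  by rewrite lee_wpmul2l ?pot_ge_sum// lee_fin mulr_ge0.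
rewrite ge0_sume_distrr; last by move=> i _; exact: term_ge0.
rewrite !big_nat; apply: lee_sum => i /andP[_ ik].
case: ifPn => [gi|_]; last by rewrite mule_ge0 ?term_ge0// lee_fin mulr_ge0.
rewrite muleCA lee_wpmul2l ?lee_fin//.
have D20 : 0 <= (2 * D)%:E by rewrite lee_fin mulr_ge0.
have := lee_wpmul2l D20 (half i ik gi).
by rewrite muleA -EFinM divff ?mul1e// gt_eqF// mulr_gt0.
Qed.

(* [Gf tau] bounds the capacity of the level set [{tau < (pot f)^s}]. *)
Lemma capacitary_strong_type (s : R) : (1 < s)%R -> exists2 C : R, (0 < C)%R &
  forall f, measurable_fun setT f -> (forall y, 0 <= f y) ->
  exists Gf : measurableTypeR R -> \bar R,
    [/\ measurable_fun setT Gf, forall t, 0 <= Gf t,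
        \int[lebesgue_measure]_t Gf t <= C%:E * \int[mu]_x f x `^ s &
        forall tau : R, (0 < tau)%R -> exists2 phi : T -> \bar R,
          measurable_fun setT phi /\ (forall y, 0 <= phi y) &
          (forall x, tau%:E < pot f x `^ s -> 1 <= pot phi x) /\
          \int[mu]_x phi x `^ s <= Gf tau].
Proof.
move=> s1; have s0 : (0 < s)%R by exact: lt_trans s1.
have [CM CM0 HM] := maxf_strong_type s1.
have K0 := Kcsi_gt0.
(* [b] is the loss in [pot_csi_fun]: the level [tau] of (pot f)^s is tested with [csi_fun] at t =
   tau^(1/s) / b. *)
pose b := (4 * D)%R; have b0 : (0 < b)%R by rewrite mulr_gt0.
pose c1 := ((b * D) `^ s)%R; have c10 : (0 < c1)%R by rewrite powR_gt0// mulr_gt0.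
pose c2 := (b `^ s * Kcsi `^ s)%R; have c20 : (0 < c2)%R by rewrite mulr_gt0 ?powR_gt0.
exists (2 `^ s * (c1 + c2) * CM)%R.
  by rewrite !mulr_gt0 ?powR_gt0// addr_gt0.
move=> f mf f0.
have mM := measurable_maxf mf f0; have mp := measurable_pot mf f0.
have M0 x : 0 <= maxf f x by exact: maxf_ge0.
have p0 x : 0 <= pot f x by exact: pot_ge0.
pose Y1 x := ((b * D)%:E * maxf f x) `^ s.
pose Y2 x := (b%:E * pot f x) `^ s.
have mY1 : measurable_fun setT Y1 by apply: measurable_poweR_fun; exact: measurable_mule.
have mY2 : measurable_fun setT Y2 by apply: measurable_poweR_fun; exact: measurable_mule.
have Y10 x : 0 <= Y1 x by exact: poweR_ge0.
have Y20 x : 0 <= Y2 x by exact: poweR_ge0.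
have mMs : measurable_fun setT (fun x => maxf f x `^ s) by exact: measurable_poweR_fun.
have Ms0 x : 0 <= maxf f x `^ s by exact: poweR_ge0.
pose A1 := [set z : measurableTypeR R * T | (0 < z.1)%R /\ z.1%:E < Y1 z.2].
have mA1 : measurable A1 := measurable_below mY1.
(* The layer in terms of [tau] in place of [t]: with tau = (b t)^s, the bounds t < pot f <= K t
   become tau < [Y2] <= K^s tau. *)
pose A2 := [set z : measurableTypeR R * T | (0 < z.1)%R /\ z.1%:E < Y2 z.2] `&`
           [set z | Y2 z.2 <= (Kcsi `^ s)%:E * z.1%:E].
have mA2 : measurable A2.
  apply: measurableI; first exact: measurable_below mY2.
  have mK : measurable_fun setT (fun z : measurableTypeR R * T => (Kcsi `^ s)%:E * z.1%:E).
    by apply: measurable_mule => //; apply/measurable_EFinP; exact: measurable_fst.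
  rewrite -[X in measurable X]setTI.
  exact: (measurable_lee measurableT (measurableT_comp mY2 measurable_snd) mK).
pose h (t : R) : \bar R := (t `^ (-1))%:E.
have mh : measurable_fun setT (h : measurableTypeR R -> \bar R).
  by apply/measurable_EFinP; exact: measurable_powR.
have h0 t : 0 <= h t by rewrite lee_fin powR_ge0.
pose I1 (t : measurableTypeR R) := \int[mu]_x ((\1_A1 (t, x))%:E * cst 1 x).
pose I2 (t : measurableTypeR R) := \int[mu]_x ((\1_A2 (t, x))%:E * maxf f x `^ s).
have mI (A : set (measurableTypeR R * T)) g : measurable A -> measurable_fun setT g ->
    (forall x, 0 <= g x) ->
    measurable_fun setT (fun t : measurableTypeR R => \int[mu]_x ((\1_A (t, x))%:E * g x)).
  move=> mA mg g0.
  apply: (measurable_fun_fubini_tonelli_F (fun z => (\1_A z)%:E * g z.2)).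
    apply: measurable_mule; last exact: (measurableT_comp mg).
    exact/measurable_EFinP/measurable_indic.
  by move=> z; rewrite mule_ge0// lee_fin.
have mI1 : measurable_fun setT I1 by exact: mI.
have mI2 : measurable_fun setT I2 by exact: mI.
have I10 t : 0 <= I1 t.
  by apply: integral_ge0 => x _; rewrite mule_ge0 ?lee_fin.
have I20 t : 0 <= I2 t.
  by apply: integral_ge0 => x _; rewrite mule_ge0 ?lee_fin.
have bs0 : (0 <= b `^ s)%R by exact: powR_ge0.
have two0 : (0 <= 2 `^ s :> R)%R by exact: powR_ge0.
pose Gf (t : measurableTypeR R) := (2 `^ s)%:E * (I1 t + (b `^ s)%:E * (h t * I2 t)).
have mhI2 : measurable_fun setT (fun t : measurableTypeR R => h t * I2 t).
  exact: measurable_mule.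
have hI20 t : 0 <= h t * I2 t by rewrite mule_ge0.
exists Gf; split.
- apply: measurable_mule => //; apply: measurable_adde => //.
  exact: measurable_mule.
- by move=> t; rewrite /Gf mule_ge0 ?lee_fin// adde_ge0 ?I10// mule_ge0 ?lee_fin.
- rewrite integralZl_ge0 ?lee_fin//; last 2 first.
  + by apply: measurable_adde => //; exact: measurable_mule.
  + by move=> t; rewrite adde_ge0// mule_ge0// lee_fin.
  rewrite ge0_integralD//; last 2 first.
  + by move=> t _; rewrite mule_ge0// lee_fin.
  + exact: measurable_mule.
  rewrite integralZl_ge0 ?lee_fin//.
  have E1 : \int[lebesgue_measure]_t I1 t = c1%:E * \int[mu]_x maxf f x `^ s.
    transitivity (\int[lebesgue_measure]_t (cst 1 t * I1 t)).
      by apply: eq_integral => t _; rewrite mul1e.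
    rewrite layer_tonelli// -integralZl_ge0 ?lee_fin ?(ltW c10)//.
    apply: eq_integral => x _; rewrite mul1e.
    have -> : c1%:E * maxf f x `^ s = Y1 x.
      by rewrite /Y1 poweRM// lee_fin mulr_ge0// ltW.
    rewrite -[RHS](measure_below (Y10 x)) -integral_setT_indic.
      by apply: eq_integral => t _; rewrite mule1.
    rewrite -[X in measurable X]setTI.
    exact: (measurable_pair2 x measurableT mA1).
  have E2 : (b `^ s)%:E * \int[lebesgue_measure]_t (h t * I2 t) <= c2%:E * \int[mu]_x maxf f x `^ s.
    rewrite /c2 EFinM -muleA lee_wpmul2l ?lee_fin//.
    rewrite layer_tonelli// -integralZl_ge0 ?lee_fin ?powR_ge0//.
    apply: le_integral_nonmeas => x _.
      by rewrite mule_ge0// integral_ge0// => t _; rewrite mule_ge0 ?h0// lee_fin.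
    rewrite muleC lee_wpmul2r//.
    have [Y2oo|] := eqVneq (Y2 x) +oo.
      rewrite integral0_eq ?lee_fin ?powR_ge0// => t _.
      rewrite indicE memNset ?mul0e// => -[_ /=]; rewrite Y2oo -EFinM.
      by rewrite leye_eq.
    move: (Y20 x); case EY : (Y2 x) => [X| |//] X0 // _; rewrite lee_fin in X0.
    move: X0; rewrite le_eqVlt => /predU1P[X0|X0].
      rewrite integral0_eq ?lee_fin ?powR_ge0// => t _.
      rewrite indicE memNset ?mul0e// => -[[/= t0]]; rewrite EY -X0 lte_fin.
      by move/(lt_trans t0); rewrite ltxx.
    (* The bounded overlap of the layers. For a fixed [x], 1/t is at most K^s / X on the layer and t
       stays in ]0, X[, so the integral of dt/t over the layer is at most K^s, whatever [x] is. *)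
    apply: (@le_trans _ _ (\int[lebesgue_measure]_t ((Kcsi `^ s / X)%:E *
        (\1_[set u : R | (0 < u)%R /\ (u%:E < X%:E)%E] t)%:E))).
      apply: le_integral_nonmeas => t _; first by rewrite mule_ge0 ?h0// lee_fin.
      rewrite indicE; have [/set_mem[[/= t0 tX] tK]|_] := boolP ((t, x) \in A2); last first.
        by rewrite mul0e mule_ge0// lee_fin divr_ge0 ?powR_ge0// ltW.
      rewrite mul1e indicE mem_set ?mule1; last by split => //; rewrite -EY.
      rewrite /h lee_fin powR_inv1 ?(ltW t0)//.
      move: tK; rewrite /= EY -EFinM lee_fin => tK.
      by rewrite ler_pdivlMr// mulrC ler_pdivrMr.
    have mX : measurable [set u : measurableTypeR R | (0 < u)%R /\ (u%:E < X%:E)%E].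
      have := @measurable_itv R `]0%R, X[; congr (measurable _).
      by apply/seteqP; split => u /=; rewrite in_itv/= lte_fin => /andP.
    rewrite integralZl_ge0 ?lee_fin//; last 2 first.
    - by rewrite divr_ge0 ?powR_ge0// ltW.
    - exact/measurable_EFinP/measurable_indic.
    have X0' : 0 <= X%:E by rewrite lee_fin ltW.
    rewrite integral_setT_indic//.
    rewrite [Z in _ * Z <= _](_ : _ = X%:E); last exact: measure_below X0'.
    by rewrite -EFinM lee_fin divfK// gt_eqF.
  rewrite E1; apply: (@le_trans _ _ ((2 `^ s * (c1 + c2))%:E * \int[mu]_x maxf f x `^ s)).
    rewrite EFinM -muleA lee_wpmul2l ?lee_fin// EFinD ge0_muleDl ?lee_fin ?(ltW c10) ?(ltW c20)//.
    by rewrite leeD2l.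
  rewrite [X in _ <= X * _]EFinM -muleA lee_wpmul2l ?HM// lee_fin mulr_ge0//.
  by rewrite addr_ge0// ltW.
move=> tau tau0.
have [t t0 bt] : exists2 t : R, (0 < t)%R & (b * t = tau `^ s^-1)%R.
  exists (tau `^ s^-1 / b)%R; first by rewrite divr_gt0// powR_gt0.
  by rewrite mulrC divfK ?gt_eqF.
have bts : ((b * t) `^ s = tau)%R.
  by rewrite bt -powRrM mulVf ?gt_eqF// powRr1// ltW.
have bt0 : (0 < b * t)%R by exact: mulr_gt0.
have up Z : 0 <= Z -> (b * t)%:E < Z -> tau%:E < Z `^ s.
  move=> Z0 h1; rewrite ltNge; apply/negP => /(poweR_mono (p := s^-1)).
  rewrite invr_ge0 (ltW s0) poweR_ge0 => /(_ isT isT).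
  by rewrite poweRK// poweR_EFin -bt leNgt h1.
have down Z : 0 <= Z -> tau%:E < Z `^ s -> (b * t)%:E < Z.
  move=> Z0 h1; rewrite ltNge; apply/negP => h2.
  have := poweR_mono (ltW s0) Z0 h2; rewrite poweR_EFin bts.
  by rewrite leNgt h1.
exists (csi_fun f Kcsi t).
  by split; [exact: measurable_csi_fun|move=> y; exact: csi_fun_ge0].
split.
  by move=> x /(down _ (p0 x)) ?; exact: pot_csi_fun.
have mS1 : measurable [set y | ((t / D)%:E < maxf f y)%E].
  by rewrite -[X in measurable X]setTI; exact: emeasurable_fun_o_infty.
have mL := measurable_csi_level t mf f0.
apply: (@le_trans _ _ (\int[mu]_x ((2 `^ s)%:E * ((\1_A1 (tau, x))%:E * cst 1 x +
    (b `^ s)%:E * (h tau * ((\1_A2 (tau, x))%:E * maxf f x `^ s)))))).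
  apply: le_integral_nonmeas => x _; first exact: poweR_ge0.
  apply: le_trans (poweR_addl (ltW s0) _ _) _.
  - by rewrite lee_fin.
  - by rewrite mule_ge0 ?mule_ge0 ?lee_fin ?invr_ge0 ?(ltW t0).
  rewrite lee_wpmul2l ?lee_fin//; apply: leeD.
    rewrite indicE; have [/set_mem/= h1|_] := boolP (x \in _); last first.
      by rewrite poweR0r ?gt_eqF// mule_ge0 ?lee_fin.
    rewrite indicE mem_set ?mul1e ?poweR_EFin ?powR1//; split => //=.
    apply: up; first by rewrite mule_ge0 ?lee_fin ?mulr_ge0// ltW.
    move: h1; rewrite -(@lte_pmul2l _ (b * D)%:E) ?lte_fin ?mulr_gt0//.
    apply: le_lt_trans; rewrite -EFinM lee_fin le_eqVlt; apply/orP; left; apply/eqP.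
    by field; rewrite gt_eqF.
  rewrite poweRM ?lee_fin ?invr_ge0 ?(ltW t0)//; last by rewrite mule_ge0 ?lee_fin.
  have -> : (t^-1)%:E `^ s = (b `^ s)%:E * h tau.
    rewrite poweR_EFin /h -EFinM; congr (_%:E).
    rewrite -[in RHS]bts -powRrM mulrN1 powRN powRM ?(ltW b0) ?(ltW t0)//.
    rewrite invfM mulrA divff ?gt_eqF ?powR_gt0// mul1r.
    by rewrite -[(t^-1)%R]powR_inv1 ?(ltW t0)// -powRrM mulN1r powRN.
  rewrite -muleA lee_wpmul2l ?lee_fin// lee_wpmul2l//.
  rewrite indicE; have [/set_mem/= /andP[h1 h2]|_] := boolP (x \in _); last first.
    by rewrite mul0e poweR0r ?gt_eqF// mule_ge0 ?lee_fin.
  rewrite mul1e indicE mem_set ?mul1e//; split.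
    split => //=; apply: up; first by rewrite mule_ge0 ?lee_fin ?(ltW b0).
    by rewrite EFinM lte_pmul2l ?lte_fin.
  rewrite /= /Y2 -bts -EFinM -powRM ?(ltW K0) ?(ltW bt0)// -poweR_EFin.
  apply: poweR_mono; rewrite ?(ltW s0) ?mule_ge0 ?lee_fin ?(ltW b0)//.
  have -> : (Kcsi * (b * t))%:E = b%:E * (Kcsi * t)%:E by rewrite -EFinM mulrCA.
  by rewrite lee_wpmul2l ?lee_fin ?(ltW b0).
have m1 (A : set (measurableTypeR R * T)) : measurable A ->
    measurable_fun setT (fun x => (\1_A (tau, x))%:E : \bar R).
  move=> mA; apply/measurable_EFinP.
  exact: (measurableT_comp (measurable_indic mA) (measurable_pair1 tau)).
have mB : measurable_fun setT (fun x => (\1_A2 (tau, x))%:E * maxf f x `^ s).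
  by apply: measurable_mule => //; exact: m1.
have B0 x : 0 <= (\1_A2 (tau, x))%:E * maxf f x `^ s by rewrite mule_ge0 ?lee_fin.
have mB' : measurable_fun setT (fun x => h tau * ((\1_A2 (tau, x))%:E * maxf f x `^ s)).
  exact: measurable_mule.
have B0' x : 0 <= h tau * ((\1_A2 (tau, x))%:E * maxf f x `^ s) by rewrite mule_ge0.
have mC : measurable_fun setT (fun x => (\1_A1 (tau, x))%:E * cst (1 : \bar R) x).
  by apply: measurable_mule => //; exact: m1.
have C0 x : 0 <= (\1_A1 (tau, x))%:E * cst (1 : \bar R) x by rewrite mule_ge0 ?lee_fin.
rewrite integralZl_ge0 ?lee_fin//; last 2 first.
- by apply: measurable_adde => //; exact: measurable_mule.
- by move=> x; rewrite adde_ge0// mule_ge0 ?lee_fin.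
rewrite ge0_integralD//; last 2 first.
- by move=> x _; rewrite mule_ge0 ?lee_fin.
- exact: measurable_mule.
rewrite integralZl_ge0 ?lee_fin//.
by rewrite integralZl_ge0.
Qed.

(** Enumerates all integer powers of 2 by natural numbers: even indices give the exponents >= 0, odd
    ones the exponents < 0. Sums over dyadic levels become ordinary series. *)
Definition lev (i : nat) : R := if odd i then ((2 ^+ (i./2).+1)^-1)%R else (2 ^+ i./2)%R.

Lemma lev_gt0 i : (0 < lev i)%R.
Proof. by rewrite /lev; case: ifP => _; rewrite ?invr_gt0 exprn_gt0. Qed.

Lemma ltr_expn2 (y : R) : exists k, (y < 2 ^+ k)%R.
Proof.
exists (Num.bound `|y|); apply: (@le_lt_trans _ _ `|y|%R); first exact: ler_norm.
apply: (lt_trans (archi_boundP (normr_ge0 y))).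
by rewrite -natrX ltr_nat ltn_expl.
Qed.

Lemma lev_cover (y : R) : (0 < y)%R -> exists i, (lev i < y <= 2 * lev i)%R.
Proof.
move=> y0; have [y1|y1] := ltP 1%R y.
  have ex : exists k, (y <= 2 ^+ k)%R by have [k /ltW] := ltr_expn2 y; exists k.
  have [[|k] yk kmin] := ex_minnP ex.
    by move: yk; rewrite expr0 leNgt y1.
  exists k.*2; rewrite /lev odd_double doubleK -exprS yk andbT ltNge.
  by apply/negP => /kmin; rewrite ltnn.
have [[|k] yk kmin] := ex_minnP (ltr_expn2 y^-1).
  by move: yk; rewrite expr0 ltNge invf_ge1 ?y1.
exists (k.*2.+1); rewrite /lev/= odd_double/= uphalf_double.
apply/andP; split; first by rewrite -[ltRHS]invrK ltf_pV2 ?posrE ?invr_gt0 ?exprn_gt0.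
rewrite exprS invfM mulrA divff ?mul1r ?pnatr_eq0// -[leLHS]invrK lef_pV2 ?posrE ?invr_gt0 ?exprn_gt0//.
by rewrite leNgt; apply/negP => /kmin; rewrite ltnn.
Qed.

(** Distinct powers of 2 differ at least by a factor 2, so the intervals []lev i / 2, lev i]] are
    disjoint. *)
Lemma lev_inj i j : (lev j / 2 < lev i)%R -> (lev i / 2 < lev j)%R -> i = j.
Proof.
have e2 (a b : nat) : (2 ^+ a / 2 < 2 ^+ b :> R)%R -> (a <= b)%N.
  rewrite ltr_pdivrMr// -exprSr ltr_eXn2l ?ltr1n//.
have big (a : nat) : (1 <= 2 ^+ a :> R)%R by rewrite exprn_ege1// ler1n.
have small (a : nat) : ((2 ^+ a.+1)^-1 <= 2^-1 :> R)%R.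
  by rewrite lef_pV2 ?posrE ?exprn_gt0// exprS ler_peMr.
have o2 (a b : nat) : ((2 ^+ a.+1)^-1 / 2 < (2 ^+ b.+1)^-1 :> R)%R -> (b <= a)%N.
  rewrite -invfM ltf_pV2 ?posrE ?mulr_gt0 ?exprn_gt0// -exprSr ltr_eXn2l ?ltr1n//.
have mix (a b : nat) : ~ (2 ^+ a / 2 < (2 ^+ b.+1)^-1 :> R)%R.
  move=> h; have := lt_le_trans h (small b).
  by rewrite ltr_pdivrMr// mulVf ?pnatr_eq0// ltNge big.
have := odd_double_half i; have := odd_double_half j; rewrite /lev.
case: (odd i) => /=; case: (odd j) => /= ji ii.
- by move=> /o2 h1 /o2 h2; rewrite -ji -ii; congr (_ + _.*2)%N; apply/eqP; rewrite eqn_leq h1 h2.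
- by move=> /mix.
- by move=> _ /mix.
- by move=> /e2 h1 /e2 h2; rewrite -ji -ii; congr (_ + _.*2)%N; apply/eqP; rewrite eqn_leq h1 h2.
Qed.

(** * Choquet integrals of potentials and of maximal functions *)

Variable Cap : set T -> \bar R.
Hypothesis Cap_ge0 : forall E, 0 <= Cap E.
Hypothesis le_Cap : forall E F, E `<=` F -> Cap E <= Cap F.

(** On []lev i / 2, lev i]] the integrand is at least [Cap (E (lev i))], because the sets decrease
    with the level; these intervals are disjoint and have length [lev i / 2]. *)
Lemma lev_sum_le (E : R -> set T) : (forall t u, (t <= u)%R -> E u `<=` E t) ->
  \sum_(i <oo) (lev i / 2)%:E * Cap (E (lev i)) <=
  \int[lebesgue_measure]_(t in `[0%R, +oo[) Cap (E t).
Proof.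
move=> nE.
pose I i : set (measurableTypeR R) := `](lev i / 2)%R, (lev i)]%classic.
have lev2 i : (lev i / 2 < lev i)%R.
  by rewrite ltr_pdivrMr// ltr_pMr ?lev_gt0// ltr1n.
have mI i : measurable (I i) by exact: measurable_itv.
have mII i : measurable_fun setT (fun t => (\1_(I i) t)%:E : \bar R).
  exact/measurable_EFinP/measurable_indic.
have -> : \sum_(i <oo) (lev i / 2)%:E * Cap (E (lev i)) =
    \sum_(i <oo) \int[lebesgue_measure]_t (Cap (E (lev i)) * (\1_(I i) t)%:E).
  apply: eq_eseriesr => i _; rewrite integralZl_ge0// integral_setT_indic// muleC.
  congr (_ * _); have := @lebesgue_measure_itv R `](lev i / 2)%R, (lev i)].
  rewrite /= lte_fin lev2 => ->; rewrite -EFinB; congr (_%:E).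
  by field.
rewrite -integral_nneseries//; last 2 first.
- by move=> i; exact: measurable_mule.
- by move=> i t _; rewrite mule_ge0 ?lee_fin.
rewrite [leRHS]integral_mkcond; apply: le_integral_nonmeas => t _.
  by apply: nneseries_ge0 => i _ _; rewrite mule_ge0 ?lee_fin.
have [[i ti]|nt] := pselect (exists i, I i t); last first.
  rewrite eseries0; first by apply: erestrict_ge0 => u _; exact: Cap_ge0.
  move=> i _ _; rewrite indicE memNset ?mule0// => ti; apply: nt.
  by exists i.
rewrite (nneseriesD1 (n := i))//; last by move=> j _; rewrite mule_ge0 ?lee_fin.
rewrite eseries0 ?adde0.
  rewrite indicE mem_set// mule1.
  move: ti; rewrite /I/= in_itv/= => /andP[h1 h2].
  rewrite patchE mem_set; first by apply: le_Cap; exact: nE.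
  rewrite /= in_itv/= andbT (le_trans _ (ltW h1))// divr_ge0//.
  exact/ltW/lev_gt0.
move=> j _ ji; rewrite indicE memNset ?mule0// => tj; move/eqP: ji; apply.
move: ti tj; rewrite /I/= !in_itv/= => /andP[h1 h2] /andP[h3 h4].
by apply: lev_inj; [exact: lt_le_trans h1 h4|exact: lt_le_trans h3 h2].
Qed.

Lemma choquet_represent (s c : R) (D0 : set T) (F : T -> \bar R) (e : R) :
  (1 < s)%R -> (0 < c)%R -> (0 < e)%R ->
  (forall E (d : R), (0 < d)%R -> Cap E < +oo -> exists2 phi : T -> \bar R,
    measurable_fun setT phi /\ (forall y, 0 <= phi y) &
    (forall x, E x -> 1 <= pot phi x) /\
    \int[mu]_x phi x `^ s <= c%:E * (Cap E + d%:E)) ->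
  let J := \int[lebesgue_measure]_(t in `[0%R, +oo[) Cap (D0 `&` [set x | t%:E < F x]) in
  J < +oo -> exists2 g : T -> \bar R,
    measurable_fun setT g /\ (forall y, 0 <= g y) &
    (forall x, D0 x -> F x <= pot g x `^ s) /\
    \int[mu]_x g x `^ s <= (4 * c)%:E * (J + e%:E).
Proof.
move=> s1 c0 e0 HC J Joo; have s0 : (0 < s)%R by exact: lt_trans s1.
pose E t := D0 `&` [set x | t%:E < F x].
have nE t u : (t <= u)%R -> E u `<=` E t.
  by move=> tu x [Dx /= ux]; split => //=; apply: le_lt_trans ux; rewrite lee_fin.
have sumJ := lev_sum_le nE; rewrite -/J in sumJ.
have l20 i : (0 < lev i / 2)%R by rewrite divr_gt0// lev_gt0.
have t0 i : 0 <= (lev i / 2)%:E * Cap (E (lev i)) by rewrite mule_ge0// lee_fin ltW.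
have Coo i : Cap (E (lev i)) < +oo.
  rewrite ltey; apply/eqP => Ei; move: (le_lt_trans sumJ Joo).
  rewrite (nneseries_pinfty (k := i)) ?ltxx//.
  by rewrite Ei mulry gtr0_sg// mul1e.
(* The error at level [i] is going to be multiplied by [2 * lev i] and summed over [i]: dividing by
   [lev i] and by 2^(i+1) keeps the total below a multiple of [e]. *)
pose del i := (e / lev i * 2^-1 ^+ i.+1)%R.
have del0 i : (0 < del i)%R by rewrite mulr_gt0 ?divr_gt0 ?lev_gt0// exprn_gt0.
have /choice[g Hg] : forall i, exists phi : T -> \bar R,
    (measurable_fun setT phi /\ (forall y, 0 <= phi y)) /\
    (forall x, E (lev i) x -> 1 <= pot phi x) /\
    \int[mu]_x phi x `^ s <= c%:E * (Cap (E (lev i)) + (del i)%:E).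
  by move=> i; have [phi h1 h2] := HC (E (lev i)) (del i) (del0 i) (Coo i); exists phi.
have mg i : measurable_fun setT (g i) by have [[]] := Hg i.
have g0 i y : 0 <= g i y by have [[]] := Hg i.
have gE i x : E (lev i) x -> 1 <= pot (g i) x by have [_ [h _]] := Hg i; exact: h.
have gs i : \int[mu]_x g i x `^ s <= c%:E * (Cap (E (lev i)) + (del i)%:E) by have [_ [_ h]] := Hg i.
have L0 i : (0 <= 2 * lev i)%R by rewrite mulr_ge0// ltW// lev_gt0.
(* An l^s sum takes the place of the supremum: its root still dominates every (2 lev i)^(1/s) [g i],
   and its s-th power integrates term by term. The factor 2 covers the values between [lev i] and
   [2 * lev i]. *)
pose S x := \sum_(i <oo) (2 * lev i)%:E * g i x `^ s.
have Si0 i x : 0 <= (2 * lev i)%:E * g i x `^ s by rewrite mule_ge0 ?poweR_ge0 ?lee_fin.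
have mSi i : measurable_fun setT (fun x => (2 * lev i)%:E * g i x `^ s).
  by apply: measurable_mule => //; exact: measurable_poweR_fun.
have S0 x : 0 <= S x by apply: nneseries_ge0 => i _ _.
have mS : measurable_fun setT S.
  by apply: (@ge0_emeasurable_sum _ _ _ setT (fun i x => (2 * lev i)%:E * g i x `^ s) xpredT).
exists (fun x => S x `^ s^-1).
  by split; [exact: measurable_poweR_fun|move=> y; exact: poweR_ge0].
have SG i x : ((2 * lev i) `^ s^-1)%:E * g i x <= S x `^ s^-1.
  rewrite -[X in _ * X](poweRK s0 (g0 i x)) -poweR_EFin -poweRM ?poweR_ge0 ?lee_fin//.
  apply: poweR_mono => //; first by rewrite invr_ge0 ltW.
  apply: (@le_trans _ _ (\sum_(0 <= j < i.+1) (2 * lev j)%:E * g j x `^ s)).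
    by rewrite big_nat_recr//= leeDr// sume_ge0.
  by apply: nneseries_lim_ge => j _ _.
have potS i x : E (lev i) x -> (2 * lev i)%:E <= pot (fun x => S x `^ s^-1) x `^ s.
  move=> Ex; rewrite -[X in X%:E](_ : ((2 * lev i) `^ s^-1) `^ s = _)%R; last first.
    by rewrite -powRrM mulVf ?gt_eqF// powRr1.
  rewrite -poweR_EFin; apply: poweR_mono; rewrite ?lee_fin ?powR_ge0 ?(ltW s0)//.
  apply: (@le_trans _ _ (((2 * lev i) `^ s^-1)%:E * pot (g i) x)).
    by rewrite -[leLHS]mule1 lee_wpmul2l ?gE// lee_fin powR_ge0.
  rewrite -potZ ?powR_ge0//; apply: le_pot => y; last exact: SG.
    by rewrite mule_ge0// lee_fin powR_ge0.
  exact: poweR_ge0.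
split.
  move=> x Dx; have [F0|F0] := leP (F x) 0; first exact: le_trans F0 (poweR_ge0 _ _).
  have key (y : R) : (0 < y)%R -> y%:E <= F x -> y%:E <= pot (fun x => S x `^ s^-1) x `^ s.
    move=> y0 yF; have [i /andP[iy yi]] := lev_cover y0.
    apply: (@le_trans _ _ (2 * lev i)%:E); first by rewrite lee_fin.
    by apply: potS; split => //=; apply: lt_le_trans yF; rewrite lte_fin.
  move: F0 key; case: (F x) => [y y0|_|//] key; first by apply: key.
  by rewrite leye_eq; apply/eqP/eqyP => r r0; apply: key => //; exact: leey.
have -> : \int[mu]_x (S x `^ s^-1) `^ s = \int[mu]_x S x.
  by apply: eq_integral => x _; exact: poweRVK.
rewrite integral_nneseries//.
apply: (@le_trans _ _ (\sum_(i <oo) (4 * c)%:E * ((lev i / 2)%:E * Cap (E (lev i)) + (e * 2^-1 ^+ i.+2)%:E))).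
  apply: lee_nneseries => [i _ _|i _]; first exact: integral_ge0.
  rewrite integralZl_ge0 ?lee_fin//; last 2 first.
  - exact: measurable_poweR_fun.
  - by move=> x; exact: poweR_ge0.
  apply: (@le_trans _ _ ((2 * lev i)%:E * (c%:E * (Cap (E (lev i)) + (del i)%:E)))).
    by rewrite lee_wpmul2l ?lee_fin.
  have := Coo i; have := Cap_ge0 (E (lev i)); case: (Cap (E (lev i))) => [r r0 _|//|//].
  rewrite -!(EFinD, EFinM) lee_fin /del le_eqVlt; apply/orP; left; apply/eqP.
  by rewrite !exprS; field; rewrite gt_eqF// lev_gt0.
rewrite nneseriesZl; last first.
  by move=> i _; rewrite adde_ge0// lee_fin mulr_ge0 ?exprn_ge0// ltW.
rewrite lee_wpmul2l ?lee_fin ?mulr_ge0 ?(ltW c0)//.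
have q0 i : (0 <= 2^-1 ^+ i :> R)%R by rewrite exprn_ge0.
rewrite nneseriesD//; last by move=> i _ _; rewrite lee_fin mulr_ge0// ltW.
apply: leeD => //.
apply: (@le_trans _ _ (\sum_(i <oo) e%:E * ((1/2) ^+ i.+1)%:E)).
  apply: lee_nneseries => [i _ _|i _]; first by rewrite lee_fin mulr_ge0// ltW.
  rewrite -EFinM lee_fin ler_wpM2l ?(ltW e0)// mul1r [leLHS]exprS ler_piMl//.
  by lra.
rewrite nneseriesZl; last by move=> i _; rewrite lee_fin exprn_ge0// divr_ge0.
rewrite -[leRHS]mule1 lee_wpmul2l ?lee_fin ?(ltW e0)//.
have -> : \sum_(i <oo) ((1/2) ^+ i.+1)%:E = (1/2)%:E * \sum_(i <oo) ((1/2) ^+ i)%:E :> \bar R.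
  rewrite -nneseriesZl; last by move=> i _; rewrite lee_fin exprn_ge0// divr_ge0.
  by apply: eq_eseriesr => i _; rewrite -EFinM exprS.
rewrite geometric_eseries; [|lra|lra].
have -> : (1 - 1/2 = 1/2 :> R)%R by lra.
by rewrite -EFinM lee_fin mulfV.
Qed.

Lemma choquet_pot_le (s c : R) : (1 < s)%R -> (0 < c)%R ->
  (forall E (phi : T -> \bar R), measurable_fun setT phi -> (forall y, 0 <= phi y) ->
    (forall x, E x -> 1 <= pot phi x) -> Cap E <= c%:E * \int[mu]_x phi x `^ s) ->
  exists2 C : R, (0 < C)%R & forall g F : T -> \bar R,
    measurable_fun setT g -> (forall y, 0 <= g y) ->
    (forall x, F x <= pot g x `^ s) ->
    \int[lebesgue_measure]_(t in `[0%R, +oo[) Cap [set x | t%:E < F x] <=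
    C%:E * \int[mu]_x g x `^ s.
Proof.
move=> s1 c0 HC; have [C C0 H] := capacitary_strong_type s1.
exists (c * C)%R; first exact: mulr_gt0.
move=> g F mg g0 FG; have [Gf [mG G0 IG HG]] := H g mg g0.
(* [HG] gives a bound for positive levels only, so the majorant is infinite at the single level 0,
   which does not affect the integral. *)
pose H' (t : measurableTypeR R) := if t == 0%R then +oo else c%:E * Gf t.
apply: (@le_trans _ _ (\int[lebesgue_measure]_(t in `[0%R, +oo[) H' t)).
  apply: le_integral_nonmeas => t; rewrite /= in_itv/= andbT // => t0.
  rewrite /H'; case: eqVneq => [_|tn0]; first exact: leey.
  have tp : (0 < t)%R by rewrite lt_neqAle eq_sym tn0.
  have [phi [mphi phi0] [phiE phis]] := HG t tp.
  apply: le_trans (HC _ phi mphi phi0 _) _.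
    by move=> x /= tF; apply: phiE; exact: lt_le_trans (FG x).
  by rewrite lee_wpmul2l ?lee_fin// ltW.
have mcG : measurable_fun setT (fun t => c%:E * Gf t) by exact: measurable_mule.
have cG0 t : 0 <= c%:E * Gf t by rewrite mule_ge0// lee_fin ltW.
rewrite -integral_itv_obnd_cbnd; last first.
  apply: (eq_measurable_fun (fun t => c%:E * Gf t)).
    move=> t; rewrite inE/= in_itv/= andbT => t0; rewrite /H' gt_eqF//.
  exact: measurable_funTS.
apply: (@le_trans _ _ (\int[lebesgue_measure]_t (c%:E * Gf t))).
  rewrite [leLHS]integral_mkcond; apply: le_integral_nonmeas => t _; rewrite patchE.
    by case: ifPn => // _; rewrite /H'; case: ifP => // _; exact: leey.
  case: ifPn => [/set_mem|_]; last exact: cG0.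
  by rewrite /= in_itv/= andbT => t0; rewrite /H' gt_eqF.
rewrite integralZl_ge0 ?lee_fin ?(ltW c0)//.
by rewrite EFinM -muleA lee_wpmul2l// lee_fin ltW.
Qed.

(** The maximal function is known here only through the last hypothesis, which bounds it by the
    dyadic means of any measurable majorant of [F] on [D0]. The majorant chosen is (pot g)^(s/q),
    where [g] represents F^q; [avg_pot_poweR] controls its means. *)
Lemma choquet_maximal (s q m p c1 c2 c3 : R) :
  (1 < s)%R -> (0 < q)%R -> (1 < m)%R -> (m < s)%R -> (1 <= p)%R ->
  (rho `^ p * D `^ (p - 1) < 1)%R -> (s / q <= m * p)%R ->
  (0 < c1)%R -> (0 < c2)%R -> (0 < c3)%R ->
  (forall E (phi : T -> \bar R), measurable_fun setT phi -> (forall y, 0 <= phi y) ->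
    (forall x, E x -> 1 <= pot phi x) -> Cap E <= c1%:E * \int[mu]_x phi x `^ s) ->
  (forall E (d : R), (0 < d)%R -> Cap E < +oo -> exists2 phi : T -> \bar R,
    measurable_fun setT phi /\ (forall y, 0 <= phi y) &
    (forall x, E x -> 1 <= pot phi x) /\
    \int[mu]_x phi x `^ s <= c2%:E * (Cap E + d%:E)) ->
  exists2 A : R, (0 < A)%R & forall (D0 : set T) (F MF : T -> \bar R),
    (forall x, 0 <= F x) -> (forall x, 0 <= MF x) ->
    (forall V : T -> \bar R, measurable_fun setT V -> (forall y, 0 <= V y) ->
      (forall x, D0 x -> F x <= V x) ->
      forall x, MF x <= c3%:E * ereal_sup (range (fun k => avg k.+2 V x))) ->
    \int[lebesgue_measure]_(t in `[0%R, +oo[) Cap [set x | t%:E < MF x `^ q] <=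
    A%:E * \int[lebesgue_measure]_(t in `[0%R, +oo[)
             Cap (D0 `&` [set x | t%:E < F x `^ q]).
Proof.
move=> s1 q0 m1 ms p1 kap1 sq c10 c20 c30 H1 H2.
have s0 : (0 < s)%R by exact: lt_trans s1.
have m0 : (0 < m)%R by exact: lt_trans m1.
have p0 : (0 < p)%R by exact: lt_le_trans p1.
have P0 : (0 < m * p)%R by exact: mulr_gt0.
(* The maximal theorem is applied to g^m in L^(s/m), which is what m < s is for. *)
have sm1 : (1 < s / m)%R by rewrite ltr_pdivlMr// mul1r.
have sq0 : (0 < s / q)%R by rewrite divr_gt0.
have [Ca Ca0 HCa] := avg_pot_poweR m1 p1 kap1.
have [CM CM0 HCM] := maxf_strong_type sm1.
have [Cc Cc0 HCc] := choquet_pot_le s1 c10 H1.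
(* Jensen with exponent [th] raises the power s/q to m p, for which [avg_pot_poweR] is available,
   and the th-th root brings it back to s/q. *)
pose th := (m * p / (s / q))%R.
have th1 : (1 <= th)%R by rewrite ler_pdivlMr// mul1r.
have th0 : (0 < th)%R by exact: lt_le_trans th1.
have sqth : (s / q * th = m * p)%R by rewrite mulrC divfK// gt_eqF.
have sqth' : (m * p * th^-1 = s / q)%R by rewrite -sqth mulfK// gt_eqF.
pose c5 := (c3 * Ca `^ th^-1)%R.
have c50 : (0 < c5)%R by rewrite mulr_gt0 ?powR_gt0.
pose c4 := (c5 `^ q)%R; have c40 : (0 < c4)%R by exact: powR_gt0.
pose K := (Cc * (c4 * (2 `^ s * (1 + CM))) * (4 * c2))%R.
have K0 : (0 < K)%R by rewrite !mulr_gt0 ?powR_gt0 ?addr_gt0.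
exists K => // D0 F MF F0 MF0 HMF; set J := (X in _ <= _ * X).
have J0 : 0 <= J by apply: integral_ge0 => t _; exact: Cap_ge0.
have [Joo|Joo] := eqVneq J +oo; first by rewrite Joo mulry gtr0_sg// mul1e leey.
have {}Joo : J < +oo by rewrite ltey.
apply/lee_addgt0Pr => e e0.
have eK0 : (0 < e / K)%R by exact: divr_gt0.
have [g [mg g0] [gF gs]] := choquet_represent s1 c20 eK0 H2 Joo.
have mM := measurable_maxpow m mg.
pose psi y := g y + maxpow m g y.
have mpsi : measurable_fun setT psi by exact: measurable_adde.
have psi0 y : 0 <= psi y by rewrite adde_ge0 ?maxpow_ge0.
have mpot := measurable_pot mg g0.
have pot0 x : 0 <= pot g x by exact: pot_ge0.
pose V x := pot g x `^ (s / q).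
have mV : measurable_fun setT V by exact: measurable_poweR_fun.
have V0 x : 0 <= V x by exact: poweR_ge0.
have FV x : D0 x -> F x <= V x.
  move=> Dx; rewrite -[F x](poweRK q0) // /V poweRrM.
  by apply: poweR_mono; rewrite ?invr_ge0 ?(ltW q0) ?poweR_ge0// gF.
have MFle x : MF x <= c5%:E * pot psi x `^ (s / q).
  apply: le_trans (HMF V mV V0 FV x) _.
  rewrite /c5 EFinM -muleA lee_wpmul2l ?lee_fin ?(ltW c30)//.
  apply: ge_ereal_sup => _ [k _ <-].
  rewrite -[leLHS](poweRK th0) ?avg_ge0//.
  rewrite -sqth' poweRrM -poweR_EFin -poweRM ?poweR_ge0 ?lee_fin ?(ltW Ca0)//.
  apply: poweR_mono; rewrite ?invr_ge0 ?(ltW th0) ?poweR_ge0//.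
  apply: le_trans (avg_poweR _ _ mV V0 th1) _.
  rewrite (_ : (fun y => V y `^ th) = fun y => pot g y `^ (m * p)); first exact: HCa.
  by apply/funext => y; rewrite /V -poweRrM sqth.
have c4s0 : (0 <= c4 `^ s^-1)%R by exact: powR_ge0.
(* The constant is moved inside the potential, so that MF^q is bounded by exactly (pot ps)^s, as
   [choquet_pot_le] expects. *)
pose ps y := (c4 `^ s^-1)%:E * psi y.
have MFs x : MF x `^ q <= pot ps x `^ s.
  rewrite potZ// poweRM ?pot_ge0 ?lee_fin// poweR_EFin -powRrM mulVf ?gt_eqF//.
  rewrite powRr1 ?(ltW c40)//.
  apply: le_trans (poweR_mono (ltW q0) (MF0 x) (MFle x)) _.
  rewrite poweRM ?poweR_ge0 ?lee_fin ?(ltW c50)// poweR_EFin -poweRrM.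
  by rewrite divfK ?gt_eqF.
have mps : measurable_fun setT ps by exact: measurable_mule.
have ps0 y : 0 <= ps y by rewrite mule_ge0 ?lee_fin.
apply: le_trans (HCc ps (fun x => MF x `^ q) mps ps0 MFs) _.
have msq f : measurable_fun setT f -> measurable_fun setT (fun x : T => f x `^ s : \bar R).
  by move=> mf; exact: measurable_poweR_fun.
have I1 : \int[mu]_x ps x `^ s = c4%:E * \int[mu]_x psi x `^ s.
  rewrite -integralZl_ge0 ?lee_fin ?(ltW c40)//; last 2 first.
  - exact: msq.
  - by move=> x; exact: poweR_ge0.
  apply: eq_integral => x _; rewrite poweRM ?lee_fin// poweR_EFin -powRrM.
  by rewrite mulVf ?gt_eqF// powRr1// ltW.
have I2 : \int[mu]_x maxpow m g x `^ s <= CM%:E * \int[mu]_x g x `^ s.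
  have mgm : measurable_fun setT (fun y => g y `^ m) by exact: measurable_poweR_fun.
  have := HCM _ mgm (fun y => poweR_ge0 (g y) m).
  have -> : \int[mu]_x (g x `^ m) `^ (s / m) = \int[mu]_x g x `^ s.
    by apply: eq_integral => x _; rewrite -poweRrM mulrC divfK ?gt_eqF.
  have -> // : \int[mu]_x maxf (fun y => g y `^ m) x `^ (s / m) = \int[mu]_x maxpow m g x `^ s.
  by apply: eq_integral => x _; rewrite /maxpow -poweRrM mulrC.
have g0' : 0 <= \int[mu]_x g x `^ s by apply: integral_ge0 => x _; exact: poweR_ge0.
have I3 : \int[mu]_x psi x `^ s <= (2 `^ s * (1 + CM))%:E * \int[mu]_x g x `^ s.
  apply: (@le_trans _ _ (\int[mu]_x ((2 `^ s)%:E * (g x `^ s + maxpow m g x `^ s)))).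
    apply: le_integral_nonmeas => x _; first exact: poweR_ge0.
    by apply: poweR_addl; rewrite ?maxpow_ge0 ?(ltW s0).
  rewrite integralZl_ge0 ?lee_fin ?powR_ge0//; last 2 first.
  - by apply: measurable_adde; exact: msq.
  - by move=> x; rewrite adde_ge0 ?poweR_ge0.
  rewrite EFinM -muleA lee_wpmul2l ?lee_fin ?powR_ge0//.
  rewrite ge0_integralD//; last 4 first.
  - by move=> x _; exact: poweR_ge0.
  - exact: msq.
  - by move=> x _; exact: poweR_ge0.
  - exact: msq.
  by rewrite EFinD ge0_muleDl ?lee_fin ?(ltW CM0)// mul1e leeD2l.
have Jfin : J \is a fin_num by rewrite ge0_fin_numE.
rewrite I1; apply: (@le_trans _ _ (K%:E * (J + (e / K)%:E))); last first.
  rewrite ge0_muleDr ?lee_fin ?(ltW eK0)// leeD2l// -EFinM lee_fin mulrC divfK//.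
  by rewrite gt_eqF.
rewrite {1}/K -mulrA EFinM -muleA lee_wpmul2l ?lee_fin ?(ltW Cc0)//.
rewrite -mulrA [X in _ <= X * _]EFinM -muleA lee_wpmul2l ?lee_fin ?(ltW c40)//.
apply: le_trans I3 _; rewrite [X in _ <= X * _]EFinM -muleA lee_wpmul2l//.
by rewrite lee_fin mulr_ge0 ?powR_ge0// addr_ge0// ltW.
Qed.

End dyadic.

(** * Lebesgue measure on R^n *)

Section affine.
Context {R : realType}.
Local Notation leb := (@lebesgue_measure R).

Definition affine_map (b a : R) (t : measurableTypeR R) : measurableTypeR R :=
  b * (t : R) + a.

Lemma measurable_affine_map b a : measurable_fun setT (affine_map b a).
Proof.
apply: (@measurable_funD _ _ _ setT (fun t : R => b * t) (cst a)).
  by apply: (@measurable_funM _ _ _ setT (cst b) id).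
exact: measurable_cst.
Qed.

Definition affine_measure b a : {measure set (measurableTypeR R) -> \bar R} :=
  mscale (NngNum (normr_ge0 b))
    (measure_function_pushforward__canonical__measure_function_Measure
      leb (measurable_affine_map b a)).

Local Open Scope ereal_scope.

(** By uniqueness of Lebesgue measure it suffices to check the intervals []c, d]]. For b < 0 the
    preimage is closed at the other end, hence the two cases. *)
Lemma lebesgue_affine_map b a (A : set R) : b != 0%R -> measurable A ->
  leb A = affine_measure b a A.
Proof.
move=> b0 mA; apply: lebesgue_measure_unique => //= _ [[c d]] _ <-.
rewrite /affine_measure /= /mscale /= /pushforward.
have [b_gt0|b_lt0|b00] := ltgtP 0%R b; last by rewrite b00 eqxx in b0.
- have -> : affine_map b a @^-1` `]c, d] = [set` `](c - a) / b, (d - a) / b]%R].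
    apply/seteqP; split=> t; rewrite /affine_map /= !in_itv/= => /andP[h1 h2];
      apply/andP; move: h1 h2;
      by rewrite ltr_pdivrMr// ler_pdivlMr// [(b * _)%R]mulrC; lra.
  rewrite !lebesgue_measure_itv/= !lte_fin gtr0_norm// ltr_pM2r ?invr_gt0//.
  rewrite ltrD2r; case: ifPn => _; last by rewrite mule0.
  by rewrite -EFinD -EFinM; congr EFin; field; rewrite gt_eqF.
- have -> : affine_map b a @^-1` `]c, d] = [set` `[(d - a) / b, (c - a) / b[%R].
    apply/seteqP; split=> t; rewrite /affine_map /= !in_itv/= => /andP[h1 h2];
      apply/andP; move: h1 h2;
      by rewrite ltr_ndivlMr// ler_ndivrMr// [(b * _)%R]mulrC; lra.
  rewrite !lebesgue_measure_itv/= !lte_fin ltr0_norm// ltr_nM2r ?invr_lt0//.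
  rewrite ltrD2r; case: ifPn => _; last by rewrite mule0.
  by rewrite -EFinD -EFinM; congr EFin; field; rewrite lt_eqF.
Qed.

Lemma ge0_integral_affine b a (f : R -> \bar R) : b != 0%R ->
  measurable_fun setT f -> (forall t, 0 <= f t) ->
  \int[leb]_t f (b * t + a)%R = (`|b|^-1)%:E * \int[leb]_t f t.
Proof.
move=> b0 mf f0.
have -> : \int[leb]_t f t =
    \int[affine_measure b a]_t f t.
  by apply: eq_measure_integral => A mA _; exact: lebesgue_affine_map.
rewrite [in RHS]/affine_measure ge0_integral_mscale//= muleA -EFinM mulVf ?normr_eq0// mul1e.
by rewrite (ge0_integral_pushforward (measurable_affine_map b a)).
Qed.

Lemma ge0_integral_dilation b (f : R -> \bar R) : (0 < b)%R ->
  measurable_fun setT f -> (forall t, 0 <= f t) ->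
  \int[leb]_(t in `]0%R, +oo[) f (b * t)%R =
  (b^-1)%:E * \int[leb]_(t in `]0%R, +oo[) f t.
Proof.
move=> b0 mf f0.
rewrite integral_indicM [in RHS]integral_indicM.
rewrite -[in RHS](gtr0_norm b0) -(@ge0_integral_affine b 0%R)//.
- apply: eq_integral => t _; rewrite addr0; congr (_%:E * _).
  by rewrite !indicE; congr (nat_of_bool _)%:R; apply/idP/idP;
    rewrite !inE /= !in_itv/= !andbT pmulr_rgt0.
- by rewrite gt_eqF.
- by apply: measurable_mule => //; apply/measurable_EFinP.
- by move=> t; rewrite mule_ge0// lee_fin.
Qed.

End affine.

Lemma integrable_prod_mul d1 d2 (T1 : measurableType d1) (T2 : measurableType d2)
    (R : realType) (m1 : {sigma_finite_measure set T1 -> \bar R})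
    (m2 : {sigma_finite_measure set T2 -> \bar R}) (f : T1 -> R) (g : T2 -> R) :
  m1.-integrable setT (EFin \o f) -> m2.-integrable setT (EFin \o g) ->
  (m1 \x m2)%E.-integrable setT (fun z => (f z.1 * g z.2)%:E).
Proof.
move=> intf intg.
have mf : measurable_fun setT f by apply/measurable_EFinP; exact: (measurable_int _ intf).
have mg : measurable_fun setT g by apply/measurable_EFinP; exact: (measurable_int _ intg).
have /integrableP[_ fi] := intf; have /integrableP[_ gi] := intg.
apply/integrable12ltyP => /=.
  apply/measurable_EFinP; apply: measurable_funM.
    exact: measurableT_comp mf measurable_fst.
  exact: measurableT_comp mg measurable_snd.
under eq_integral => a _.
  under eq_integral => y _ do rewrite normrM EFinM.
  rewrite integralZl_ge0//; first over.
  exact: (measurableT_comp (@abse_measurable _ setT) (measurable_int _ intg)).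
have gfin : (\int[m2]_y (`|g y|)%:E)%E \is a fin_num.
  by rewrite ge0_fin_numE// integral_ge0.
rewrite -(fineK gfin).
under eq_integral do rewrite muleC.
rewrite integralZl_ge0//.
  by rewrite lte_mul_pinfty// ?lee_fin ?fine_ge0// integral_ge0.
- by rewrite lee_fin fine_ge0// integral_ge0.
- exact: (measurableT_comp (@abse_measurable _ setT) (measurable_int _ intf)).
Qed.

(** * Integration on R^n by recursion on the dimension *)

Section Rn_recursion.
Context {R : realType}.
Local Notation leb := (@lebesgue_measure R).
Local Notation mu n := (@lebesgue_Rn R n).
Local Open Scope ereal_scope.

Lemma ge0_integral_cons_Rn n (f : Rn R n.+1 -> \bar R) :
  measurable_fun setT f -> (forall x, 0 <= f x) ->
  \int[mu n.+1]_x f x = \int[leb]_a \int[mu n]_y f (cons_Rn (a, y)).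
Proof.
move=> mf f0; rewrite (ge0_integral_pushforward (@measurable_cons_Rn R n))//.
rewrite preimage_setT fubini_tonelli1//=.
exact: measurableT_comp mf (@measurable_cons_Rn R n).
Qed.

Lemma tnth_cons_Rn0 n (a : R) (y : Rn R n) : tnth (cons_Rn (a, y)) ord0 = a.
Proof. by rewrite /cons_Rn (tnth_nth 0%R). Qed.

Lemma tnth_cons_RnS n (a : R) (y : Rn R n) i :
  tnth (cons_Rn (a, y)) (lift ord0 i) = tnth y i.
Proof. by rewrite /cons_Rn !(tnth_nth 0%R). Qed.

Lemma measurable_tnth_Rn n i : measurable_fun setT (fun x : Rn R n => tnth x i : R).
Proof. exact: measurable_tnth. Qed.

Lemma integral_cons_Rn_mul n (f : R -> R) (g : Rn R n -> R)
    (h : Rn R n.+1 -> R) : measurable_fun setT h ->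
  leb.-integrable setT (EFin \o f) -> (mu n).-integrable setT (EFin \o g) ->
  (forall a y, h (cons_Rn (a, y)) = f a * g y)%R ->
  (mu n.+1).-integrable setT (EFin \o h) /\
  (\int[mu n.+1]_x h x = (\int[leb]_a f a) * \int[mu n]_y g y)%R.
Proof.
move=> mh intf intg hE.
have mh' : measurable_fun setT (EFin \o h) by exact/measurable_EFinP.
have hfg : (EFin \o h) \o @cons_Rn R n = fun z => (f z.1 * g z.2)%:E.
  by apply/funext => -[a y]/=; rewrite hE.
have mfg : measurable_fun setT (fun z : measurableTypeR R * Rn R n => (f z.1 * g z.2)%:E).
  by rewrite -hfg; exact: measurableT_comp mh' (@measurable_cons_Rn R n).
have intfg := integrable_prod_mul intf intg.
have inth : (mu n.+1).-integrable setT (EFin \o h).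
  apply: (integrable_pushforward (@measurable_cons_Rn R n)) => //.
  by rewrite preimage_setT hfg.
split => //.
rewrite /Rintegral (integral_pushforward (@measurable_cons_Rn R n))//; last first.
  by rewrite preimage_setT hfg.
rewrite preimage_setT hfg -integral12_prod_meas1//= /fubini_F/=.
have gfin := integrable_fin_num measurableT intg.
have ffin := integrable_fin_num measurableT intf.
under eq_integral => a _.
  under eq_integral => y _ do rewrite EFinM.
  rewrite integralZl// -(fineK gfin) muleC; over.
rewrite integralZl// -[X in _ * X](fineK ffin) -EFinM /= mulrC.
by [].
Qed.

End Rn_recursion.

Section Rn_product.
Context {R : realType}.
Local Notation leb := (@lebesgue_measure R).
Local Notation mu n := (@lebesgue_Rn R n).

Lemma integral_Rn0 (f : Rn R 0 -> R) :
  (mu 0).-integrable setT (EFin \o f) /\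
  \int[mu 0]_x f x = f [tuple].
Proof.
have fE : f = cst (f [tuple]) by apply/funext => x; rewrite [x]tuple0.
have mf : measurable_fun setT (EFin \o f).
  by rewrite fE; exact: (@measurable_cst _ _ _ _ setT (f [tuple])%:E).
split; last by rewrite /Rintegral /= integral_dirac// diracT mul1e.
apply/integrableP; split => //.
rewrite /= integral_dirac ?diracT ?mul1e ?ltry//.
exact: (measurableT_comp (@abse_measurable _ setT) mf).
Qed.

Lemma measurable_prod_Rn n (f : 'I_n -> measurableTypeR R -> R) :
  (forall i, measurable_fun setT (f i)) ->
  measurable_fun setT (fun x : Rn R n => \prod_i f i (tnth x i)).
Proof.
move=> mf; apply: measurable_prod => i _.
exact: measurableT_comp (mf i) (measurable_tnth_Rn i).
Qed.

Lemma integral_Rn_prod n (f : 'I_n -> R -> R) :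
  (forall i, leb.-integrable setT (EFin \o f i)) ->
  (mu n).-integrable setT (fun x => (\prod_i f i (tnth x i))%:E) /\
  \int[mu n]_x (\prod_i f i (tnth x i)) = \prod_i \int[leb]_t f i t.
Proof.
elim: n f => [|n IH] f intf.
  have [h1 h2] := integral_Rn0 (fun x => \prod_(i < 0) f i (tnth x i)).
  by split => //; rewrite h2 !big_ord0.
have [h1 h2] := IH (fun i => f (lift ord0 i)) (fun i => intf _).
rewrite big_ord_recl -h2.
apply: integral_cons_Rn_mul => //.
  apply: measurable_prod_Rn => i; apply/measurable_EFinP.
  exact: (measurable_int _ (intf i)).
move=> a y; rewrite big_ord_recl tnth_cons_Rn0; congr (_ * _).
by apply: eq_bigr => i _; rewrite tnth_cons_RnS.
Qed.

Lemma measurable_dotv n (xi : Rn R n) : measurable_fun setT (fun x : Rn R n => dotv x xi).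
Proof.
apply: measurable_sum => i.
by apply: measurable_funM => //; exact: measurable_tnth_Rn.
Qed.

Lemma integrable_bounded_mul d (T : measurableType d) (nu : measure T R)
    (b f : T -> R) : measurable_fun setT b -> (forall x, `|b x| <= 1) ->
  nu.-integrable setT (EFin \o f) ->
  nu.-integrable setT (EFin \o (fun x => b x * f x)).
Proof.
move=> mb b1 intf; apply: (le_integrable _ _ _ intf) => //.
  apply/measurable_EFinP; apply: measurable_funM => //.
  by apply/measurable_EFinP; exact: (measurable_int nu intf).
by move=> x _; rewrite /= lee_fin normrM ler_piMl.
Qed.

Lemma measurable_cos : measurable_fun [set: measurableTypeR R] (@cos R).
Proof. by apply: continuous_measurable_fun => x; exact: continuous_cos. Qed.

Lemma measurable_sin : measurable_fun [set: measurableTypeR R] (@sin R).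
Proof. by apply: continuous_measurable_fun => x; exact: continuous_sin. Qed.

Lemma norm_cos_le1 (x : R) : `|cos x| <= 1.
Proof. by rewrite ler_norml cos_geN1 cos_le1. Qed.

Lemma norm_sin_le1 (x : R) : `|sin x| <= 1.
Proof. by rewrite ler_norml sin_geN1 sin_le1. Qed.

Lemma measurable_mulr_cst (a : R) :
  measurable_fun [set: measurableTypeR R] (fun t : measurableTypeR R => (t : R) * a).
Proof. by apply: measurable_funM. Qed.

(** The Fourier transform of a product function, in real form. The addition formulas split off the
    first coordinate; all one-dimensional sine integrals vanish, so only the product of the cosine
    integrals survives. *)
Lemma integral_cos_sin_prod n (w u : 'I_n -> R -> R) (xi : Rn R n) :
  (forall i, leb.-integrable setT (EFin \o w i)) ->
  (forall i, \int[leb]_t (cos (t * tnth xi i) * w i t) = u i (tnth xi i)) ->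
  (forall i, \int[leb]_t (sin (t * tnth xi i) * w i t) = 0) ->
  \int[mu n]_x (cos (dotv x xi) * \prod_i w i (tnth x i)) =
    \prod_i u i (tnth xi i) /\
  \int[mu n]_x (sin (dotv x xi) * \prod_i w i (tnth x i)) = 0.
Proof.
elim: n w u xi => [|n IH] w u xi intw hc hs.
  rewrite !(integral_Rn0 _).2 /dotv !big_ord0 cos0 sin0.
  by rewrite mul1r mul0r.
pose xi' : Rn R n := [tuple of behead xi].
have xi'E i : tnth xi' i = tnth xi (lift ord0 i).
  by rewrite tnth_behead; congr tnth; apply: val_inj; rewrite /= inordK// ltnS.
pose W (x : Rn R n) := \prod_i w (lift ord0 i) (tnth x i).
have [IHc IHs] : \int[mu n]_x (cos (dotv x xi') * W x) =
    \prod_i u (lift ord0 i) (tnth xi' i) /\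
    \int[mu n]_x (sin (dotv x xi') * W x) = 0.
  apply: (IH (fun i => w (lift ord0 i)) (fun i => u (lift ord0 i))) => i.
  - exact: intw.
  - by rewrite xi'E.
  - by rewrite xi'E.
have [intW _] := integral_Rn_prod (fun i => intw (lift ord0 i)).
have intc0 := integrable_bounded_mul (measurableT_comp measurable_cos
  (measurable_mulr_cst (tnth xi ord0))) (fun _ => norm_cos_le1 _) (intw ord0).
have ints0 := integrable_bounded_mul (measurableT_comp measurable_sin
  (measurable_mulr_cst (tnth xi ord0))) (fun _ => norm_sin_le1 _) (intw ord0).
have intcW := integrable_bounded_mul (measurableT_comp measurable_cos
  (measurable_dotv xi')) (fun _ => norm_cos_le1 _) intW.
have intsW := integrable_bounded_mul (measurableT_comp measurable_sin
  (measurable_dotv xi')) (fun _ => norm_sin_le1 _) intW.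
have dotE a y : dotv (cons_Rn (a, y)) xi = a * tnth xi ord0 + dotv y xi'.
  rewrite /dotv big_ord_recl tnth_cons_Rn0; congr (_ + _).
  by apply: eq_bigr => i _; rewrite tnth_cons_RnS xi'E.
have prodE a y : \prod_i w i (tnth (cons_Rn (a, y)) i) = w ord0 a * W y.
  rewrite big_ord_recl tnth_cons_Rn0; congr (_ * _).
  by apply: eq_bigr => i _; rewrite tnth_cons_RnS.
pose hd (x : Rn R n.+1) : R := tnth x ord0.
pose tl (x : Rn R n.+1) : Rn R n := [tuple of behead x].
have hdE a y : hd (cons_Rn (a, y)) = a by exact: tnth_cons_Rn0.
have tlE a y : tl (cons_Rn (a, y)) = y.
  by rewrite /tl /cons_Rn /=; exact: val_inj.
have mtl : measurable_fun setT tl by exact: measurable_behead.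
have split_int (f : R -> R) (g : Rn R n -> R) :
    leb.-integrable setT (EFin \o f) -> (mu n).-integrable setT (EFin \o g) ->
    (mu n.+1).-integrable setT (EFin \o (fun x => f (hd x) * g (tl x))) /\
    \int[mu n.+1]_x (f (hd x) * g (tl x)) = (\int[leb]_a f a) * \int[mu n]_y g y.
  move=> intf intg; apply: integral_cons_Rn_mul => //.
  - apply: measurable_funM.
      apply: (measurableT_comp (f := f : measurableTypeR R -> R));
        last exact: measurable_tnth_Rn.
      by apply/measurable_EFinP; exact: (measurable_int leb).
    apply: (measurableT_comp (f := g)) => //.
    by apply/measurable_EFinP; exact: (measurable_int (mu n)).
  - by move=> a y; rewrite hdE tlE.
have consE x : x = cons_Rn (hd x, tl x).
  by rewrite /cons_Rn /= [LHS]tuple_eta; apply: val_inj.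
have [cc_int ccE] := split_int _ _ intc0 intcW.
have [ss_int ssE] := split_int _ _ ints0 intsW.
have [sc_int scE] := split_int _ _ ints0 intcW.
have [cs_int csE] := split_int _ _ intc0 intsW.
split.
  under eq_Rintegral => x _.
    rewrite [x in cos (dotv x _)]consE [x in \prod_i w i (tnth x i)]consE dotE prodE cosD.
    rewrite (_ : _ * _ = (cos (hd x * tnth xi ord0) * w ord0 (hd x)) *
      (cos (dotv (tl x) xi') * W (tl x)) -
      (sin (hd x * tnth xi ord0) * w ord0 (hd x)) *
      (sin (dotv (tl x) xi') * W (tl x))); last ring.
    over.
  rewrite RintegralB//= ccE ssE hc hs mul0r subr0 IHc big_ord_recl.
  by congr (_ * _); apply: eq_bigr => i _; rewrite xi'E.
under eq_Rintegral => x _.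
  rewrite [x in sin (dotv x _)]consE [x in \prod_i w i (tnth x i)]consE dotE prodE sinD.
  rewrite (_ : _ * _ = (sin (hd x * tnth xi ord0) * w ord0 (hd x)) *
    (cos (dotv (tl x) xi') * W (tl x)) +
    (cos (hd x * tnth xi ord0) * w ord0 (hd x)) *
    (sin (dotv (tl x) xi') * W (tl x))); last ring.
  over.
by rewrite RintegralD//= scE csE hs IHs mulr0 mul0r addr0.
Qed.

Lemma measurable_subv_pair n :
  measurable_fun setT (fun p : Rn R n * Rn R n => subv p.1 p.2).
Proof.
apply/measurable_fun_tnthP => i.
rewrite (_ : _ \o _ = fun p : Rn R n * Rn R n => (tnth p.1 i : R) - tnth p.2 i); last first.
  by apply/funext => p; rewrite /= tnth_mktuple.
apply: measurable_funB.
  exact: measurableT_comp (measurable_tnth_Rn i) measurable_fst.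
exact: measurableT_comp (measurable_tnth_Rn i) measurable_snd.
Qed.

Lemma measurable_subv n (x : Rn R n) : measurable_fun setT (subv x).
Proof. exact: (measurableT_comp (@measurable_subv_pair n) (pair1_measurable x)). Qed.

(** Coordinate by coordinate, y -> x - y is the affine change of variable with slope -1. Translation
    invariance and evenness are used together in this form for convolutions. *)
Lemma ge0_integral_subv n (x : Rn R n) (f : Rn R n -> \bar R) :
  measurable_fun setT f -> (forall y, (0 <= f y)%E) ->
  (\int[mu n]_y f (subv x y) = \int[mu n]_y f y)%E.
Proof.
elim: n x f => [|n IH] x f mf f0.
  by apply: eq_integral => y _; rewrite [subv x y]tuple0 [y]tuple0.
have msub := measurable_subv x.
have subE a y : subv x (cons_Rn (a, y)) =
    cons_Rn ((tnth x ord0 : R) - a, subv [tuple of behead x] y).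
  apply: eq_from_tnth => i; rewrite tnth_mktuple.
  case: (unliftP ord0 i) => [j|] ->.
    rewrite !tnth_cons_RnS tnth_mktuple tnth_behead; congr (tnth _ _ - _).
    by apply: val_inj; rewrite /= inordK// ltnS.
  by rewrite !tnth_cons_Rn0.
rewrite (ge0_integral_cons_Rn (measurableT_comp mf msub)); last by move=> z; exact: f0.
rewrite (ge0_integral_cons_Rn mf f0).
pose g (a : measurableTypeR R) := (\int[mu n]_y f (cons_Rn (a, y)))%E.
have mg : measurable_fun setT g.
  apply: (measurable_fun_fubini_tonelli_F (f \o @cons_Rn R n)).
    exact: measurableT_comp mf (@measurable_cons_Rn R n).
  by move=> z; exact: f0.
transitivity (\int[leb]_a g (-1 * (a : R) + tnth x ord0)%R)%E; last first.
  rewrite (@ge0_integral_affine _ (-1) _ g) ?normrN1 ?invr1 ?mul1e//.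
  by move=> t; exact: integral_ge0.
apply: eq_integral => a _; rewrite /= /g -(IH [tuple of behead x]).
- by apply: eq_integral => y _; rewrite subE mulN1r addrC.
- apply: (measurableT_comp mf).
  apply: (measurableT_comp (@measurable_cons_Rn R n)).
  exact: pair1_measurable.
- by move=> y; exact: f0.
Qed.

End Rn_product.

(** * Dyadic grids on R^n *)

Section grid.
Context {R : realType} {n : nat}.
Local Notation leb := (@lebesgue_measure R).
Local Notation mu := (@lebesgue_Rn R n).

(** The index of the dyadic interval of length 4 / 2^k that contains [t]. The 4 makes generation
    [k.+2] the one of side 2^-k and leaves the two coarser generations below index 2. *)
Definition cell (k : nat) (t : measurableTypeR R) : int :=
  Num.floor (2 ^+ k / 4 * (t : R)).

(** One definition for both families: c = 0 gives the cell of [x], and c = 1 the block of the 3^n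
    cells around it. *)
Definition grid_rel (c : int) (k : nat) (x : Rn R n) : set (Rn R n) :=
  [set y | forall i, cell k (tnth y i) <= cell k (tnth x i) + c /\
                     cell k (tnth x i) <= cell k (tnth y i) + c].

Let scale_gt0 k : 0 < 2 ^+ k / 4 :> R.
Proof. by rewrite divr_gt0// exprn_gt0. Qed.

Lemma cell_le k t m : (cell k t <= m) = (2 ^+ k / 4 * t < (m + 1)%:~R).
Proof. by rewrite -floor_lt_int ltzD1. Qed.

Lemma cell_ge k t m : (m <= cell k t) = (m%:~R <= 2 ^+ k / 4 * t).
Proof. by rewrite floor_ge_int. Qed.

Lemma cellS k t : 2 * cell k t <= cell k.+1 t <= 2 * cell k t + 1.
Proof.
have h1 := floor_le (2 ^+ k / 4 * t).
have := floor_itv (2 ^+ k / 4 * t); rewrite -/(cell k t) => /andP[_ h2].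
apply/andP; split.
  by rewrite cell_ge exprS rmorphM/= -mulrA -mulrA ler_pM2l// mulrA.
rewrite cell_le (_ : 2 * cell k t + 1 + 1 = 2 * (cell k t + 1)); last by lia.
by rewrite rmorphM/= exprS -mulrA -mulrA ltr_pM2l// mulrA.
Qed.

Lemma cell_near k t u : `|t - u| <= 4 / 2 ^+ k -> cell k t <= cell k u + 1.
Proof.
move=> h; rewrite cell_le.
have := floor_itv (2 ^+ k / 4 * u); rewrite -/(cell k u) => /andP[_ h2].
have : 2 ^+ k / 4 * (t - u) <= 1.
  apply: (@le_trans _ _ (2 ^+ k / 4 * (4 / 2 ^+ k))).
    by rewrite ler_pM2l// (le_trans (ler_norm _)).
  have : 2 ^+ k != 0 :> R by rewrite expf_neq0.
  move: (2 ^+ k) => d d0.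
  by rewrite le_eqVlt (_ : _ * _ = 1) ?eqxx//; field; rewrite d0.
rewrite rmorphD/= in h2 *; rewrite rmorphD/= mulrBr; lra.
Qed.

Lemma cell_dist k t u : cell k t <= cell k u + 1 -> cell k u <= cell k t + 1 ->
  `|t - u| <= 8 / 2 ^+ k.
Proof.
rewrite !cell_le => h1 h2.
have := floor_le (2 ^+ k / 4 * u); have := floor_le (2 ^+ k / 4 * t).
rewrite -/(cell k u) -/(cell k t) !rmorphD/= in h1 h2 * => h3 h4.
have : `|2 ^+ k / 4 * (t - u)| <= 2 by rewrite ler_norml mulrBr; lra.
rewrite normrM (gtr0_norm (scale_gt0 k)) => h.
have : (4 / 2 ^+ k) * (2 ^+ k / 4 * `|t - u|) <= (4 / 2 ^+ k) * 2.
  by rewrite ler_pM2l// divr_gt0// exprn_gt0.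
have : 2 ^+ k != 0 :> R by rewrite expf_neq0.
move: (2 ^+ k) => d d0.
rewrite (_ : 4 / d * (_ * `|t - u|) = `|t - u|); last by field; rewrite d0.
by rewrite (_ : 4 / d * 2 = 8 / d)//; field.
Qed.

Lemma grid_refl c k x : 0 <= c -> grid_rel c k x x.
Proof. by move=> c0 i; split; rewrite lerDl. Qed.

Lemma grid_sym c k x y : grid_rel c k x y -> grid_rel c k y x.
Proof. by move=> h i; have [] := h i. Qed.

Lemma grid_trans c k x y z : grid_rel c k x y -> grid_rel 0 k y z -> grid_rel c k x z.
Proof. by move=> h1 h2 i; have := h1 i; have := h2 i; lia. Qed.

Lemma grid_nested k x y : grid_rel 0 k.+1 x y -> grid_rel 0 k x y.
Proof.
by move=> h i; have := h i; have := cellS k (tnth x i); have := cellS k (tnth y i); lia.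
Qed.

(** The indices of [x] and [z] at generation [k.+1] differ by at most 2, so their halves rounded
    down differ by at most 1. *)
Lemma grid_comp k x y z : grid_rel 1 k.+1 x y -> grid_rel 1 k.+1 y z -> grid_rel 1 k x z.
Proof.
move=> h1 h2 i; have := h1 i; have := h2 i.
by have := cellS k (tnth x i); have := cellS k (tnth z i); lia.
Qed.

Lemma measurable_cell k :
  measurable_fun [set: measurableTypeR R] (fun t : measurableTypeR R => (cell k t)%:~R : R).
Proof.
apply: nondecreasing_measurable => // t u tu.
by rewrite ler_int le_floor// ler_pM2l.
Qed.

Lemma measurable_grid c k : measurable [set z : Rn R n * Rn R n | grid_rel c k z.1 z.2].
Proof.
rewrite (_ : mkset _ = \bigcap_(i in [set: 'I_n])
    ([set z : Rn R n * Rn R n | (cell k (tnth z.2 i))%:~R <= (cell k (tnth z.1 i))%:~R + c%:~R :> R] `&`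
     [set z | (cell k (tnth z.1 i))%:~R <= (cell k (tnth z.2 i))%:~R + c%:~R :> R])); last first.
  apply/seteqP; split=> z /=.
    by move=> h i _ /=; rewrite -!rmorphD/= !ler_int; exact: h.
  by move=> h i; have /= := h i Logic.I; rewrite -!rmorphD/= !ler_int.
have m1 i : measurable_fun setT (fun z : Rn R n * Rn R n => (cell k (tnth z.1 i))%:~R : R).
  apply: (measurableT_comp (measurable_cell k)).
  exact: measurableT_comp (measurable_tnth_Rn i) measurable_fst.
have m2 i : measurable_fun setT (fun z : Rn R n * Rn R n => (cell k (tnth z.2 i))%:~R : R).
  apply: (measurableT_comp (measurable_cell k)).
  exact: measurableT_comp (measurable_tnth_Rn i) measurable_snd.
apply: fin_bigcap_measurable; first exact: finite_finset.
move=> i _; apply: measurableI.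
  rewrite -[X in measurable X]setTI; apply: measurable_fun_le => //.
  exact: measurable_funD.
rewrite -[X in measurable X]setTI; apply: measurable_fun_le => //.
exact: measurable_funD.
Qed.

Lemma measure_box (A : 'I_n -> set (measurableTypeR R)) (l : 'I_n -> R) :
  (forall i, measurable (A i)) -> (forall i, leb (A i) = (l i)%:E) ->
  mu [set x | forall i, A i (tnth x i)] = (\prod_i l i)%:E.
Proof.
move=> mA Al.
have mB : measurable [set x : Rn R n | forall i, A i (tnth x i)].
  rewrite (_ : mkset _ = \bigcap_(i in [set: 'I_n]) ((fun x : Rn R n => tnth x i) @^-1` A i)).
    apply: fin_bigcap_measurable; first exact: finite_finset.
    move=> i _; rewrite -[X in measurable X]setTI.
    exact: (measurable_tnth_Rn i measurableT (mA i)).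
  by apply/seteqP; split=> x /= h i; [move=> _|]; exact: h.
have Al' i : (\int[leb]_t (\1_(A i) t)%:E)%E = (l i)%:E.
  by rewrite (integral_indic leb measurableT (mA i)) setIT; exact: Al.
have intA i : leb.-integrable setT (EFin \o (\1_(A i) : _ -> R)).
  apply/integrableP; split; first exact/measurable_EFinP/measurable_indic.
  under eq_integral => t _ do rewrite /= ger0_norm//.
  by rewrite Al' ltry.
have [h1 h2] := integral_Rn_prod intA.
rewrite -(setIT [set x : Rn R n | _]) -(integral_indic mu measurableT mB).
have -> : (\prod_i l i)%:E = (\int[mu]_x (\prod_i \1_(A i) (tnth x i)))%:E.
  rewrite h2; congr EFin; apply: eq_bigr => i _.
  by rewrite /Rintegral Al'.
rewrite /Rintegral fineK; last exact: integrable_fin_num.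
apply: eq_integral => x _; congr EFin.
rewrite indicE; case: (asboolP (forall i, A i (tnth x i))) => h.
  by rewrite mem_set// big1// => i _; rewrite indicE mem_set.
rewrite memNset// mulr0n; apply/esym/eqP/prodf_eq0.
have /existsNP[i hi] := h; exists i => //.
by rewrite indicE memNset.
Qed.

Lemma measure_grid c k x : 0 <= c ->
  mu (grid_rel c k x) = (((2 * c + 1)%:~R * (4 / 2 ^+ k)) ^+ n)%:E.
Proof.
move=> c0.
pose e : R := 4 / 2 ^+ k.
have e0 : 0 < e by rewrite divr_gt0// exprn_gt0.
have eK : 2 ^+ k / 4 = e^-1 :> R by rewrite invf_div.
pose A i : set (measurableTypeR R) :=
  [set` `[e * (cell k (tnth x i) - c)%:~R, e * (cell k (tnth x i) + c + 1)%:~R[%R].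
have -> : grid_rel c k x = [set y | forall i, A i (tnth y i)].
  apply/seteqP; split=> y h i; have := h i; rewrite /A /= in_itv/=.
    rewrite -[cell k (tnth x i) <= _]lerBlDr cell_le cell_ge eK => -[h1 h2]; apply/andP; split.
      by rewrite -(invrK e) ler_pdivrMl ?invr_gt0//.
    by rewrite -(invrK e) ltr_pdivlMl ?invr_gt0//.
  move=> /andP[h1 h2]; rewrite -[cell k (tnth x i) <= _]lerBlDr cell_le cell_ge eK.
  by rewrite -ltr_pdivlMl ?invr_gt0// -ler_pdivrMl ?invr_gt0// invrK.
rewrite (@measure_box A (fun=> (2 * c + 1)%:~R * e)).
- by rewrite prodr_const card_ord.
- by move=> i; exact: measurable_itv.
- move=> i; rewrite /A lebesgue_measure_itv/= lte_fin ltr_pM2l// ltr_int.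
  rewrite ifT; last lia.
  by rewrite -EFinD; congr EFin; rewrite !rmorphD rmorphN rmorphM/=; ring.
Qed.

Lemma measurable_dotv_subv x : measurable_fun setT (fun y : Rn R n => dotv (subv y x) (subv y x)).
Proof.
have m i : measurable_fun setT (fun y : Rn R n => tnth (subv y x) i : R).
  rewrite (_ : (fun _ => _) = fun y : Rn R n => (tnth y i : R) - tnth x i).
    by apply: measurable_funB => //; exact: measurable_tnth_Rn.
  by apply/funext => y; rewrite tnth_mktuple.
by apply: measurable_sum => i; apply: measurable_funM.
Qed.

Lemma measurable_eball x r : measurable (eball x r : set (Rn R n)).
Proof.
have m : measurable_fun setT (fun y : Rn R n => enorm (subv y x)).
  apply: (measurableT_comp (f := @Num.sqrt R : measurableTypeR R -> R)).
    by apply: continuous_measurable_fun => t; exact: sqrt_continuous.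
  exact: measurable_dotv_subv.
rewrite -[X in measurable X]setTI.
rewrite (_ : eball x r = (fun y => enorm (subv y x)) @^-1` `]-oo, r[).
  by apply: m => //; exact: measurable_itv.
by apply/seteqP; split=> y; rewrite /= in_itv.
Qed.

Lemma tnth_le_enorm (z : Rn R n) i : `|tnth z i : R| <= enorm z.
Proof.
rewrite /enorm -sqrtr_sqr ler_sqrt; last first.
  by apply: sumr_ge0 => j _; rewrite -expr2 sqr_ge0.
rewrite /dotv (bigD1 i)//= expr2 lerDl sumr_ge0// => j _.
by rewrite -expr2 sqr_ge0.
Qed.

(** Cells of generation [k.+2] have side 2^-k, at least the radius, so each coordinate of a point of
    the ball falls in the same interval as that of [x] or in an adjacent one. *)
Lemma eball_grid k x r : r <= 2^-1 ^+ k -> eball x r `<=` grid_rel 1 k.+2 x.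
Proof.
move=> rk y xy i.
have h : `|(tnth y i : R) - tnth x i| <= 4 / 2 ^+ k.+2.
  rewrite (_ : 4 / 2 ^+ k.+2 = 2^-1 ^+ k); last first.
    rewrite exprVn !exprS; have : 2 ^+ k != 0 :> R by rewrite expf_neq0.
    by move: (2 ^+ k) => d d0; field; rewrite d0.
  apply: le_trans rk; apply: le_trans (ltW xy).
  by have := tnth_le_enorm (subv y x) i; rewrite tnth_mktuple.
by split; apply: cell_near => //; rewrite distrC.
Qed.

(** The ball contains the cube of side r/n centred at [x], whose half diagonal is r / (2 sqrt n). *)
Lemma measure_eball_ge x r : (0 < n)%N -> 0 < r ->
  (((r / n%:R) ^+ n)%:E <= mu (eball x r))%E.
Proof.
move=> n0 r0.
have n0' : 0 < n%:R :> R by rewrite ltr0n.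
pose h := r / (2 * n%:R).
have h0 : 0 < h by rewrite divr_gt0// mulr_gt0.
pose A i : set (measurableTypeR R) :=
  [set` `[(tnth x i : R) - h, (tnth x i : R) + h]%R].
have <- : mu [set y | forall i, A i (tnth y i)] = ((r / n%:R) ^+ n)%:E.
  rewrite (@measure_box A (fun=> r / n%:R)).
  - by rewrite prodr_const card_ord.
  - by move=> i; exact: measurable_itv.
  - move=> i; rewrite /A lebesgue_measure_itv/= lte_fin ifT; last by lra.
    by rewrite -EFinD; congr EFin; rewrite /h; field; rewrite gt_eqF.
apply: le_measure; rewrite ?inE.
- rewrite (_ : mkset _ = \bigcap_(i in [set: 'I_n]) ((fun y : Rn R n => tnth y i) @^-1` A i)).
    apply: fin_bigcap_measurable; first exact: finite_finset.
    move=> i _; rewrite -[X in measurable X]setTI.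
    exact: (measurable_tnth_Rn i measurableT (measurable_itv _)).
  by apply/seteqP; split=> y /= H i; [move=> _|]; exact: H.
- exact: measurable_eball.
- move=> y yA; rewrite /eball /= /enorm -(gtr0_norm r0) -sqrtr_sqr ltr_sqrt ?exprn_gt0//.
  apply: (@le_lt_trans _ _ (\sum_(i < n) h ^+ 2)).
    apply: ler_sum => i _; rewrite tnth_mktuple -expr2 -real_normK ?num_real//.
    rewrite lerXn2r ?nnegrE// ?(ltW h0)//.
    by have := yA i; rewrite /A /= in_itv/= ler_norml; lra.
  rewrite sumr_const card_ord -mulr_natl /h.
  rewrite (_ : n%:R * _ = r ^+ 2 / (4 * n%:R)); last first.
    by field; rewrite gt_eqF.
  rewrite ltr_pdivrMr ?mulr_gt0// ltr_pMr ?exprn_gt0//.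
  have : 1 <= n%:R :> R by rewrite ler1n.
  lra.
Qed.

Lemma dyadic_scale (r : R) : 0 < r -> r <= 1 ->
  exists k, 2^-1 ^+ k.+1 < r <= 2^-1 ^+ k.
Proof.
move=> r0 r1.
have [k hk] : exists k, 2^-1 ^+ k < r.
  have [k hk] : exists k : nat, r^-1 < k%:R.
    by exists (Num.bound r^-1); rewrite archi_boundP// invr_ge0 ltW.
  exists k; rewrite exprVn invf_plt ?posrE ?exprn_gt0//.
  by apply: lt_trans hk _; rewrite -natrX ltr_nat ltn_expl.
elim: k hk => [|k IH] hk; first by move: hk; rewrite expr0; lra.
have [h|h] := ltP (2^-1 ^+ k) r; first exact: IH.
by exists k; rewrite hk.
Qed.

End grid.

(** * The Bessel kernel *)

Section gaussian.
Context {R : realType}.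
Local Notation leb := (@lebesgue_measure R).

Definition gauss (s t : R) : R := expR (- (t ^+ 2 / (2 * s ^+ 2))).

Lemma gauss_ge0 s t : 0 <= gauss s t. Proof. exact: expR_ge0. Qed.

Lemma gauss_le1 s t : gauss s t <= 1.
Proof. rewrite -[leRHS]expR0 ler_expR oppr_le0; apply: divr_ge0; first exact: sqr_ge0.
by rewrite mulr_ge0// sqr_ge0. Qed.

Lemma continuous_gauss s : continuous (gauss s).
Proof.
move=> t; apply: (cvg_comp _ expR); last exact: continuous_expR.
apply: (@cvgN _ R^o); apply: cvgMr_tmp; exact: sqr_continuous.
Qed.

Lemma measurable_gauss s : measurable_fun [set: measurableTypeR R] (gauss s : measurableTypeR R -> R).
Proof. by apply: continuous_measurable_fun => t; exact: continuous_gauss. Qed.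

Lemma integral_gauss s : 0 < s ->
  (\int[leb]_t (gauss s t)%:E = (s * Num.sqrt (2 * pi))%:E)%E.
Proof.
move=> s0; have := integral_normal_pdf 0 s.
rewrite normal_pdfE ?gt_eqF//.
have p0 : 0 < normal_peak s by rewrite normal_peak_gt0 ?gt_eqF.
under eq_integral => t _.
  rewrite /normal_fun subr0 (_ : expR _ = gauss s t) ?EFinM; last first.
    by rewrite /gauss mulNr -mulr_natl.
  over.
rewrite integralZl_ge0 ?lee_fin ?(ltW p0)//; last 2 first.
- by apply/measurable_EFinP; exact: measurable_gauss.
- by move=> t; rewrite lee_fin gauss_ge0.
move=> h.
have pE : (normal_peak s)^-1 = s * Num.sqrt (2 * pi).
  rewrite /normal_peak invrK (_ : _ *+ 2 = s ^+ 2 * (2 * pi)); last by rewrite -mulr_natl; ring.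
  by rewrite sqrtrM ?sqr_ge0// sqrtr_sqr gtr0_norm.
rewrite -pE -[RHS]mule1 -h muleA -EFinM mulVf ?mul1e//.
by rewrite gt_eqF.
Qed.

Lemma integrable_gauss s : 0 < s -> leb.-integrable setT (EFin \o gauss s).
Proof.
move=> s0; apply/integrableP; split; first by apply/measurable_EFinP; exact: measurable_gauss.
under eq_integral => t _ do rewrite /= ger0_norm ?gauss_ge0//.
by rewrite integral_gauss// ltry.
Qed.

(** Half of the exponent absorbs |t|: from e^u >= 1 + u and (2 s - |t|)^2 >= 0 follows |t| <= s
    e^(t^2/(4 s^2)). The other half is an integrable Gaussian, which dominates the moment. *)
Lemma gauss_moment_le s t : 0 < s -> `|t| * gauss s t <= s * gauss (Num.sqrt 2 * s) t.
Proof.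
move=> s0.
have -> : gauss s t = gauss (Num.sqrt 2 * s) t * gauss (Num.sqrt 2 * s) t.
  rewrite /gauss -expRD exprMn sqr_sqrtr//; congr expR.
  by field; rewrite gt_eqF.
rewrite mulrA ler_wpM2r ?gauss_ge0// /gauss expRN ler_pdivrMr ?expR_gt0//.
rewrite exprMn sqr_sqrtr//.
have := expR_ge1Dx (t ^+ 2 / (2 * (2 * s ^+ 2))).
rewrite -(ler_pM2l s0); apply: le_trans.
rewrite (_ : s * _ = s + `|t| ^+ 2 / (4 * s)); last first.
  by rewrite real_normK ?num_real//; field; rewrite gt_eqF.
move: `|t| => x.
rewrite -subr_ge0 (_ : _ - x = (2 * s - x) ^+ 2 / (4 * s)); last first.
  by field; rewrite gt_eqF.
by rewrite divr_ge0 ?sqr_ge0// mulr_ge0// ltW.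
Qed.

Lemma is_derive_gauss (s t : R) : s != 0 ->
  is_derive t 1 (gauss s) (- (t / s ^+ 2) * gauss s t).
Proof.
move=> s0.
have h : is_derive t 1 (fun t : R => - (t ^+ 2 / (2 * s ^+ 2))) (- (t / s ^+ 2)).
  by apply: is_derive_eq; rewrite /GRing.scale/=; field.
apply: (is_derive_eq (@is_derive1_comp _ (@expR R) _ _ _ _ (is_derive_expR _) h)).
by rewrite mulrC.
Qed.

Lemma cvg_gauss s : 0 < s -> gauss s (k.+1%:R : R) @[k --> \oo] --> (0 : R).
Proof.
move=> s0; apply: (@squeeze_cvgr _ _ _ _ (cst 0) (fun k => (2 * s ^+ 2) * k.+1%:R^-1)).
- near=> k; rewrite gauss_ge0 /=.
  have : 1 <= k.+1%:R :> R by rewrite ler1n.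
  move: k.+1%:R => x x1; rewrite /gauss expRN -[leLHS]mul1r ler_pdivrMr ?expR_gt0//.
  have s2 : 0 < 2 * s ^+ 2 by rewrite mulr_gt0// exprn_gt0.
  have := expR_ge1Dx (x ^+ 2 / (2 * s ^+ 2)).
  have x0 : 0 < x by lra.
  rewrite -(ler_pM2l (divr_gt0 s2 x0)); apply: le_trans.
  rewrite (_ : 2 * s ^+ 2 / x * _ = 2 * s ^+ 2 / x + x); last by field; rewrite !gt_eqF.
  have : 0 < 2 * s ^+ 2 / x by rewrite divr_gt0.
  lra.
- exact: cvg_cst.
- rewrite -[X in _ --> X](mulr0 (2 * s ^+ 2)); apply: cvgMl_tmp.
  exact: cvg_harmonic.
Unshelve. all: by end_near. Qed.

(** The fundamental theorem of calculus on growing symmetric intervals and dominated convergence: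
    the integral of an integrable derivative vanishes when its primitive tends to 0 at both ends. *)
Lemma integral_derivative_eq0 (G g : R -> R) (h : R^nat) :
  (forall t : R, is_derive t 1 G (g t)) -> continuous g ->
  leb.-integrable setT (EFin \o g) ->
  (forall k : nat, `|G k.+1%:R| <= h k /\ `|G (- k.+1%:R)| <= h k) ->
  h k @[k --> \oo] --> (0 : R) ->
  \int[leb]_t g t = 0.
Proof.
move=> dG cg intg Gh h0.
pose I k : set (measurableTypeR R) := `[- k.+1%:R, k.+1%:R]%classic.
pose f_ k (t : measurableTypeR R) : \bar R := ((\1_(I k) t : R)%:E * (g t)%:E)%E.
have mg := measurable_int leb intg.
have mf_ k : measurable_fun setT (f_ k).
  apply: measurable_mule => //; apply/measurable_EFinP; apply: measurable_indic.
  exact: measurable_itv.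
have mag : leb.-integrable setT (fun t => `|(g t)%:E|)%E by exact: integrable_abse.
have f_cvg t : f_ k t @[k --> \oo] --> (g t)%:E.
  apply: cvg_near_cst; near=> k.
  rewrite /f_ indicE mem_set ?mul1e// /I /= in_itv/= -ler_norml.
  near: k; exists (Num.bound `|t|) => // k /= hk.
  apply: ltW; apply: lt_le_trans (archi_boundP (normr_ge0 t)) _.
  by rewrite ler_nat (leq_trans hk).
have f_le k t : (`|f_ k t| <= `|(g t)%:E|)%E.
  rewrite /f_ abseM -[leRHS]mul1e lee_wpmul2r//= lee_fin.
  by rewrite indicE; case: (_ \in _); rewrite ?normr1 ?normr0.
have [_ _ lim_f] := dominated_convergence measurableT mf_ mg
  (aeW _ (fun t _ => f_cvg t)) mag (aeW _ (fun t k _ => f_le k t)).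
have IE k : (\int[leb]_t f_ k t)%E = (G k.+1%:R - G (- k.+1%:R))%:E.
  have k0 : 0 < k.+1%:R :> R by rewrite ltr0n.
  rewrite -[LHS]integral_indicM EFinB; apply: continuous_FTC2.
  - lra.
  - by apply: continuous_subspaceT => t; exact: cg.
  - have cG t : {for t, continuous G}.
      by apply: differentiable_continuous; apply/derivable1_diffP; exact: (@ex_derive _ _ _ _ _ _ _ (dG t)).
    split.
    + by move=> t _; exact: (@ex_derive _ _ _ _ _ _ _ (dG t)).
    + by apply: cvg_at_right_filter; exact: cG.
    + by apply: cvg_at_left_filter; exact: cG.
  - by move=> t _; rewrite derive1E; exact: (@derive_val _ _ _ _ _ _ _ (dG t)).
have lim0 : (\int[leb]_t f_ k t)%E @[k --> \oo] --> 0%E.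
  under eq_fun do rewrite IE.
  apply: cvg_EFin; first by near=> k.
  apply/cvgr0Pnorm_lt => e e0; near=> k.
  rewrite (le_lt_trans (ler_normB _ _))//; have [h1 h2] := Gh k.
  have : `|h k| < e / 2.
    by near: k; move/cvgr0Pnorm_lt : h0; apply; rewrite divr_gt0.
  by have := ler_norm (h k); lra.
have := cvg_unique _ lim_f lim0; rewrite /Rintegral => -> //.
Unshelve. all: by end_near. Qed.

Lemma integrable_gauss_moment s : 0 < s ->
  leb.-integrable setT (EFin \o (fun t => t * gauss s t)).
Proof.
move=> s0.
have s20 : 0 < Num.sqrt 2 * s by rewrite mulr_gt0// sqrtr_gt0.
apply: (le_integrable measurableT _ _ (integrableZl measurableT s (integrable_gauss s20))).
  by apply/measurable_EFinP; apply: measurable_funM => //; exact: measurable_gauss.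
move=> t _; rewrite /= lee_fin normrM [`|gauss s t|]ger0_norm ?gauss_ge0//.
rewrite [leRHS]ger0_norm ?gauss_moment_le//.
by rewrite mulr_ge0 ?gauss_ge0// ltW.
Qed.

Lemma measurable_cosD x c :
  measurable_fun [set: measurableTypeR R] (fun t : measurableTypeR R => cos ((t : R) * x + c)).
Proof.
apply: (measurableT_comp measurable_cos).
by apply: measurable_funD => //; exact: measurable_mulr_cst.
Qed.

Lemma measurable_sinD x c :
  measurable_fun [set: measurableTypeR R] (fun t : measurableTypeR R => sin ((t : R) * x + c)).
Proof.
apply: (measurableT_comp measurable_sin).
by apply: measurable_funD => //; exact: measurable_mulr_cst.
Qed.

(** Integration by parts: the derivative in t of sin(t x + c) [gauss s t] has integral 0. *)
Lemma integral_sinD_gauss_moment s x c : 0 < s ->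
  \int[leb]_t (sin (t * x + c) * (t * gauss s t)) =
  s ^+ 2 * x * \int[leb]_t (cos (t * x + c) * gauss s t).
Proof.
move=> s0.
have i1 := integrable_bounded_mul (measurable_cosD x c) (fun _ => norm_cos_le1 _)
  (integrable_gauss s0).
have i2 := integrable_bounded_mul (measurable_sinD x c) (fun _ => norm_sin_le1 _)
  (integrable_gauss_moment s0).
pose g t := x * (cos (t * x + c) * gauss s t) -
  (s ^+ 2)^-1 * (sin (t * x + c) * (t * gauss s t)).
have s0' : s != 0 by rewrite gt_eqF.
have j1 : leb.-integrable setT (EFin \o (fun t => x * (cos (t * x + c) * gauss s t))).
  exact: (integrableZl measurableT x i1).
have j2 : leb.-integrable setT
    (EFin \o (fun t => (s ^+ 2)^-1 * (sin (t * x + c) * (t * gauss s t)))).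
  exact: (integrableZl measurableT (s ^+ 2)^-1 i2).
have intg : leb.-integrable setT (EFin \o g).
  exact: (integrableB measurableT j1 j2).
have : \int[leb]_t g t = 0.
  apply: (@integral_derivative_eq0 (fun t => sin (t * x + c) * gauss s t) g
    (fun k => gauss s k.+1%:R)) => //.
  - move=> t.
    have h1 : is_derive t 1 (fun t : R => t * x + c) x.
      by apply: is_derive_eq; rewrite /GRing.scale/=; ring.
    have h2 := @is_derive1_comp _ (@sin R) _ _ _ _ (is_derive_sin _) h1.
    have h3 := is_derive_gauss t s0'.
    apply: (@is_derive_eq _ _ _ _ _ _ _ _ (is_deriveM h2 h3)).
    by rewrite /g /GRing.scale/=; field.
  - move=> t; apply: cvgB.
      apply: cvgMl_tmp; apply: cvgM; last exact: continuous_gauss.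
      apply: (cvg_comp _ cos); last exact: continuous_cos.
      by apply: cvgD; [apply: cvgMr_tmp; exact: cvg_id|exact: cvg_cst].
    apply: cvgMl_tmp; apply: cvgM.
      apply: (cvg_comp _ sin); last exact: continuous_sin.
      by apply: cvgD; [apply: cvgMr_tmp; exact: cvg_id|exact: cvg_cst].
    by apply: cvgM; [exact: cvg_id|exact: continuous_gauss].
  - move=> k; have gN : gauss s (- k.+1%:R) = gauss s k.+1%:R by rewrite /gauss sqrrN.
    by rewrite !normrM gN [`|gauss _ _|]ger0_norm ?gauss_ge0// !ler_piMl ?gauss_ge0 ?norm_sin_le1.
  - exact: cvg_gauss.
rewrite /g RintegralB//=.
rewrite !RintegralZl// => /eqP; rewrite subr_eq0 => /eqP h.
rewrite -mulrA h; field; exact: s0'.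
Qed.

(** As a function F of [x], the integral satisfies F' = - s^2 x F, by differentiation under the
    integral sign and the previous identity, so F times e^(x^2 s^2 / 2) is constant. The phase [c]
    covers the cosine, c = 0, and the sine, c = -pi/2, at once. *)
Lemma integral_cosD_gauss s x c : 0 < s ->
  \int[leb]_t (cos (t * x + c) * gauss s t) =
  s * Num.sqrt (2 * pi) * cos c * gauss s^-1 x.
Proof.
move=> s0; have s0' : s != 0 by rewrite gt_eqF.
pose f x t := cos (t * x + c) * gauss s t.
pose F x := \int[leb]_t f x t.
have inti y : leb.-integrable setT (EFin \o f y).
  exact: integrable_bounded_mul (measurable_cosD y c) (fun _ => norm_cos_le1 _)
    (integrable_gauss s0).
have df (y : R) (t : measurableTypeR R) : is_derive y 1 (f^~ t) (- (sin (t * y + c) * (t * gauss s t))).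
  rewrite /f; move: (gauss s t) => k.
  have h1 : is_derive y 1 (fun y : R => t * y + c) t.
    by apply: is_derive_eq; rewrite /GRing.scale/=; ring.
  have h2 := @is_derive1_comp _ (@cos R) _ _ _ _ (is_derive_cos _) h1.
  apply: (@is_derive_eq _ _ _ _ _ _ _ _ (is_deriveM h2 (is_derive_cst _ _ _))).
  by rewrite /GRing.scale/= mulr0 add0r /cst; ring.
have pf y t : partial1of2 f y t = - (sin (t * y + c) * (t * gauss s t)).
  by rewrite /partial1of2 derive1E; exact: (@derive_val _ _ _ _ _ _ _ (df y t)).
have dF (y : R) : is_derive y 1 F (- (s ^+ 2 * y * F y)).
  have yI : `]y - 1, y + 1[%classic y by rewrite /= in_itv/=; lra.
  have ider z (t : measurableTypeR R) : derivable (f^~ t) z 1 by exact: (@ex_derive _ _ _ _ _ _ _ (df z t)).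
  have mom_ge0 t : 0 <= `|t * gauss s t| by [].
  have imom : leb.-integrable setT (EFin \o (fun t => `|t * gauss s t|)).
    have i0 := integrable_gauss_moment s0.
    apply: (le_integrable measurableT _ _ i0).
      apply/measurable_EFinP; apply: (measurableT_comp (@normr_measurable R setT)).
      by apply/measurable_EFinP; exact: (measurable_int leb i0).
    by move=> t _; rewrite /= normr_id.
  have pub z (t : measurableTypeR R) : `|partial1of2 f z t| <= `|t * gauss s t|.
    by rewrite pf normrN normrM ler_piMl// norm_sin_le1.
  have h1 := derivable_under_integral measurableT yI (fun z _ => inti z)
    (fun z t _ _ => ider z t) mom_ge0 imom (fun z t _ _ => pub z t).
  have h2 := differentiation_under_integral measurableT yI (fun z _ => inti z)
    (fun z t _ _ => ider z t) mom_ge0 imom (fun z t _ _ => pub z t).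
  apply: DeriveDef; first exact: h1.
  rewrite -derive1E h2 -integral_sinD_gauss_moment//.
  under eq_Rintegral do rewrite pf.
  rewrite -[RHS]mulN1r -RintegralZl//.
    by apply: eq_Rintegral => t _; rewrite mulN1r.
  exact: integrable_bounded_mul (measurable_sinD y c) (fun _ => norm_sin_le1 _)
    (integrable_gauss_moment s0).
have dH (y : R) : is_derive y 1 (fun y => F y * expR (y ^+ 2 * s ^+ 2 / 2)) 0.
  have h1 : is_derive y 1 (fun y : R => y ^+ 2 * s ^+ 2 / 2) (y * s ^+ 2).
    by apply: is_derive_eq; rewrite /GRing.scale/=; field.
  have h2 := @is_derive1_comp _ (@expR R) _ _ _ _ (is_derive_expR _) h1.
  apply: (@is_derive_eq _ _ _ _ _ _ _ _ (is_deriveM (dF y) h2)).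
  by rewrite /GRing.scale/=; ring.
have := is_derive_0_is_cst x 0 dH.
rewrite expr0n !mul0r expR0 mulr1 => FE.
have -> : gauss s^-1 x = (expR (x ^+ 2 * s ^+ 2 / 2))^-1.
  by rewrite /gauss expRN; congr (expR _)^-1; field.
have e0 : expR (x ^+ 2 * s ^+ 2 / 2) != 0 :> R by rewrite gt_eqF ?expR_gt0.
apply: (mulIf e0); rewrite divfK// -[X in X * _ = _]/(F x) FE /F /f.
under eq_Rintegral do rewrite mulr0 add0r.
rewrite RintegralZl//; last exact: integrable_gauss.
by rewrite /Rintegral integral_gauss//= mulrC.
Qed.

Lemma integral_cos_gauss s x : 0 < s ->
  \int[leb]_t (cos (t * x) * gauss s t) = s * Num.sqrt (2 * pi) * gauss s^-1 x.
Proof.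
move=> s0; have := integral_cosD_gauss x 0 s0; rewrite cos0 mulr1 => <-.
by apply: eq_Rintegral => t _; rewrite addr0.
Qed.

Lemma integral_sin_gauss s x : 0 < s ->
  \int[leb]_t (sin (t * x) * gauss s t) = 0.
Proof.
move=> s0; have := integral_cosD_gauss x (- (pi / 2)) s0.
rewrite cosN cos_pihalf mulr0 mul0r => <-.
by apply: eq_Rintegral => t _; rewrite cosBpihalf.
Qed.

End gaussian.

(** * Integrating a nonnegative kernel over its parameter *)

Section fubini_bounded.
Context d1 d2 (T1 : measurableType d1) (T2 : measurableType d2) (R : realType).
Variables (m1 : {sigma_finite_measure set T1 -> \bar R}).
Variables (m2 : {sigma_finite_measure set T2 -> \bar R}).
Variable Phi : T1 * T2 -> R.
Hypothesis mPhi : measurable_fun setT Phi.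
Hypothesis Phi_ge0 : forall z, 0 <= Phi z.
Hypothesis Phi_fin : (\int[m1]_x \int[m2]_y (Phi (x, y))%:E < +oo)%E.

Let ints (b : T2 -> R) : measurable_fun setT b -> (forall y, `|b y| <= 1) ->
  (m1 \x m2)%E.-integrable setT (fun z => (b z.2 * Phi z)%:E).
Proof.
move=> mb b1.
have mbP : measurable_fun setT (fun z : T1 * T2 => b z.2 * Phi z).
  by apply: measurable_funM => //; exact: measurableT_comp mb measurable_snd.
apply/integrable12ltyP; first exact/measurable_EFinP.
apply: le_lt_trans Phi_fin; apply: ge0_le_integral => //.
- by move=> x _; apply: integral_ge0.
- apply: (measurable_fun_fubini_tonelli_F (fun z : T1 * T2 => `|(b z.2 * Phi z)%:E|%E)) => //.
  by apply: measurableT_comp => //; exact/measurable_EFinP.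
- apply: (measurable_fun_fubini_tonelli_F (fun z : T1 * T2 => (Phi z)%:E)).
    exact/measurable_EFinP.
  by move=> z; rewrite lee_fin.
move=> x _; apply: ge0_le_integral => //.
- apply: measurableT_comp => //; apply/measurable_EFinP.
  exact: (measurableT_comp mbP (pair1_measurable x)).
- apply/measurable_EFinP; exact: (measurableT_comp mPhi (pair1_measurable x)).
- move=> y _; rewrite /= lee_fin normrM (ger0_norm (Phi_ge0 _)).
  by rewrite ler_piMl.
Qed.

(** The integral may be infinite on a null set, where [fine] returns 0; this is why
    [ae_fubini_density] holds almost everywhere only. *)
Definition fubini_density (y : T2) : R := fine (\int[m1]_x (Phi (x, y))%:E)%E.

Let mG : measurable_fun setT (fun y => \int[m1]_x (Phi (x, y))%:E)%E.
Proof.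
apply: (measurable_fun_fubini_tonelli_G (fun z : T1 * T2 => (Phi z)%:E)).
  exact/measurable_EFinP.
by move=> z; rewrite lee_fin.
Qed.

Lemma measurable_fubini_density : measurable_fun setT fubini_density.
Proof. exact: (measurableT_comp (fine_measurable measurableT) mG). Qed.

Lemma integral_fubini_density_lty : (\int[m2]_y \int[m1]_x (Phi (x, y))%:E < +oo)%E.
Proof.
rewrite -(@fubini_tonelli _ _ _ _ _ m1 m2 (fun z => (Phi z)%:E))//.
exact/measurable_EFinP.
Qed.

Lemma ae_integrable_section :
  {ae m2, forall y, m1.-integrable setT (fun x => (Phi (x, y))%:E)}.
Proof.
have b1 (y : T2) : `|cst (1 : R) y| <= 1 by rewrite normr1.
have := ae_integrable2 (ints (measurable_cst (1 : R)) b1).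
by apply: filterS => y; rewrite /cst; under eq_fun do rewrite mul1r.
Qed.

Lemma ae_fubini_density :
  {ae m2, forall y, (fubini_density y)%:E = \int[m1]_x (Phi (x, y))%:E}%E.
Proof.
have := ae_integrable_section; apply: filterS => y h.
by rewrite /fubini_density fineK//; exact: integrable_fin_num.
Qed.

Lemma integrable_fubini_density : m2.-integrable setT (EFin \o fubini_density).
Proof.
apply/integrableP; split; first exact/measurable_EFinP/measurable_fubini_density.
rewrite (@ae_eq_integral _ _ _ m2 setT (fun y => \int[m1]_x (Phi (x, y))%:E)%E) //.
- exact: integral_fubini_density_lty.
- apply: measurableT_comp => //; exact/measurable_EFinP/measurable_fubini_density.
- have := ae_fubini_density; apply: filterS => y /= <- _.
  by rewrite ger0_norm// fine_ge0// integral_ge0// => x _; rewrite lee_fin.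
Qed.

Lemma Rintegral_fubini_density (b : T2 -> R) :
  measurable_fun setT b -> (forall y, `|b y| <= 1) ->
  \int[m2]_y (b y * fubini_density y) = \int[m1]_x \int[m2]_y (b y * Phi (x, y)).
Proof.
move=> mb b1; rewrite /Rintegral.
have mbP : measurable_fun setT (fun z : T1 * T2 => b z.2 * Phi z).
  by apply: measurable_funM => //; exact: measurableT_comp mb measurable_snd.
have ib := ints mb b1.
transitivity (fine (\int[m2]_y \int[m1]_x (b y * Phi (x, y))%:E)%E).
  congr fine; apply: ae_eq_integral => //.
  - by apply/measurable_EFinP/measurable_funM => //; exact: measurable_fubini_density.
  - exact: measurable_fubini_G ib.
  - have := ae_integrable_section; apply: filterS => y h _.
    under [RHS]eq_integral do rewrite EFinM.
    rewrite integralZl// /fubini_density EFinM fineK//.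
    exact: integrable_fin_num.
rewrite -(Fubini ib); congr fine; apply: ae_eq_integral => //.
- exact: measurable_fubini_F ib.
- apply/measurable_EFinP.
  exact: (measurableT_comp (fine_measurable measurableT) (measurable_fubini_F ib)).
- have := ae_integrable1 ib; apply: filterS => x h _ /=.
  by rewrite fineK//; exact: integrable_fin_num.
Qed.

End fubini_bounded.

(** * Gaussian densities and their Fourier transforms *)

Section heat_kernel.
Context {R : realType} {n : nat}.
Local Notation leb := (@lebesgue_measure R).
Local Notation mu := (@lebesgue_Rn R n).
Local Notation kappa := (Num.sqrt (2 * pi) : R).

Lemma kappa_gt0 : 0 < kappa.
Proof. by rewrite sqrtr_gt0 mulr_gt0// pi_gt0. Qed.

(** Writing 1/t as t times the power -1 of t^2 reduces the claim to powers of nonnegative numbers;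
    at 0 both sides are 0. *)
Lemma measurable_inv : measurable_fun [set: measurableTypeR R] (fun t : measurableTypeR R => (t : R)^-1).
Proof.
rewrite (_ : (fun _ => _) = fun t : measurableTypeR R => (t : R) * ((t : R) ^+ 2) `^ (-1)).
  apply: measurable_funM => //; apply: (measurableT_comp (@measurable_powR R (-1))).
  exact: measurable_funX.
apply/funext => t; rewrite powR_inv1 ?sqr_ge0//.
have [->|t0] := eqVneq (t : R) 0; first by rewrite invr0 mul0r.
by field.
Qed.

Definition heat (s : R) (z : Rn R n) : R :=
  \prod_(i < n) (gauss s (tnth z i) / (s * kappa)).

Lemma heat_ge0 s z : 0 < s -> 0 <= heat s z.
Proof.
move=> s0; apply: prodr_ge0 => i _; rewrite divr_ge0 ?gauss_ge0//.
by rewrite mulr_ge0 ?(ltW s0)// ltW// kappa_gt0.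
Qed.

Lemma heatE s z : heat s z = (s * kappa) ^- n * gauss s (enorm z).
Proof.
rewrite /heat big_split /= prodr_const card_ord -exprVn mulrC; congr (_ * _).
rewrite /gauss -expR_sum; congr expR.
rewrite sqr_sqrtr; last by apply: sumr_ge0 => i _; rewrite -expr2 sqr_ge0.
by rewrite sumrN /dotv mulr_suml.
Qed.

Lemma measurable_heat : measurable_fun [set: measurableTypeR R * Rn R n] (fun p => heat p.1 p.2).
Proof.
apply: measurable_prod => i _.
have m1 : measurable_fun setT (fun p : measurableTypeR R * Rn R n => p.1 : R) by exact: measurable_fst.
have m2 : measurable_fun setT (fun p : measurableTypeR R * Rn R n => tnth p.2 i : R).
  exact: measurableT_comp (measurable_tnth_Rn i) measurable_snd.
apply: measurable_funM.
  apply: (measurableT_comp (@measurable_expR R)); apply: (measurableT_comp (@oppr_measurable R setT)).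
  apply: measurable_funM; first exact: measurable_funX.
  apply: (measurableT_comp measurable_inv); apply: measurable_funM => //.
  exact: measurable_funX.
apply: (measurableT_comp measurable_inv); exact: measurable_funM.
Qed.

Lemma heat_fourier s xi : 0 < s ->
  [/\ mu.-integrable setT (EFin \o heat s), \int[mu]_z heat s z = 1,
   \int[mu]_z (cos (dotv z xi) * heat s z) = gauss 1 (s * enorm xi) &
   \int[mu]_z (sin (dotv z xi) * heat s z) = 0].
Proof.
move=> s0; have sk0 : s * kappa != 0 by rewrite mulf_neq0 ?gt_eqF// kappa_gt0.
pose w (i : 'I_n) t := gauss s t / (s * kappa).
have wE i t : w i t = (s * kappa)^-1 * gauss s t by rewrite mulrC.
have iw i : leb.-integrable setT (EFin \o w i).
  rewrite (_ : w i = fun t => (s * kappa)^-1 * gauss s t); last by apply/funext => t; rewrite wE.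
  exact: (integrableZl measurableT (s * kappa)^-1 (integrable_gauss s0)).
have [h1 h2] := integral_Rn_prod iw.
have ic x := integrable_bounded_mul (measurableT_comp measurable_cos
  (measurable_mulr_cst x)) (fun _ => norm_cos_le1 _) (integrable_gauss s0).
have isn x := integrable_bounded_mul (measurableT_comp measurable_sin
  (measurable_mulr_cst x)) (fun _ => norm_sin_le1 _) (integrable_gauss s0).
have [|i|h3 h4] := @integral_cos_sin_prod R n w (fun i x => gauss s^-1 x) xi iw.
- move=> i; under eq_Rintegral do rewrite wE mulrCA.
  rewrite (RintegralZl _ measurableT (ic _)).
  by rewrite [X in _ * X](integral_cos_gauss _ s0) mulrA mulVf ?mul1r.
- under eq_Rintegral do rewrite wE mulrCA.
  by rewrite (RintegralZl _ measurableT (isn _)) [X in _ * X](integral_sin_gauss _ s0) mulr0.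
split => //.
- rewrite [LHS]h2 big1// => i _; under eq_Rintegral do rewrite wE.
  rewrite RintegralZl//; last exact: integrable_gauss.
  by rewrite /Rintegral integral_gauss//= mulVf.
- rewrite [LHS]h3 /gauss -expR_sum; congr expR.
  rewrite exprMn sqr_sqrtr; last by apply: sumr_ge0 => i _; rewrite -expr2 sqr_ge0.
  rewrite sumrN /dotv mulr_sumr mulr_suml; congr (- _); apply: eq_bigr => i _.
  by field; rewrite gt_eqF.
Qed.

End heat_kernel.

(** * The subordination weight *)

Section bessel_weight.
Context {R : realType}.
Local Notation leb := (@lebesgue_measure R).
Local Open Scope ereal_scope.

Lemma integral_powR_tail (b X : R) : (0 < b)%R -> (0 < X)%R ->
  \int[leb]_(t in `[X, +oo[) (t `^ (- b - 1))%:E = (b^-1 * X `^ (- b))%:E.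
Proof.
move=> b0 X0.
have dF (t : R) : (0 < t)%R ->
    is_derive t 1%R (fun t : R => - b^-1 * t `^ (- b))%R (t `^ (- b - 1))%R.
  move=> t0; have h := is_derive1_powR (- b) t0.
  have -> : (t `^ (- b - 1) = - b^-1 *: (- b * t `^ (- b - 1)))%R.
    by rewrite /GRing.scale/= mulrA mulrNN mulVf ?mul1r// gt_eqF.
  exact: is_deriveZ.
have dp (t c : R) : (0 < t)%R -> derivable (fun t : R => t `^ c)%R t 1%R.
  by move=> t0; apply: ex_derive; exact: is_derive1_powR.
rewrite (@ge0_continuous_FTC2y _ _ (fun t => - b^-1 * t `^ (- b))%R X 0%R).
- by rewrite -EFinB sub0r mulNr opprK.
- by move=> t _; exact: powR_ge0.
- apply: derivable_within_continuous => t; rewrite in_itv/= andbT => Xt.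
  by apply: dp; exact: lt_le_trans Xt.
- rewrite -[X in _ --> X](mulr0 (- b^-1)%R); apply: cvgMl_tmp.
  apply/cvgr0Pnorm_lt => e e0; near=> t.
  have t0 : (0 < t)%R by near: t; exact: nbhs_pinfty_gt.
  rewrite ger0_norm ?powR_ge0// powRN invf_plt ?posrE ?powR_gt0//.
  have -> : (e^-1 = (e^-1 `^ b^-1) `^ b)%R.
    by rewrite -powRrM mulVf ?gt_eqF// powRr1// invr_ge0 ltW.
  apply: gt0_ltr_powR => //; rewrite ?nnegrE ?powR_ge0 ?(ltW t0)//.

- by move=> t Xt; apply: ex_derive; apply: dF; exact: lt_trans Xt.
- have cF : {for X, continuous (fun t : R => - b^-1 * t `^ (- b))%R}.
    by apply: differentiable_continuous; apply/derivable1_diffP; apply: ex_derive; exact: dF.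
  by apply: cvg_at_right_filter; exact: cF.
- move=> t; rewrite in_itv/= andbT => Xt; rewrite derive1E.
  exact: (@derive_val _ _ _ _ _ _ _ (dF t (lt_trans X0 Xt))).
Unshelve. all: by end_near. Qed.

Lemma expr_le_expR (m : nat) (x : R) : (0 <= x)%R -> (x ^+ m <= m%:R ^+ m * expR x)%R.
Proof.
move=> x0; case: m => [|m].
  by rewrite !expr0 mul1r -[leLHS]expR0 ler_expR.
have m0 : (0 < m.+1%:R :> R)%R by rewrite ltr0n.
have h : (x / m.+1%:R <= expR (x / m.+1%:R))%R.
  by apply: le_trans (expR_ge1Dx _); rewrite lerDr.
have -> : (expR x = expR (x / m.+1%:R) ^+ m.+1)%R.
  by rewrite -expRM_natl -mulr_natl mulrC divfK// gt_eqF.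
rewrite -exprMn lerXn2r ?nnegrE ?mulr_ge0 ?expR_ge0 ?(ltW m0)//.
by rewrite mulrC -ler_pdivrMr.
Qed.

Definition bessel_weight (a t : R) : R := t `^ (a - 1) * gauss 1 t.

Lemma bessel_weight_ge0 a t : (0 <= bessel_weight a t)%R.
Proof. by rewrite mulr_ge0 ?powR_ge0 ?gauss_ge0. Qed.

Lemma measurable_bessel_weight a :
  measurable_fun [set: measurableTypeR R] (bessel_weight a : measurableTypeR R -> R).
Proof.
apply: measurable_funM; [exact: measurable_powR|exact: measurable_gauss].
Qed.

(** For an integer m >= a + 1 and t >= 1, t^(a+1) <= t^m <= m^m e^t, and t - t^2/2 <= 1/2. The power
    -2 that remains is integrable at infinity. *)
Lemma bessel_weight_tail a :
  exists2 C : R, (0 < C)%R &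
    forall t : R, (1 <= t)%R -> (bessel_weight a t <= C * t `^ (-1 - 1))%R.
Proof.
pose m := (Num.bound `|a + 1|)%R.+1.
have hm : (a + 1 <= m%:R)%R.
  apply: le_trans (ler_norm _) _; apply: le_trans (ltW (archi_boundP _)) _ => //.
  by rewrite ler_nat.
exists (m%:R ^+ m * expR 2^-1)%R.
  by rewrite mulr_gt0 ?expR_gt0// exprn_gt0// ltr0n.
move=> t t1; have t0 : (0 < t)%R by exact: lt_le_trans t1.
rewrite /bessel_weight (_ : a - 1 = (-1 - 1) + (a + 1))%R; last by ring.
rewrite powRD; last by apply/implyP => _; rewrite gt_eqF.
rewrite -mulrA mulrC ler_wpM2r ?powR_ge0//.
have h1 : (t `^ (a + 1) <= t ^+ m)%R by rewrite -powR_mulrn ?(ltW t0)// ler_powR.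
have h2 := expr_le_expR m (ltW t0).
have h3 : (expR t * gauss 1 t <= expR 2^-1)%R.
  rewrite /gauss -expRD ler_expR expr1n mulr1.
  have := sqr_ge0 (t - 1)%R; lra.
apply: (@le_trans _ _ (m%:R ^+ m * expR t * gauss 1 t)%R).
  by rewrite ler_wpM2r ?gauss_ge0// (le_trans h1).
by rewrite -mulrA ler_wpM2l// exprn_ge0.
Qed.

(** In closed form this is 2^(a/2 - 1) Gamma(a/2); what matters below is that it is finite and
    positive. *)
Definition bessel_mass (a : R) : R :=
  fine (\int[leb]_(t in `]0%R, +oo[) (bessel_weight a t)%:E).

Lemma bessel_massE a : (0 < a)%R ->
  \int[leb]_(t in `]0%R, +oo[) (bessel_weight a t)%:E = (bessel_mass a)%:E.
Proof.
move=> a0; rewrite /bessel_mass fineK// ge0_fin_numE; last first.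
  by apply: integral_ge0 => t _; rewrite lee_fin bessel_weight_ge0.
have mw : measurable_fun setT (fun t : measurableTypeR R => (bessel_weight a t)%:E).
  by apply/measurable_EFinP; exact: measurable_bessel_weight.
have [C C0 hC] := bessel_weight_tail a.
pose I : set (measurableTypeR R) := `]0%R, 1%R]%classic.
pose J : set (measurableTypeR R) := `]1%R, +oo[%classic.
pose J' : set (measurableTypeR R) := `[1%R, +oo[%classic.
have -> : `]0%R, +oo[%classic = I `|` J.
  apply/seteqP; split=> t; rewrite /I /J /= !in_itv/= !andbT.
    by move=> t0; have [|] := leP t 1%R; [left; rewrite t0|right].
  by case=> [/andP[]//|]; exact: lt_trans.
have [mI mJ mJ'] : [/\ measurable I, measurable J & measurable J'].
  by split; exact: measurable_itv.
apply: (@le_lt_trans _ _ ((a^-1 * 1 `^ a)%:E + (C * (1^-1 * 1 `^ (-1)))%:E)); last first.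
  by rewrite -EFinD ltry.
apply: (@le_trans _ _ (\int[leb]_(t in I) (bessel_weight a t)%:E +
    \int[leb]_(t in J) (bessel_weight a t)%:E)).
  rewrite ge0_integral_setU//; first exact: measurable_funTS.
    by move=> t _; rewrite lee_fin bessel_weight_ge0.
  apply/disj_setPS => t; rewrite /I /J /= !in_itv/= andbT => -[/andP[_ t1] t2].
  by have := le_lt_trans t1 t2; rewrite ltxx.
apply: leeD.
  apply: le_trans (integral_powR_le a0 ltr01).
  apply: ge0_le_integral => //.
  - by move=> t _; rewrite lee_fin bessel_weight_ge0.
  - exact: measurable_funTS.
  - by apply: measurable_funTS; apply/measurable_EFinP; exact: measurable_powR.
  - by move=> t _; rewrite lee_fin ler_piMr ?powR_ge0// gauss_le1.
apply: (@le_trans _ _ (\int[leb]_(t in J') (bessel_weight a t)%:E)).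
  apply: ge0_subset_integral => //; first exact: measurable_funTS.
  - by move=> t _; rewrite lee_fin bessel_weight_ge0.
  - by move=> t; rewrite /J /J' /= !in_itv/= !andbT => /ltW.
rewrite EFinM -integral_powR_tail// -ge0_integralZl//.
- apply: ge0_le_integral => //.
  - by move=> t _; rewrite lee_fin bessel_weight_ge0.
  - exact: measurable_funTS.
  - by apply: measurable_funTS; apply/measurable_EFinP; apply: measurable_funM.
  - by move=> t; rewrite /J' /= in_itv/= andbT => t1; rewrite -EFinM lee_fin hC.
- by apply: measurable_funTS; apply/measurable_EFinP; exact: measurable_powR.
- by move=> t _; rewrite lee_fin powR_ge0.
- by rewrite lee_fin ltW.
Qed.

Lemma bessel_mass_gt0 a : (0 < a)%R -> (0 < bessel_mass a)%R.
Proof.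
move=> a0; rewrite -lte_fin -bessel_massE//.
pose c : R := (2 `^ (- `|a - 1|) * gauss 1 2)%R.
have c0 : (0 < c)%R by rewrite mulr_gt0 ?powR_gt0 ?expR_gt0.
pose I : set (measurableTypeR R) := `[1%R, 2%R]%classic.
have mw : measurable_fun setT (fun t : measurableTypeR R => (bessel_weight a t)%:E).
  by apply/measurable_EFinP; exact: measurable_bessel_weight.
apply: (@lt_le_trans _ _ (\int[leb]_(t in I) c%:E)).
  rewrite integral_cst; last exact: measurable_itv.
  have I1 : leb I = 1%:E.
    rewrite /I lebesgue_measure_itv/= lte_fin ltr1n -EFinD; congr EFin; ring.
  by rewrite [X in _ < _ * X]I1 mule1 lte_fin.
apply: (@le_trans _ _ (\int[leb]_(t in I) (bessel_weight a t)%:E)).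
  apply: ge0_le_integral => //.
  - exact: measurable_itv.
  - by move=> t _; rewrite lee_fin ltW.
  - exact: measurable_funTS.
  - move=> t; rewrite /I /= in_itv/= => /andP[t1 t2]; rewrite lee_fin ler_pM ?powR_ge0 ?gauss_ge0//.
      apply: (@le_trans _ _ (t `^ (- `|a - 1|))%R); last first.
        by apply: ler_powR => //; rewrite lerNl -normrN ler_norm.
      have t21 : (1 <= 2 :> R)%R by rewrite ler1n.
      rewrite !powRN lef_pV2 ?posrE ?powR_gt0 ?(lt_le_trans ltr01)//.
      by apply: ge0_ler_powR => //; rewrite nnegrE; lra.
    rewrite /gauss ler_expR lerN2 ler_wpM2r ?invr_ge0 ?mulr_ge0// ?sqr_ge0//.
    by rewrite lerXn2r ?nnegrE//; lra.
apply: ge0_subset_integral => //.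
- exact: measurable_itv.
- exact: measurable_funTS.
- by move=> t _; rewrite lee_fin bessel_weight_ge0.
- by move=> t; rewrite /I /= !in_itv/= andbT => /andP[t1 _]; exact: lt_le_trans t1.
Qed.

(** With l = (1 + |xi|^2)^(1/2), the power l^(-a) is the symbol of the Bessel kernel. *)
Lemma integral_bessel_weight_dilation a l : (0 < a)%R -> (0 < l)%R ->
  \int[leb]_(t in `]0%R, +oo[) (t `^ (a - 1) * gauss 1 (l * t))%:E =
  (l `^ (- a) * bessel_mass a)%:E.
Proof.
move=> a0 l0.
have mw : measurable_fun setT (fun t : measurableTypeR R => (bessel_weight a t)%:E).
  by apply/measurable_EFinP; exact: measurable_bessel_weight.
have := @ge0_integral_dilation R l (fun t => (bessel_weight a t)%:E) l0 mw
  (fun t => ltac:(by rewrite lee_fin bessel_weight_ge0)).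
rewrite bessel_massE// => h.
transitivity ((l `^ (1 - a))%:E *
  \int[leb]_(t in `]0%R, +oo[) (bessel_weight a (l * t))%:E); last first.
  rewrite h -!EFinM mulrA; congr (_ * _)%:E.
  rewrite -powR_inv1 ?(ltW l0)// -powRD; last by apply/implyP => _; rewrite gt_eqF.
  by congr (_ `^ _)%R; ring.
rewrite -ge0_integralZl//; first last.
- by rewrite lee_fin powR_ge0.
- by move=> t _; rewrite lee_fin bessel_weight_ge0.
- apply: measurable_funTS.
  apply: (measurableT_comp (f := fun t : measurableTypeR R => (bessel_weight a t)%:E) mw).
  exact: (@measurable_funM _ _ _ setT (cst l) id).
apply: eq_integral => t; rewrite inE /= in_itv/= andbT => t0.
rewrite -EFinM /bessel_weight powRM ?(ltW t0) ?(ltW l0)// !mulrA -powRD; last first.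
  by apply/implyP => _; rewrite gt_eqF.
by rewrite (_ : 1 - a + (a - 1) = 0)%R ?powRr0 ?mul1r//; ring.
Qed.

End bessel_weight.

(** * The Bessel kernel as a superposition of Gaussians *)

Section bessel_subordination.
Context {R : realType} {n : nat}.
Local Notation leb := (@lebesgue_measure R).
Local Notation mu := (@lebesgue_Rn R n).
Variable a : R.
Hypothesis a_gt0 : 0 < a.

(* [l] is [1] in the Bessel kernel. *)
Definition bessel_density (l : R) (p : measurableTypeR R * Rn R n) : R :=
  \1_(`]0, +oo[%classic : set (measurableTypeR R)) p.1 * bessel_weight a p.1 * heat (l * p.1) p.2.

Let indic_pos (t : measurableTypeR R) : 0 < (t : R) ->
  \1_(`]0, +oo[%classic : set (measurableTypeR R)) t = 1 :> R.
Proof. by move=> t0; rewrite indicE mem_set//= in_itv/= andbT. Qed.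

Let indic_npos (t : measurableTypeR R) : (t : R) <= 0 ->
  \1_(`]0, +oo[%classic : set (measurableTypeR R)) t = 0 :> R.
Proof. by move=> t0; rewrite indicE memNset//= in_itv/= andbT => t1; lra. Qed.

Lemma bessel_density_ge0 l p : 0 < l -> 0 <= bessel_density l p.
Proof.
move=> l0.
have [p0|p0] := ltP 0 (p.1 : R); last by rewrite /bessel_density indic_npos// !mul0r.
by rewrite /bessel_density indic_pos// mul1r mulr_ge0 ?bessel_weight_ge0 ?heat_ge0 ?mulr_gt0.
Qed.

Lemma measurable_bessel_density l : measurable_fun setT (bessel_density l).
Proof.
apply: measurable_funM; last first.
  apply: (measurableT_comp (f := fun p : measurableTypeR R * Rn R n => heat p.1 p.2)
    (g := fun p : measurableTypeR R * Rn R n => ((l * p.1 : R) : measurableTypeR R, p.2))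
    measurable_heat).
  apply/measurable_fun_pairP; split; last exact: measurable_snd.
  by apply: (measurable_funM (f := cst l)) => //; exact: measurable_fst.
apply: measurable_funM.
  apply: (measurableT_comp _ measurable_fst).
  by apply: measurable_indic; exact: measurable_itv.
exact: (measurableT_comp (measurable_bessel_weight a) measurable_fst).
Qed.

Lemma integral_bessel_density l (t : measurableTypeR R) : 0 < l ->
  (\int[mu]_z (bessel_density l (t, z))%:E =
   (\1_(`]0%R, +oo[%classic : set (measurableTypeR R)) t)%:E * (bessel_weight a t)%:E)%E.
Proof.
move=> l0; have [t0|t0] := ltP 0 (t : R); last first.
  rewrite indic_npos// mul0e integral0_eq// => z _.
  by rewrite /bessel_density indic_npos// !mul0r.
rewrite /bessel_density indic_pos// mul1e; under eq_integral do rewrite mul1r EFinM.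
have [h1 h2 _ _] := heat_fourier [tuple 0 | i < n] (mulr_gt0 l0 t0).
rewrite /= integralZl_ge0 ?lee_fin ?bessel_weight_ge0//.
- have := h2; rewrite /Rintegral => h3.
  by rewrite -[X in (_ * X)%E]fineK ?h3 ?mule1//; exact: integrable_fin_num h1.
- exact: measurable_int h1.
- by move=> z; rewrite lee_fin heat_ge0 ?mulr_gt0.
Qed.

Lemma bessel_density_lty l : 0 < l ->
  (\int[leb]_t \int[mu]_z (bessel_density l (t, z))%:E < +oo)%E.
Proof.
move=> l0; under eq_integral do rewrite integral_bessel_density//.
by rewrite -integral_indicM bessel_massE// ltry.
Qed.

Definition bessel_gauss (z : Rn R n) : R :=
  (bessel_mass a)^-1 * fubini_density leb (bessel_density 1) z.

Lemma integrable_bessel_gauss : mu.-integrable setT (EFin \o bessel_gauss).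
Proof.
have h := integrable_fubini_density (measurable_bessel_density 1)
    (fun p => bessel_density_ge0 p ltr01) (bessel_density_lty ltr01).
exact: (integrableZl measurableT (bessel_mass a)^-1 h).
Qed.

(** The transform of the Gaussian of width t is e^(- t^2 |xi|^2 / 2). It merges with the factor e^(-
    t^2 / 2) of the weight into [gauss 1 (l * t)], where l^2 = 1 + |xi|^2, and the dilation formula
    ends the computation. *)
Lemma fourier_bessel_gauss xi :
  fourier bessel_gauss xi = ((1 + enorm xi ^+ 2) `^ (- (a / 2)))%:C%C.
Proof.
have h := integrable_fubini_density (measurable_bessel_density 1)
    (fun p => bessel_density_ge0 p ltr01) (bessel_density_lty ltr01).
have trig (b : R -> R) (g : R -> R) : measurable_fun [set: measurableTypeR R] b ->
    (forall x, `|b x| <= 1) ->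
    (forall t, 0 < t -> \int[mu]_z (b (dotv z xi) * heat t z) = g t) ->
    \int[mu]_z (b (dotv z xi) * bessel_gauss z) =
    (bessel_mass a)^-1 * fine (\int[leb]_(t in `]0%R, +oo[) (bessel_weight a t * g t)%:E)%E.
  move=> mb b1 hg.
  have mbd : measurable_fun setT (fun z : Rn R n => b (dotv z xi)).
    exact: (measurableT_comp mb (measurable_dotv xi)).
  under eq_Rintegral do rewrite /bessel_gauss mulrCA.
  rewrite (RintegralZl _ measurableT (integrable_bounded_mul mbd (fun _ => b1 _) h)).
  congr (_ * _).
  rewrite (Rintegral_fubini_density (measurable_bessel_density 1)
    (fun p => bessel_density_ge0 p ltr01) (bessel_density_lty ltr01) mbd (fun _ => b1 _)).
  rewrite [LHS]/Rintegral [in RHS]integral_indicM; congr fine; apply: eq_integral => t _.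
  have [t0|t0] := ltP 0 (t : R); last first.
    rewrite indic_npos// mul0e; congr EFin.
    rewrite /Rintegral integral0_eq// => z _.
    by rewrite /bessel_density indic_npos// !mul0r mulr0.
  rewrite indic_pos// mul1e -(hg _ t0); congr EFin.
  have [i1 _ _ _] := heat_fourier xi t0.
  have i2 := integrable_bounded_mul mbd (fun _ => b1 _) i1.
  rewrite -(RintegralZl _ measurableT i2) /Rintegral; congr fine.
  apply: eq_integral => z _; congr EFin.
  by rewrite /bessel_density indic_pos// !mul1r mulrCA.
rewrite /fourier.
have -> := trig (@sin R) (fun=> 0) measurable_sin (fun _ => norm_sin_le1 _)
  (fun t t0 => ltac:(by case: (heat_fourier xi t0))).
have -> := trig (@cos R) (fun t => gauss 1 (t * enorm xi)) measurable_cos (fun _ => norm_cos_le1 _)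
  (fun t t0 => ltac:(by case: (heat_fourier xi t0))).
rewrite (_ : (fun t => (_ * 0)%:E) = cst 0%E); last by apply/funext => t; rewrite mulr0.
rewrite integral0 mulr0 oppr0; congr Complex.
pose l : R := Num.sqrt (1 + enorm xi ^+ 2).
have l2 : 0 < 1 + enorm xi ^+ 2 by rewrite ltr_pwDl// sqr_ge0.
have l0 : 0 < l by rewrite sqrtr_gt0.
have l2E : l ^+ 2 = 1 + enorm xi ^+ 2 by rewrite sqr_sqrtr// ltW.
rewrite (_ : (fun t => _) = fun t : R => (t `^ (a - 1) * gauss 1 (l * t))%:E); last first.
  apply/funext => t; congr EFin; rewrite /bessel_weight -mulrA; congr (_ * _).
  rewrite /gauss -expRD; congr expR.
  by rewrite [(l * t) ^+ 2]exprMn l2E; field.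
rewrite integral_bessel_weight_dilation//= mulrCA mulVf ?mulr1 ?gt_eqF ?bessel_mass_gt0//.
by rewrite /l -powR12_sqrt ?(ltW l2)// -powRrM; congr (_ `^ _); field.
Qed.

(** [bessel_gauss] inhabits the set from which [xget] chooses, so the default value [cst 0] does not
    occur. *)
Lemma bessel_kernel_spec : mu.-integrable setT (EFin \o bessel_kernel a) /\
  forall xi : Rn R n,
    fourier (bessel_kernel a) xi = ((1 + enorm xi ^+ 2) `^ (- (a / 2)))%:C%C.
Proof.
rewrite /bessel_kernel; case: xgetP => [G _ []//|H].
by have := H bessel_gauss; case; split; [exact: integrable_bessel_gauss|exact: fourier_bessel_gauss].
Qed.

End bessel_subordination.

Lemma Rintegral_swap d1 d2 (T1 : measurableType d1) (T2 : measurableType d2)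
    (R : realType) (m1 : {sigma_finite_measure set T1 -> \bar R})
    (m2 : {sigma_finite_measure set T2 -> \bar R}) (f : T1 * T2 -> R) :
  (m1 \x m2)%E.-integrable setT (EFin \o f) ->
  \int[m1]_x \int[m2]_y f (x, y) = \int[m2]_y \int[m1]_x f (x, y).
Proof.
move=> intf; rewrite /Rintegral.
transitivity (fine (\int[m1]_x \int[m2]_y (f (x, y))%:E)%E).
  congr fine; apply: ae_eq_integral => //.
  - apply/measurable_EFinP.
    exact: (measurableT_comp (fine_measurable measurableT) (measurable_fubini_F intf)).
  - exact: measurable_fubini_F intf.
  - have := ae_integrable1 intf; apply: filterS => x h _ /=.
    by rewrite fineK//; exact: integrable_fin_num.
rewrite (Fubini intf); congr fine; apply: ae_eq_integral => //.
- exact: measurable_fubini_G intf.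
- apply/measurable_EFinP.
  exact: (measurableT_comp (fine_measurable measurableT) (measurable_fubini_G intf)).
- have := ae_integrable2 intf; apply: filterS => x h _ /=.
  by rewrite fineK//; exact: integrable_fin_num.
Qed.

(** * Injectivity of the Fourier transform on integrable functions *)

Section fourier_uniqueness.
Context {R : realType} {n : nat}.
Local Notation leb := (@lebesgue_measure R).
Local Notation mu := (@lebesgue_Rn R n).
Local Notation kappa := (Num.sqrt (2 * pi) : R).
Variable H : Rn R n -> R.
Hypothesis intH : mu.-integrable setT (EFin \o H).
Hypothesis cosH : forall xi, \int[mu]_x (cos (dotv x xi) * H x) = 0.
Hypothesis sinH : forall xi, \int[mu]_x (sin (dotv x xi) * H x) = 0.

(** A Gaussian is a superposition of cosines with a Gaussian weight. After Fubini and the formula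
    for the cosine of a difference, only the integrals in [cosH] and [sinH] are left. *)
Lemma gauss_convolution_eq0 s y : 0 < s ->
  \int[mu]_x ((\prod_(i < n) gauss s ((tnth x i : R) - tnth y i)) * H x) = 0.
Proof.
move=> s0; have s1 : 0 < s^-1 by rewrite invr_gt0.
have sk : s^-1 * kappa != 0 by rewrite mulf_neq0 ?gt_eqF ?kappa_gt0.
pose W (xi : Rn R n) := (s^-1 * kappa) ^- n * \prod_(i < n) gauss s^-1 (tnth xi i).
have [intW' _] := integral_Rn_prod (fun _ : 'I_n => integrable_gauss s1).
have intW : mu.-integrable setT (EFin \o W).
  exact: (integrableZl measurableT _ intW').
have WE (z : Rn R n) : \prod_(i < n) gauss s (tnth z i) =
    \int[mu]_xi (cos (dotv xi z) * W xi).
  under [RHS]eq_Rintegral do rewrite mulrCA.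
  rewrite (RintegralZl _ measurableT (integrable_bounded_mul
    (measurableT_comp measurable_cos (measurable_dotv z)) (fun _ => norm_cos_le1 _) intW')).
  have [|i|-> _] := @integral_cos_sin_prod R n (fun=> gauss s^-1)
    (fun _ x => s^-1 * kappa * gauss s x) z (fun=> integrable_gauss s1).
  - by move=> i; rewrite [LHS](integral_cos_gauss _ s1) invrK.
  - exact: integral_sin_gauss.
  - by rewrite big_split/= prodr_const card_ord mulrA mulVf ?mul1r// expf_neq0.
pose f (p : Rn R n * Rn R n) := cos (dotv p.2 (subv p.1 y)) * (H p.1 * W p.2).
have mf : measurable_fun setT (fun p : Rn R n * Rn R n => cos (dotv p.2 (subv p.1 y))).
  apply: (measurableT_comp measurable_cos); apply: measurable_sum => i.
  apply: measurable_funM.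
    exact: measurableT_comp (measurable_tnth_Rn i) measurable_snd.
  rewrite (_ : (fun _ => _) = fun p : Rn R n * Rn R n => (tnth p.1 i : R) - tnth y i).
    apply: measurable_funB => //.
    exact: measurableT_comp (measurable_tnth_Rn i) measurable_fst.
  by apply/funext => p; rewrite tnth_mktuple.
have intf : (mu \x mu)%E.-integrable setT (EFin \o f).
  exact: (integrable_bounded_mul mf (fun _ => norm_cos_le1 _) (integrable_prod_mul intH intW)).
transitivity (\int[mu]_x \int[mu]_xi f (x, xi)).
  apply: eq_Rintegral => x _; rewrite /f /=.
  under [RHS]eq_Rintegral do rewrite mulrCA.
  rewrite (RintegralZl _ measurableT (integrable_bounded_mul
    (measurableT_comp measurable_cos (measurable_dotv _)) (fun _ => norm_cos_le1 _) intW)).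
  rewrite -WE mulrC; congr (_ * _); apply: eq_bigr => i _.
  by rewrite tnth_mktuple.
rewrite (Rintegral_swap intf) (_ : (fun xi => _) = cst 0).
  by rewrite /Rintegral integral0.
apply/funext => xi /=.
under eq_Rintegral => x _.
  rewrite /f /= (_ : dotv xi (subv x y) = dotv x xi - dotv y xi); last first.
    rewrite /dotv -sumrB; apply: eq_bigr => i _; rewrite tnth_mktuple; ring.
  rewrite cosB (_ : _ * _ = W xi * cos (dotv y xi) * (cos (dotv x xi) * H x) +
    W xi * sin (dotv y xi) * (sin (dotv x xi) * H x)); last ring.
  over.
have i1 := integrable_bounded_mul (measurableT_comp measurable_cos (measurable_dotv xi))
  (fun _ => norm_cos_le1 _) intH.
have i2 := integrable_bounded_mul (measurableT_comp measurable_sin (measurable_dotv xi))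
  (fun _ => norm_sin_le1 _) intH.
rewrite RintegralD//=; [|exact: (integrableZl measurableT _ i1)|exact: (integrableZl measurableT _ i2)].
by rewrite (RintegralZl _ measurableT i1) (RintegralZl _ measurableT i2) cosH sinH !mulr0 addr0.
Qed.

Let section_gauss s (A : set (measurableTypeR R)) (x : R) : R :=
  \int[leb]_(t in A) gauss s (x - t).

Let mgauss_sub s (x : R) :
  measurable_fun setT (fun t : measurableTypeR R => gauss s (x - (t : R))).
Proof.
apply: (measurableT_comp (measurable_gauss s)).
by apply: measurable_funB.
Qed.

Let indic_norm_le1 T (A : set T) x : `|\1_A x : R| <= 1.
Proof. by rewrite indicE; case: (_ \in _); rewrite ?normr1 ?normr0. Qed.

Let int_indic (A : set (measurableTypeR R)) : measurable A -> (leb A < +oo)%E ->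
  leb.-integrable setT (EFin \o (\1_A : _ -> R)).
Proof.
move=> mA Aoo; apply/integrableP; split; first exact/measurable_EFinP/measurable_indic.
under eq_integral => t _ do rewrite /= ger0_norm//.
by rewrite (integral_indic leb measurableT mA) setIT.
Qed.

Let gauss_norm_le1 s (x : R) : `|gauss s x| <= 1.
Proof. by rewrite ger0_norm ?gauss_ge0 ?gauss_le1. Qed.

Let section_gaussE s (A : set (measurableTypeR R)) (x : R) :
  section_gauss s A x = \int[leb]_t (gauss s (x - t) * \1_A t).
Proof.
rewrite /section_gauss /Rintegral integral_indicM; congr fine.
by apply: eq_integral => t _; rewrite -EFinM mulrC.
Qed.

(** Integrating the previous identity in [y] over a box turns the Gaussian into a smoothed indicator
    of that box. *)
Lemma box_gauss_eq0 s (A : 'I_n -> set (measurableTypeR R)) : 0 < s ->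
  (forall i, measurable (A i)) -> (forall i, (leb (A i) < +oo)%E) ->
  \int[mu]_x ((\prod_(i < n) section_gauss s (A i) (tnth x i)) * H x) = 0.
Proof.
move=> s0 mA Aoo.
pose V (y : Rn R n) := \prod_(i < n) (\1_(A i) (tnth y i) : R).
have [intV _] := integral_Rn_prod (fun i => int_indic (mA i) (Aoo i)).
pose g (p : Rn R n * Rn R n) := \prod_(i < n) gauss s ((tnth p.1 i : R) - tnth p.2 i).
have mg : measurable_fun setT g.
  apply: measurable_prod => i _; apply: (measurableT_comp (measurable_gauss s)).
  apply: measurable_funB.
    exact: measurableT_comp (measurable_tnth_Rn i) measurable_fst.
  exact: measurableT_comp (measurable_tnth_Rn i) measurable_snd.
have g1 p : `|g p| <= 1.
  rewrite /g normr_prod; apply: prodr_ile1 => i _.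
  by rewrite normr_ge0 gauss_norm_le1.
pose f (p : Rn R n * Rn R n) := g p * (H p.1 * V p.2).
have intf : (mu \x mu)%E.-integrable setT (EFin \o f).
  exact: (integrable_bounded_mul mg g1 (integrable_prod_mul intH intV)).
transitivity (\int[mu]_x \int[mu]_y f (x, y)).
  apply: eq_Rintegral => x _.
  have i1 i : leb.-integrable setT (EFin \o (fun t => gauss s ((tnth x i : R) - t) * \1_(A i) t)).
    exact: (integrable_bounded_mul (mgauss_sub s _) (fun _ => gauss_norm_le1 _ _)
      (int_indic (mA i) (Aoo i))).
  have [i2 i3] := integral_Rn_prod i1.
  under eq_bigr do rewrite section_gaussE.
  rewrite -i3 mulrC -(RintegralZl _ measurableT i2).
  by apply: eq_Rintegral => y _; rewrite /f /g /V /= mulrCA big_split.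
rewrite (Rintegral_swap intf) (_ : (fun xi => _) = cst 0).
  by rewrite /Rintegral integral0.
apply/funext => y /=.
have i1 : mu.-integrable setT (EFin \o (fun x => g (x, y) * H x)).
  apply: integrable_bounded_mul intH => //.
  exact: (measurableT_comp mg (pair2_measurable y)).
under eq_Rintegral do rewrite /f /= mulrA mulrC.
rewrite (RintegralZl _ measurableT i1) /g /=.
by rewrite gauss_convolution_eq0 ?mulr0.
Qed.

(* The box is translated by [e k], which exceeds the width [e k ^+ 2] of the
   Gaussian: this makes the limit of [norm_section] the indicator of the
   half-open interval at its endpoints too. *)
Let norm_section s (A : set (measurableTypeR R)) (x : R) : R :=
  (s * kappa)^-1 * section_gauss s A x.

Let norm_sectionE s (A : set (measurableTypeR R)) (x : R) : 0 < s -> measurable A ->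
  ((norm_section s A x)%:E =
   (kappa^-1)%:E * \int[leb]_z (\1_A (s * z + x) * gauss 1 z)%:E)%E /\
  (\int[leb]_z (\1_A (s * z + x)%R * gauss 1 z)%:E <= kappa%:E)%E.
Proof.
move=> s0 mA.
have mi : measurable_fun setT (fun z : measurableTypeR R => (\1_A (s * (z : R) + x) : R)).
  apply: (measurableT_comp (f := \1_A : measurableTypeR R -> R)).
    exact: measurable_indic.
  exact: measurable_affine_map.
have le_k : (\int[leb]_z (\1_A (s * z + x)%R * gauss 1 z)%:E <= kappa%:E)%E.
  rewrite -[leRHS](_ : \int[leb]_t (gauss 1 t)%:E = _)%E; last first.
    by rewrite integral_gauss// mul1r.
  apply: ge0_le_integral => //.
  - by move=> z _; rewrite lee_fin mulr_ge0 ?gauss_ge0.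
  - by apply/measurable_EFinP; apply: measurable_funM => //; exact: measurable_gauss.
  - by apply/measurable_EFinP; exact: measurable_gauss.
  - by move=> z _; rewrite lee_fin ler_piMl ?gauss_ge0// indicE; case: (_ \in _).
split => //.
have mf : measurable_fun setT (fun t : measurableTypeR R => (gauss s (x - (t : R)) * \1_A t)%:E).
  apply/measurable_EFinP; apply: measurable_funM => //; exact: measurable_indic.
have := @ge0_integral_affine R s x (fun t => (gauss s (x - t) * \1_A t)%:E) (lt0r_neq0 s0) mf
  (fun t => ltac:(by rewrite lee_fin mulr_ge0 ?gauss_ge0)).
rewrite (_ : (fun t => (gauss s (x - (s * t + x)) * _)%:E) =
  (fun z => (\1_A (s * z + x) * gauss 1 z)%:E)); last first.
  apply/funext => z; rewrite mulrC; congr (_ * expR (- _))%:E.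
  by field; rewrite gt_eqF.
rewrite gtr0_norm// => h; rewrite h.
have fin : (\int[leb]_t (gauss s (x - t) * \1_A t)%:E)%E \is a fin_num.
  have : ((s^-1)%:E * \int[leb]_t (gauss s (x - t)%R * \1_A t)%:E < +oo)%E.
    by rewrite -h (le_lt_trans le_k)// ltry.
  rewrite ge0_fin_numE; last by apply: integral_ge0 => t _; rewrite lee_fin mulr_ge0 ?gauss_ge0.
  by move: (\int[leb]_t _)%E => [r| |]//; rewrite ?ltry// gt0_muley// lte_fin invr_gt0.
rewrite /norm_section section_gaussE /Rintegral EFinM fineK// muleA -EFinM.
by rewrite invfM mulrC.
Qed.

Let norm_section_le1 s (A : set (measurableTypeR R)) (x : R) : 0 < s -> measurable A ->
  0 <= norm_section s A x <= 1.
Proof.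
move=> s0 mA; have [h1 h2] := norm_sectionE x s0 mA.
rewrite -!lee_fin h1; apply/andP; split.
  rewrite mule_ge0 ?lee_fin ?invr_ge0 ?(ltW kappa_gt0)//.
  by apply: integral_ge0 => t _; rewrite lee_fin mulr_ge0 ?gauss_ge0.
apply: (@le_trans _ _ ((kappa^-1)%:E * kappa%:E)%E).
  by rewrite lee_wpmul2l// lee_fin invr_ge0 ltW// kappa_gt0.
by rewrite -EFinM mulVf// gt_eqF// kappa_gt0.
Qed.

Let measurable_norm_section s (A : set (measurableTypeR R)) : measurable A ->
  measurable_fun setT (norm_section s A : measurableTypeR R -> R).
Proof.
move=> mA; apply: measurable_funM => //.
pose f (p : measurableTypeR R * measurableTypeR R) : \bar R :=
  (gauss s ((p.1 : R) - p.2) * \1_A p.2)%:E.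
have mf : measurable_fun setT f.
  apply/measurable_EFinP; apply: measurable_funM.
    apply: (measurableT_comp (measurable_gauss s)).
    by apply: measurable_funB; [exact: measurable_fst|exact: measurable_snd].
  by apply: (measurableT_comp _ measurable_snd); exact: measurable_indic.
have mF := @measurable_fun_fubini_tonelli_F _ _ _ _ _ leb f mf
  (fun p => ltac:(by rewrite lee_fin mulr_ge0 ?gauss_ge0)).
rewrite (_ : section_gauss s A = fine \o fubini_F leb f); last first.
  by apply/funext => x; rewrite section_gaussE.
exact: (measurableT_comp (fine_measurable measurableT) mF).
Qed.

Let e k : R := k.+1%:R^-1.

Let e_gt0 k : 0 < e k. Proof. by rewrite invr_gt0 ltr0n. Qed.

Let box_itv (c d : R) k : set (measurableTypeR R) := [set` `]c + e k, d + e k]%R].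

Lemma cvg_norm_section (c d x : R) :
  norm_section (e k ^+ 2) (box_itv c d k) x @[k --> \oo] --> (\1_(`]c, d]%classic) x : R).
Proof.
pose F k (z : measurableTypeR R) : \bar R :=
  (\1_(box_itv c d k) (e k ^+ 2 * (z : R) + x) * gauss 1 z)%:E.
pose G (z : measurableTypeR R) : \bar R := (\1_(`]c, d]%classic) x * gauss 1 z)%:E.
have mF k : measurable_fun setT (F k).
  apply/measurable_EFinP; apply: measurable_funM; last exact: measurable_gauss.
  apply: (measurableT_comp (f := \1_(box_itv c d k) : measurableTypeR R -> R)).
    by apply: measurable_indic; exact: measurable_itv.
  exact: measurable_affine_map.
have mG : measurable_fun setT G.
  by apply/measurable_EFinP; apply: measurable_funM => //; exact: measurable_gauss.
have FG z : F k z @[k --> \oo] --> G z.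
  apply: cvg_near_cst.
  (* [eta] is at most the distance from [x] to each endpoint strictly to its left. The effective
     shift [dl] is positive and below [eta], hence moves [x] to the left without crossing [c] or
     [d], even when [x] is one of them. *)
  pose eta := Num.min (if c < x then x - c else 1) (if d < x then x - d else 1).
  have eta0 : 0 < eta.
    by rewrite lt_min; apply/andP; split; case: ifPn => // h; rewrite subr_gt0.
  near=> k; rewrite /F /G; congr (_ * _)%:E.
  have ez : e k * (1 + `|z : R|) < 1.
    rewrite -ltr_pdivlMr ?ltr_pwDl// div1r.
    near: k; apply: (near_infty_natSinv_lt (PosNum _)).
    by rewrite invr_gt0 ltr_pwDl.
  have e2 : e k < eta / 2.
    by near: k; apply: (near_infty_natSinv_lt (PosNum _)); rewrite divr_gt0.
  pose dl := e k - e k ^+ 2 * z.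
  have ez' : `|e k * z| < 1.
    by rewrite normrM gtr0_norm//; have := e_gt0 k; rewrite mulrDr mulr1 in ez; lra.
  have [dl0 dle] : 0 < dl /\ dl < eta.
    rewrite /dl (_ : _ - _ = e k * (1 - e k * z)); last by ring.
    move: ez'; rewrite ltr_norml => /andP[h1 h2]; split.
      by rewrite mulr_gt0// subr_gt0.
    apply: lt_trans (_ : e k * 2 < _); last by rewrite -ltr_pdivlMr.
    by rewrite ltr_pM2l//; lra.
  have xE : e k ^+ 2 * z + x = x - dl + e k by rewrite /dl; ring.
  rewrite !indicE; congr (nat_of_bool _)%:R.
  apply/idP/idP; rewrite !inE /box_itv /= !in_itv/= xE ltrD2r lerD2r => /andP[h1 h2];
    move: dle; rewrite /eta lt_min => /andP[].
  - by case: ifPn => [h3|/negP h3]; case: ifPn => [h5|/negP h5] h4 h6; apply/andP; split; lra.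
  - by case: ifPn => [h3|/negP h3]; case: ifPn => [h5|/negP h5] h4 h6; apply/andP; split; lra.
have ig := integrable_gauss (@ltr01 R).
have FGle k z : (`|F k z| <= (gauss 1 z)%:E)%E.
  rewrite /F /= lee_fin normrM (ger0_norm (gauss_ge0 _ _)).
  by rewrite ler_piMl ?gauss_ge0.
have [_ _ lim_F] := dominated_convergence measurableT mF mG
  (aeW _ (fun t _ => FG t)) ig (aeW _ (fun t k _ => FGle k t)).
apply: (@fine_cvg _ _ _ _ (fun k => (norm_section (e k ^+ 2) (box_itv c d k) x)%:E)).
rewrite (_ : (\1_(`]c, d]%classic) x)%:E = ((kappa^-1)%:E * \int[leb]_z G z)%E); last first.
  rewrite /G; under eq_integral do rewrite EFinM.
  rewrite integralZl_ge0 ?lee_fin//.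
  - rewrite [X in (_ * (_ * X))%E](integral_gauss ltr01) mul1r -!EFinM mulrCA mulVf ?mulr1//.
    by rewrite gt_eqF ?kappa_gt0.
  - by apply/measurable_EFinP; exact: measurable_gauss.
  - by move=> z; rewrite lee_fin gauss_ge0.
under eq_fun => k do rewrite (norm_sectionE x (exprn_gt0 2 (e_gt0 k)) (measurable_itv _)).1.
by apply: cvgeZl => //.
Unshelve. all: by end_near. Qed.

Let cvg_prod (I : Type) (r : seq I) (f : I -> R^nat) (l : I -> R) :
  (forall i, f i k @[k --> \oo] --> l i) ->
  \prod_(i <- r) f i k @[k --> \oo] --> \prod_(i <- r) l i.
Proof.
move=> h; elim: r => [|i r IH].
  by rewrite big_nil; under eq_fun do rewrite big_nil; exact: cvg_cst.
by rewrite big_cons; under eq_fun do rewrite big_cons; exact: cvgM.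
Qed.

Let box (c d : 'I_n -> R) : set (Rn R n) :=
  [set x | forall i, `]c i, d i]%classic (tnth x i)].

Let measurable_box c d : measurable (box c d).
Proof.
rewrite (_ : box c d = \bigcap_(i in [set: 'I_n])
    ((fun x : Rn R n => tnth x i) @^-1` `]c i, d i]%classic)).
  apply: fin_bigcap_measurable; first exact: finite_finset.
  move=> i _; rewrite -[X in measurable X]setTI.
  exact: (measurable_tnth_Rn i measurableT (measurable_itv _)).
by apply/seteqP; split=> x /= h i; [move=> _|]; exact: h.
Qed.

Lemma integral_box_eq0 (c d : 'I_n -> R) : (\int[mu]_(x in box c d) (H x)%:E = 0)%E.
Proof.
pose P k (x : Rn R n) : R := \prod_(i < n) norm_section (e k ^+ 2) (box_itv (c i) (d i) k) (tnth x i).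
have e20 k : 0 < e k ^+ 2 by rewrite exprn_gt0.
have mA i k : measurable (box_itv (c i) (d i) k) by exact: measurable_itv.
have mP k : measurable_fun setT (P k).
  apply: (@measurable_prod_Rn R n (fun i =>
    norm_section (e k ^+ 2) (box_itv (c i) (d i) k))) => i.
  exact: measurable_norm_section.
have P1 k x : `|P k x| <= 1.
  rewrite /P normr_prod; apply: prodr_ile1 => i _.
  by have /andP[h1 h2] := norm_section_le1 (tnth x i) (e20 k) (mA i k); rewrite ger0_norm// h1.
have intP k := integrable_bounded_mul (mP k) (P1 k) intH.
have PH k : \int[mu]_x (P k x * H x) = 0.
  have Aoo i : (leb (box_itv (c i) (d i) k) < +oo)%E.
    by rewrite /box_itv lebesgue_measure_itv; case: ifP => _; rewrite ?ltry//= -EFinD ltry.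
  have := box_gauss_eq0 (e20 k) (mA^~ k) Aoo.
  have sk : e k ^+ 2 * kappa != 0 by rewrite mulf_neq0 ?gt_eqF ?kappa_gt0.
  rewrite (_ : (fun x => _) = fun x => (e k ^+ 2 * kappa) ^+ n * (P k x * H x)); last first.
    apply/funext => x; rewrite mulrA; congr (_ * _).
    rewrite /P /norm_section big_split/= prodr_const card_ord mulrA -exprMn mulfV//.
    by rewrite expr1n mul1r.
  rewrite (RintegralZl _ measurableT (intP k)) => /eqP.
  by rewrite mulf_eq0 expf_eq0 (negbTE sk) andbF => /eqP.
rewrite integral_indicM.
pose F k (x : Rn R n) : \bar R := (P k x * H x)%:E.
pose G (x : Rn R n) : \bar R := ((\1_(box c d) x)%:E * (H x)%:E)%E.
have mF k : measurable_fun setT (F k) by exact: measurable_int (intP k).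
have mG : measurable_fun setT G.
  apply: measurable_mule; last exact: measurable_int intH.
  by apply/measurable_EFinP; exact: measurable_indic.
have FG x : F k x @[k --> \oo] --> G x.
  apply: cvg_EFin; first by apply: nearW.
  rewrite [X in _ --> X](_ : _ =
      \prod_(i < n) \1_(`]c i, d i]%classic : set R) (tnth x i) * H x); last first.
    congr (_ * _); rewrite indicE.
    case: (asboolP (forall i, `]c i, d i]%classic (tnth x i : R))) => h.
      by rewrite mem_set// big1// => i _; rewrite indicE mem_set.
    rewrite memNset//; apply/esym/eqP/prodf_eq0.
    have /existsNP[i hi] := h; exists i => //.
    by rewrite indicE memNset.
  apply: (@cvgM _ _ _ _ _ _ _ _); last exact: cvg_cst.
  apply: cvg_prod => i; exact: cvg_norm_section.
have iaH : mu.-integrable setT (fun x => `|(H x)%:E|%E) by exact: integrable_abse.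
have Fle k x : (`|F k x| <= `|(H x)%:E|)%E.
  by rewrite /F /= lee_fin normrM ler_piMl.
have [_ _ lim_F] := dominated_convergence measurableT mF mG
  (aeW _ (fun t _ => FG t)) iaH (aeW _ (fun t k _ => Fle k t)).
have F0 k : (\int[mu]_x F k x = 0)%E.
  by rewrite -[LHS]fineK; [congr EFin; exact: PH|exact: integrable_fin_num (intP k)].
apply: (cvg_unique _ lim_F) => //.
rewrite (_ : [sequence _]_n = cst 0%E); first exact: cvg_cst.
by apply/funext => k; exact: F0.
Qed.

Let boxes : set (set (Rn R n)) := [set B | exists c d, B = box c d].

Let setI_closed_boxes : setI_closed boxes.
Proof.
move=> _ _ [c [d ->]] [c' [d' ->]].
exists (fun i => Num.max (c i) (c' i)), (fun i => Num.min (d i) (d' i)).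
apply/seteqP; split=> x.
  move=> [h1 h2] i; have := h1 i; have := h2 i.
  by rewrite /= !in_itv/= => /andP[a1 a2] /andP[a3 a4]; rewrite gt_max le_min a1 a2 a3 a4.
move=> h; split=> i; have := h i; rewrite /= !in_itv/= gt_max le_min => /andP[/andP[a1 a2] /andP[a3 a4]].
  by rewrite a1 a3.
by rewrite a2 a4.
Qed.

Let measurable_boxes : @measurable _ (Rn R n) = <<s boxes >>.
Proof.
apply/seteqP; split; last first.
  apply: smallest_sub; first exact: sigma_algebra_measurable.
  by move=> _ [c [d ->]]; exact: measurable_box.
apply: smallest_sub; first exact: smallest_sigma_algebra.
apply: (big_ind (fun S => S `<=` <<s boxes >>)).
- by [].
- by move=> S S' hS hS' B [/hS|/hS'].
move=> i _.
have := g_sigma_preimageE [set: Rn R n] (fun x : Rn R n => tnth x i) (@ocitv R).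
rewrite /measurable /= => <-.
apply: smallest_sub; first exact: smallest_sigma_algebra.
move=> _ [_ [[a b] _ <-] <-]; rewrite setTI.
(* A condition on the coordinate [i] alone is a countable union of boxes that grow in all the other
   coordinates. *)
pose lo k j : R := if j == i then a else - k%:R.
pose hi k j : R := if j == i then b else k%:R.
rewrite (_ : _ @^-1` _ = \bigcup_k box (lo k) (hi k)).
  apply: sigma_algebra_bigcup => k.
  by apply: sub_gen_smallest; exists (lo k), (hi k).
apply/seteqP; split=> x /=.
  move=> h; pose k := (Num.bound (\sum_j `|tnth x j : R|)).
  exists k => // j; rewrite /lo /hi; case: eqVneq => [->//|_].
  rewrite /= in_itv/=.
  have h1 : `|tnth x j : R| < k%:R.
    apply: le_lt_trans (archi_boundP _); last exact: sumr_ge0.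
    by rewrite (bigD1 j)//= lerDl sumr_ge0.
  by move: h1; rewrite ltr_norml => /andP[-> /ltW ->].
by move=> [k _ /(_ i)]; rewrite /lo /hi eqxx.
Qed.

(** The Borel sets on which [H] integrates to 0 form a Dynkin class that contains the boxes, which
    are stable under intersection and generate; the whole space is the frequency xi = 0. *)
Lemma fourier_eq0_ae : {ae mu, forall x, H x = 0}.
Proof.
have H0 (E : set (Rn R n)) : measurable E -> (\int[mu]_(x in E) (H x)%:E = 0)%E.
  have HT : (\int[mu]_x (H x)%:E = 0)%E.
    have := cosH [tuple 0 | i < n].
    rewrite (_ : (fun x => _) = H); last first.
      apply/funext => x; rewrite (_ : dotv _ _ = 0) ?cos0 ?mul1r//.
      by rewrite /dotv big1// => i _; rewrite tnth_mktuple mulr0.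
    rewrite /Rintegral => h; rewrite -[LHS]fineK ?h//; exact: integrable_fin_num intH.
  move=> mE; have hE : <<s boxes >> E by rewrite -measurable_boxes.
  move: E hE {mE}.
  apply: (dynkin_induction (P := fun E => \int[mu]_(x in E) (H x)%:E = 0)%E
    measurable_boxes setI_closed_boxes HT).
  - by move=> _ [c [d ->]]; exact: integral_box_eq0.
  - move=> S mS S0; rewrite integral_indicM.
    have iS := integrable_bounded_mul (measurable_indic mS) (fun x => indic_norm_le1 S x) intH.
    have -> : (fun x => (\1_(~` S) x)%:E * (H x)%:E)%E =
        (fun x => (EFin \o H) x - (EFin \o (fun x => \1_S x * H x)%R) x)%E.
      apply/funext => x; rewrite /= -EFinB -EFinM !indicE in_setC.
      by case: (x \in S); congr EFin; rewrite /=; ring.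
    rewrite integralB//= [X in (X - _)%E]HT.
    rewrite [X in (_ - X)%E](_ : _ = 0)%E ?sube0//.
    by rewrite -S0 [RHS]integral_indicM.
  - move=> F mF tF F0; rewrite integral_bigcup//.
      by apply: eseries0 => k _ _; exact: F0.
    apply: integrableS intH => //; exact: bigcup_measurable.
have := @integral_ae_eq _ _ _ mu setT measurableT (cst 0%E) (EFin \o H) intH.
move=> h; have {h} : ae_eq mu setT (EFin \o H) (cst 0%E).
  apply: h => // E _ mE; rewrite integral0; exact: H0.
by apply: filterS => x /(_ Logic.I) /= [].
Qed.

End fourier_uniqueness.

(** * Pointwise bounds for the Bessel kernel *)

Section bessel_bounds.
Context {R : realType} {n : nat}.
Local Notation leb := (@lebesgue_measure R).
Local Notation mu := (@lebesgue_Rn R n).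
Local Notation kappa := (Num.sqrt (2 * pi) : R).
Variable a : R.
Hypothesis a_gt0 : 0 < a.

(* Enlarging the Gaussians by a factor [l] without changing their mass keeps the
   integral over R^n, and absorbs a translation in [bessel_spread_far]. *)
Definition bessel_spread (l : R) (z : Rn R n) : \bar R :=
  (\int[leb]_t (bessel_density a l (t, z))%:E)%E.

Lemma bessel_spread_ge0 l z : 0 < l -> (0 <= bessel_spread l z)%E.
Proof. by move=> l0; apply: integral_ge0 => t _; rewrite lee_fin bessel_density_ge0. Qed.

Lemma measurable_bessel_spread l : 0 < l -> measurable_fun setT (bessel_spread l).
Proof.
move=> l0.
apply: (measurable_fun_fubini_tonelli_G (fun p => (bessel_density a l p)%:E)).
  by apply/measurable_EFinP; exact: measurable_bessel_density.
by move=> p; rewrite lee_fin bessel_density_ge0.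
Qed.

Lemma bessel_spreadE l z : 0 < l -> bessel_spread l z =
  (\int[leb]_(t in `]0%R, +oo[) (bessel_weight a t * heat (l * t) z)%:E)%E.
Proof.
move=> l0; rewrite integral_indicM; apply: eq_integral => t _.
by rewrite -EFinM; congr EFin; rewrite /bessel_density /= -mulrA.
Qed.

Lemma measurable_weight_heat l (z : Rn R n) : measurable_fun setT
  (fun t : measurableTypeR R => (bessel_weight a t * heat (l * t) z)%:E).
Proof.
apply/measurable_EFinP; apply: measurable_funM; first exact: measurable_bessel_weight.
apply: (measurableT_comp (f := fun t : measurableTypeR R => heat t z)).
  exact: (measurableT_comp (@measurable_heat R n) (pair2_measurable z)).
exact: (measurable_funM (f := cst l)).
Qed.

Lemma integral_bessel_spread l : 0 < l ->
  (\int[mu]_z bessel_spread l z = (bessel_mass a)%:E)%E.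
Proof.
move=> l0.
rewrite -(@fubini_tonelli _ _ _ _ _ leb mu (fun p => (bessel_density a l p)%:E)).
- under eq_integral do rewrite integral_bessel_density//.
  by rewrite -integral_indicM bessel_massE.
- by apply/measurable_EFinP; exact: measurable_bessel_density.
- by move=> p; rewrite lee_fin bessel_density_ge0.
Qed.

Lemma enorm_subvC (x y : Rn R n) : enorm (subv x y) = enorm (subv y x).
Proof.
rewrite /enorm /dotv; congr Num.sqrt; apply: eq_bigr => i _.
by rewrite !tnth_mktuple; ring.
Qed.

Lemma bessel_spread_subvC l (x y : Rn R n) :
  bessel_spread l (subv x y) = bessel_spread l (subv y x).
Proof.
by apply: eq_integral => t _; rewrite /bessel_density/= !heatE enorm_subvC.
Qed.

Lemma integral_bessel_spread_subv l (x : Rn R n) : 0 < l ->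
  (\int[mu]_y bessel_spread l (subv x y) = (bessel_mass a)%:E)%E.
Proof.
move=> l0; rewrite ge0_integral_subv ?integral_bessel_spread//.
- exact: measurable_bessel_spread.
- by move=> y; exact: bessel_spread_ge0.
Qed.

Lemma ae_subv (x : Rn R n) (P : Rn R n -> Prop) :
  {ae mu, forall z, P z} -> {ae mu, forall y, P (subv x y)}.
Proof.
move=> [N [mN N0 PN]]; exists (subv x @^-1` N); split.
- by rewrite -[X in measurable X]setTI; exact: measurable_subv.
- have mN' : measurable_fun setT (fun z : Rn R n => (\1_N z : R)%:E).
    by apply/measurable_EFinP; exact: measurable_indic.
  have N0' (z : Rn R n) : (0 <= (\1_N z : R)%:E)%E by [].
  have := ge0_integral_subv x mN' N0'.
  rewrite (integral_indic mu measurableT mN) setIT => h.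
  have {}h : (\int[mu]_y (\1_N (subv x y) : R)%:E = 0)%E by rewrite h; exact: N0.
  rewrite -[LHS](_ : mu (subv x @^-1` N `&` setT) = _); last by rewrite setIT.
  rewrite -(integral_indic mu measurableT)//.
  by rewrite -[X in measurable X]setTI; exact: measurable_subv.
- by move=> y Py; apply: PN.
Qed.

(** The kernel selected by [xget] and the subordination integral have the same transform, so their
    difference falls under [fourier_eq0_ae]. *)
Lemma bessel_kernel_ae : {ae mu, forall z,
  (bessel_kernel a z)%:E = ((bessel_mass a)^-1%:E * bessel_spread 1 z)%E}.
Proof.
have [ik fk] := @bessel_kernel_spec R n a a_gt0.
have ig := @integrable_bessel_gauss R n a a_gt0.
pose H (z : Rn R n) := bessel_kernel a z - bessel_gauss a z.
have intH : mu.-integrable setT (EFin \o H) by exact: (integrableB measurableT ik ig).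
have fE xi : fourier (bessel_kernel a) xi = fourier (@bessel_gauss R n a) xi.
  by rewrite fk fourier_bessel_gauss.
have tH (b : R -> R) xi : measurable_fun [set: measurableTypeR R] b -> (forall t, `|b t| <= 1) ->
    \int[mu]_x (b (dotv x xi) * bessel_kernel a x) = \int[mu]_x (b (dotv x xi) * bessel_gauss a x) ->
    \int[mu]_x (b (dotv x xi) * H x) = 0.
  move=> mb b1 h.
  have mbd : measurable_fun setT (fun z : Rn R n => b (dotv z xi)).
    exact: (measurableT_comp mb (measurable_dotv xi)).
  have i1 := integrable_bounded_mul mbd (fun _ => b1 _) ik.
  have i2 := integrable_bounded_mul mbd (fun _ => b1 _) ig.
  under eq_Rintegral do rewrite /H mulrBr.
  by rewrite RintegralB//= h subrr.
have cosH xi : \int[mu]_x (cos (dotv x xi) * H x) = 0.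
  apply: (tH (@cos R)); [exact: measurable_cos|exact: norm_cos_le1|].
  by have [] := fE xi.
have sinH xi : \int[mu]_x (sin (dotv x xi) * H x) = 0.
  apply: (tH (@sin R)); [exact: measurable_sin|exact: norm_sin_le1|].
  by have [_ /oppr_inj] := fE xi.
have h1 := fourier_eq0_ae intH cosH sinH.
have h2 := @ae_fubini_density _ _ _ _ _ leb mu _ (measurable_bessel_density a 1)
  (fun p => bessel_density_ge0 a p ltr01) (bessel_density_lty a_gt0 ltr01).
apply: filterS2 h1 h2 => z /eqP; rewrite subr_eq0 => /eqP -> h.
by rewrite /bessel_gauss EFinM h.
Qed.

Lemma bessel_potentialE (f : Rn R n -> \bar R) x :
  measurable_fun setT f -> (forall y, (0 <= f y)%E) ->
  (bessel_potential a f x =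
   (bessel_mass a)^-1%:E * \int[mu]_y (bessel_spread 1 (subv x y) * f y))%E.
Proof.
move=> mf f0.
have ms : measurable_fun setT (fun y => bessel_spread 1 (subv x y)).
  exact: (measurableT_comp (measurable_bessel_spread ltr01) (measurable_subv x)).
have s0 y : (0 <= bessel_spread 1 (subv x y))%E by exact: bessel_spread_ge0.
rewrite -integralZl_ge0; last 3 first.
- by rewrite lee_fin invr_ge0 ltW// bessel_mass_gt0.
- exact: measurable_mule.
- by move=> y; rewrite mule_ge0.
have [ik _] := @bessel_kernel_spec R n a a_gt0.
apply: ae_eq_integral => //.
- apply: measurable_mule => //.
  exact: (measurableT_comp (measurable_int _ ik) (measurable_subv x)).
- by apply: measurable_mule => //; exact: measurable_mule.
- have := ae_subv x bessel_kernel_ae; apply: filterS => y -> _.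
  by rewrite muleA.
Qed.

Let theta : R := 2 `^ (- a) * 2 ^+ n.

Let powR_half k : (2^-1 ^+ k : R) `^ a = (2 `^ (- a)) ^+ k.
Proof.
have -> : 2^-1 ^+ k = 2 `^ (- k%:R) :> R by rewrite powRN powR_mulrn// exprVn.
by rewrite -powRrM -powR_mulrn ?powR_ge0// -powRrM; congr (_ `^ _); ring.
Qed.

(** The times t in ]2^-(k+1), 2^-k] produce the term [k]: for [y] in [grid_rel 1 k.+2 x] the
    distance |x - y| is at most a multiple of t, so the Gaussian of width t is bounded below by a
    multiple of t^-n. These time intervals are disjoint. *)
Lemma bessel_spread_lower : exists2 c : R, 0 < c & forall x y : Rn R n,
  (c%:E * \sum_(0 <= k <oo) ((theta ^+ k)%:E * (\1_(grid_rel 1 k.+2 x) y)%:E) <=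
   bessel_spread 1 (subv x y))%E.
Proof.
(* With u = 2^-k and t in ]u/2, u]: 2^-a and the next 1/2 come from t > u/2 and from the length u/2,
   [kappa] from the normalization, and the exponent from t^2/2 <= 1/2 and |x - y|^2 / (2 t^2) <= 4 n
   u^2 / (u^2 / 2) = 8 n. *)
pose c : R := 2^-1 `^ a / 2 * kappa ^- n * expR (- (2^-1 + 8 * n%:R)).
have k0 := @kappa_gt0 R.
have c0 : 0 < c by rewrite !mulr_gt0 ?powR_gt0 ?expR_gt0 ?invr_gt0 ?exprn_gt0.
exists c => // x y.
rewrite -nneseriesZl; last by move=> k _; rewrite mule_ge0// lee_fin exprn_ge0// mulr_ge0// powR_ge0.
pose u k : R := 2^-1 ^+ k.
have u0 k : 0 < u k by rewrite exprn_gt0.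
pose I k : set (measurableTypeR R) := [set` `]u k.+1, u k]%R].
have mI k : measurable (I k) by exact: measurable_itv.
have uS k : u k.+1 = u k / 2 by rewrite /u exprSr.
have u_le i j : (i <= j)%N -> u j <= u i by move=> ij; rewrite ler_wiXn2l//; lra.
have tI : trivIset setT I.
  apply/trivIsetP => i j _ _; wlog ij : i j / (i < j)%N.
    move=> h; rewrite neq_lt => /orP[|] ij; first by apply: h => //; rewrite ltn_eqF.
    by rewrite setIC; apply: h => //; rewrite ltn_eqF.
  move=> _; apply/seteqP; split=> t //=.
  rewrite /I /= !in_itv/= => -[/andP[h1 _] /andP[_ h2]].
  by have := lt_le_trans h1 (le_trans h2 (u_le _ _ ij)); rewrite ltxx.
rewrite bessel_spreadE//.
have md := measurable_weight_heat 1 (subv x y).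
have d0 (t : measurableTypeR R) : 0 < (t : R) -> (0 <= (bessel_weight a t * heat (1 * t) (subv x y))%:E)%E.
  by move=> t0; rewrite lee_fin mulr_ge0 ?bessel_weight_ge0 ?heat_ge0 ?mul1r.
have Ipos k t : I k t -> 0 < t.
  by rewrite /I /= in_itv/= => /andP[h _]; exact: lt_trans h.
apply: (@le_trans _ _ (\int[leb]_(t in \bigcup_k I k)
    (bessel_weight a t * heat (1 * t) (subv x y))%:E)%E); last first.
  apply: ge0_subset_integral => //.
  - exact: bigcup_measurable.
  - exact: measurable_funTS.
  - by move=> t; rewrite /= in_itv/= andbT; exact: d0.
  - by move=> t [k _ /Ipos]; rewrite /= in_itv/= andbT.
rewrite ge0_integral_bigcup//; last 2 first.
- exact: measurable_funTS.
- by move=> t [k _ /Ipos]; exact: d0.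
apply: lee_nneseries => [k _ _|k _].
  by rewrite !mule_ge0// lee_fin ?(ltW c0)// exprn_ge0// mulr_ge0// powR_ge0.
have [/set_mem xy|xy] := boolP (y \in grid_rel 1 k.+2 x); last first.
  rewrite indicE (negbTE xy) mule0 mule0.
  by apply: integral_ge0 => t /Ipos; exact: d0.
rewrite indicE mem_set// mule1.
have zi i : `|tnth (subv x y) i : R| <= 2 * u k.
  rewrite tnth_mktuple; have [h1 h2] := xy i.
  have -> : 2 * u k = 8 / 2 ^+ k.+2.
    rewrite /u exprVn !exprS; have : 2 ^+ k != 0 :> R by rewrite expf_neq0.
    by move: (2 ^+ k) => d d0'; field; rewrite d0'.
  exact: cell_dist.
have z2 : enorm (subv x y) ^+ 2 <= 4 * n%:R * u k ^+ 2.
  rewrite sqr_sqrtr; last by apply: sumr_ge0 => j _; rewrite -expr2 sqr_ge0.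
  apply: (@le_trans _ _ (\sum_(i < n) (2 * u k) ^+ 2)).
    apply: ler_sum => i _; rewrite -expr2 -real_normK ?num_real//.
    by rewrite lerXn2r ?nnegrE// mulr_ge0// ltW.
  by rewrite sumr_const card_ord -mulr_natl exprMn; lra.
pose b : R := (u k / 2) `^ a / u k * ((u k * kappa) ^- n * expR (- (2^-1 + 8 * n%:R))).
have bI : (b * (u k / 2) = c * theta ^+ k)%R.
  have uk : u k != 0 by rewrite gt_eqF.
  have kn : kappa ^+ n != 0 by rewrite expf_neq0// gt_eqF.
  have un : u k ^- n = (2 ^+ n) ^+ k by rewrite /u !exprVn invrK -!exprM mulnC.
  have thk : theta ^+ k = u k `^ a * u k ^- n by rewrite /theta exprMn un powR_half.
  rewrite /b /c thk powRM ?(ltW (u0 k))// [(_ * kappa) ^+ n]exprMn.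
  have : u k ^+ n != 0 by rewrite expf_neq0.
  move: (u k `^ a) (2^-1 `^ a) (expR _) (u k ^+ n) (kappa ^+ n) kn => p1 p2 p3 p4 p5 kn p40.
  by field; rewrite uk p40 kn.
rewrite -EFinM -bI EFinM.
have -> : (u k / 2)%:E = leb (I k).
  rewrite /I lebesgue_measure_itv/= lte_fin uS ifT; last by have := u0 k; lra.
  by rewrite -EFinD; congr EFin; lra.
rewrite -[X in (X <= _)%E](integral_cst leb (mI k)).
apply: ge0_le_integral => //.
- move=> t _; rewrite /= lee_fin /b !mulr_ge0 ?invr_ge0 ?powR_ge0 ?expR_ge0 ?(ltW (u0 _))//.
  by rewrite exprn_ge0// mulr_ge0 ?ltW.
- exact: measurable_funTS.
move=> t /[dup] /Ipos t0; rewrite /I /= in_itv/= uS => /andP[ut tu].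
rewrite lee_fin mul1r heatE /b /bessel_weight.
have t1 : t <= 1 by apply: le_trans tu _; have := u_le 0%N k isT; rewrite /u expr0.
have t2 : t ^+ 2 <= 1 by rewrite exprn_ile1// ltW.
have e1 : expR (- (2^-1 + 8 * n%:R)) <= gauss 1 t * gauss t (enorm (subv x y)).
  rewrite /gauss -expRD ler_expR -opprD lerN2 expr1n mulr1 lerD//.
    by lra.
  rewrite ler_pdivrMr ?mulr_gt0 ?exprn_gt0//; apply: le_trans z2 _.
  have : (u k / 2) ^+ 2 <= t ^+ 2 by rewrite lerXn2r ?nnegrE ?(ltW t0)// ?(ltW ut)// divr_ge0// ltW.
  rewrite expr_div_n => h; have := ler_wpM2l (ler0n R n) h; lra.
have e2 : (u k / 2) `^ a / u k <= t `^ (a - 1).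
  rewrite powRB ?(gt_eqF t0) ?implybT// powRr1 ?(ltW t0)// ler_pM ?powR_ge0 ?invr_ge0 ?(ltW (u0 k))//.
    by apply: ge0_ler_powR; rewrite ?nnegrE ?(ltW a_gt0) ?(ltW t0) ?(ltW ut)// divr_ge0// ltW.
  by rewrite lef_pV2 ?posrE.
have e3 : (u k * kappa) ^- n <= (t * kappa) ^- n.
  rewrite lef_pV2 ?posrE ?exprn_gt0 ?mulr_gt0// lerXn2r ?nnegrE ?mulr_ge0 ?(ltW k0) ?(ltW t0) ?(ltW (u0 k))//.
  by rewrite ler_pM2r.
rewrite -[X in _ <= X]mulrA [X in _ <= _ * X]mulrCA.
apply: ler_pM => //.
- by rewrite divr_ge0 ?powR_ge0 ?(ltW (u0 k)).
- by rewrite mulr_ge0 ?expR_ge0// invr_ge0 exprn_ge0// mulr_ge0 ?ltW.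
- by apply: ler_pM => //; rewrite ?expR_ge0// invr_ge0 exprn_ge0// mulr_ge0 ?ltW.
Qed.

(** The integral is split at t = r = |z|. For t <= r the decay of the Gaussian beats t^-n and leaves
    r^-n times the integral of t^(a-1); for t > r the Gaussian is bounded by its maximum, and
    t^(a-1-n) is integrable at infinity because a < n. Both parts have order r^(a-n). *)
Lemma bessel_spread_near : a < n%:R -> exists2 C : R, 0 < C & forall z : Rn R n,
  0 < enorm z -> (bessel_spread 1 z <= (C * enorm z `^ (a - n%:R))%:E)%E.
Proof.
move=> an; have k0 := @kappa_gt0 R.
have nn : (0 < n%:R :> R) by exact: lt_trans an.
pose K : R := n%:R ^+ n * expR 2^-1.
have K0 : 0 < K by rewrite mulr_gt0 ?expR_gt0// exprn_gt0.
exists (K * kappa ^- n * a^-1 + kappa ^- n * (n%:R - a)^-1).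
  by rewrite addr_gt0// !mulr_gt0// ?invr_gt0 ?exprn_gt0// ?subr_gt0.
move=> z; set r := enorm z => r0.
rewrite bessel_spreadE//.
pose I : set (measurableTypeR R) := [set` `]0, r]%R].
pose J : set (measurableTypeR R) := [set` `]r, +oo[%R].
pose J' : set (measurableTypeR R) := [set` `[r, +oo[%R].
have [mI mJ mJ'] : [/\ measurable I, measurable J & measurable J'].
  by split; exact: measurable_itv.
have IJ : `]0%R, +oo[%classic = I `|` J.
  apply/seteqP; split=> t; rewrite /I /J /= !in_itv/= !andbT.
    by move=> t0; have [|] := leP t r; [left; rewrite t0|right].
  by case=> [/andP[]//|]; exact: lt_trans.
have md := measurable_weight_heat 1 z.
have d0 (t : measurableTypeR R) : 0 < (t : R) -> (0 <= (bessel_weight a t * heat (1 * t) z)%:E)%E.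
  by move=> t0; rewrite lee_fin mulr_ge0 ?bessel_weight_ge0 ?heat_ge0 ?mul1r.
have Ipos t : I t -> 0 < t by rewrite /I /= in_itv/= => /andP[].
have Jpos t : J t -> 0 < t by rewrite /J /= in_itv/= andbT; exact: lt_trans.
have J'pos t : J' t -> 0 < t by rewrite /J' /= in_itv/= andbT; exact: lt_le_trans.
have mp c (b : R) : measurable_fun setT (fun t : measurableTypeR R => (c * t `^ b)%:E).
  by apply/measurable_EFinP; apply: measurable_funM => //; exact: measurable_powR.
have rE : r `^ (a - n%:R) = r ^- n * r `^ a.
  by rewrite powRB ?(gt_eqF r0) ?implybT// powR_mulrn ?(ltW r0)// mulrC.
rewrite IJ ge0_integral_setU//; last 3 first.
- exact: measurable_funTS.
- by move=> t [/Ipos|/Jpos]; exact: d0.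
- apply/disj_setPS => t; rewrite /I /J /= !in_itv/= andbT => -[/andP[_ t1] t2].
  by have := le_lt_trans t1 t2; rewrite ltxx.
rewrite mulrDl EFinD; apply: leeD.
- apply: (@le_trans _ _ (\int[leb]_(t in I) ((K * kappa ^- n * r ^- n)%:E * (t `^ (a - 1))%:E))%E).
    apply: ge0_le_integral => //.
    + by move=> t /Ipos; exact: d0.
    + exact: measurable_funTS.
    + by apply: measurable_funTS; under eq_fun do rewrite -EFinM; exact: mp.
    move=> t /Ipos t0; rewrite -EFinM lee_fin mul1r /bessel_weight heatE -/r.
    rewrite -mulrA [leRHS]mulrC ler_wpM2l ?powR_ge0//.
    apply: (@le_trans _ _ ((t * kappa) ^- n * gauss t r)).
      rewrite -[leRHS]mul1r ler_wpM2r ?gauss_le1// mulr_ge0 ?gauss_ge0//.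
      by rewrite invr_ge0 exprn_ge0// mulr_ge0 ?ltW.
    have w0 : 0 <= r / t by rewrite divr_ge0 ?ltW.
    have h1 := expr_le_expR n w0.
    have h2 : expR (r / t) * gauss t r <= expR 2^-1.
      rewrite /gauss -expRD ler_expR.
      rewrite (_ : r ^+ 2 / (2 * t ^+ 2) = (r / t) ^+ 2 / 2); last by field; rewrite gt_eqF.
      by have := sqr_ge0 (r / t - 1); lra.
    have h3 : (r / t) ^+ n * gauss t r <= K.
      apply: le_trans (ler_wpM2r (gauss_ge0 _ _) h1) _.
      by rewrite -mulrA ler_wpM2l// exprn_ge0.
    have -> : (t * kappa) ^- n * gauss t r = (kappa ^- n * r ^- n) * ((r / t) ^+ n * gauss t r).
      rewrite expr_div_n [(t * kappa) ^+ n]exprMn.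
      have : r ^+ n != 0 by rewrite expf_neq0// gt_eqF.
      have : t ^+ n != 0 by rewrite expf_neq0// gt_eqF.
      have : kappa ^+ n != 0 by rewrite expf_neq0// gt_eqF.
      move: (r ^+ n) (t ^+ n) (kappa ^+ n) => p1 p2 p3 q3 q2 q1.
      by field; rewrite q1 q2 q3.
    rewrite [leRHS](_ : _ = kappa ^- n * r ^- n * K); last by ring.
    by rewrite ler_wpM2l// mulr_ge0// invr_ge0 exprn_ge0// ltW.
  have c0 : 0 <= K * kappa ^- n * r ^- n.
    by rewrite !mulr_ge0 ?invr_ge0 ?exprn_ge0 ?(ltW r0) ?(ltW k0) ?(ltW K0).
  rewrite ge0_integralZl//; first last.
  + by move=> t _; rewrite lee_fin powR_ge0.
  + by apply: measurable_funTS; apply/measurable_EFinP; exact: measurable_powR.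
  apply: (@le_trans _ _ ((K * kappa ^- n * r ^- n)%:E * (a^-1 * r `^ a)%:E)%E).
    by rewrite lee_wpmul2l ?lee_fin//; exact: integral_powR_le.
  by rewrite -EFinM lee_fin rE le_eqVlt; apply/orP; left; apply/eqP; ring.
- apply: (@le_trans _ _ (\int[leb]_(t in J') ((kappa ^- n)%:E * (t `^ (- (n%:R - a) - 1))%:E))%E).
    apply: (@le_trans _ _ (\int[leb]_(t in J) ((kappa ^- n)%:E * (t `^ (- (n%:R - a) - 1))%:E))%E).
      apply: ge0_le_integral => //.
      + by move=> t /Jpos; exact: d0.
      + exact: measurable_funTS.
      + by apply: measurable_funTS; under eq_fun do rewrite -EFinM; exact: mp.
      move=> t /Jpos t0; rewrite -EFinM lee_fin mul1r /bessel_weight heatE.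
      rewrite (_ : - (n%:R - a) - 1 = (a - 1) - n%:R); last by ring.
      rewrite [t `^ (_ - n%:R)]powRB ?(gt_eqF t0) ?implybT// powR_mulrn ?(ltW t0)//.
      rewrite exprMn invfM.
      apply: (@le_trans _ _ (t `^ (a - 1) * 1 * (t ^- n * kappa ^- n * 1))).
        have p1 : 0 <= t ^- n * kappa ^- n by rewrite mulr_ge0// invr_ge0 exprn_ge0 ?(ltW k0)// ltW.
        apply: ler_pM.
        + by rewrite mulr_ge0 ?powR_ge0 ?gauss_ge0.
        + exact: mulr_ge0 p1 (gauss_ge0 _ _).
        + by rewrite ler_wpM2l ?powR_ge0 ?gauss_le1.
        + by rewrite ler_wpM2l ?gauss_le1.
      by rewrite le_eqVlt; apply/orP; left; apply/eqP; ring.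
    apply: ge0_subset_integral => //.
    + by apply: measurable_funTS; under eq_fun do rewrite -EFinM; exact: mp.
    + by move=> t _; rewrite -EFinM lee_fin mulr_ge0 ?powR_ge0// invr_ge0 exprn_ge0// ltW.
    + by move=> t; rewrite /J /J' /= !in_itv/= !andbT => /ltW.
  rewrite ge0_integralZl//; first last.
  + by move=> t _; rewrite lee_fin powR_ge0.
  + by apply: measurable_funTS; apply/measurable_EFinP; exact: measurable_powR.
  rewrite integral_powR_tail ?subr_gt0// -EFinM lee_fin opprB.
  by rewrite mulrA.
Qed.

(** Since |w| / (l t) <= |z| / t, the exponential of width l t at [w] is at least that of width t at
    [z]; l^n makes up for the normalizations. *)
Lemma bessel_spread_far l (z w : Rn R n) : 0 < l -> enorm w <= l * enorm z ->
  (bessel_spread 1 z <= (l ^+ n)%:E * bessel_spread l w)%E.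
Proof.
move=> l0 wz; have k0 := @kappa_gt0 R.
have ln0 : 0 <= l ^+ n by rewrite exprn_ge0// ltW.
rewrite !bessel_spreadE// -ge0_integralZl//; last 2 first.
- by apply: measurable_funTS; exact: measurable_weight_heat.
- move=> t; rewrite /= in_itv/= andbT => t0.
  by rewrite lee_fin mulr_ge0 ?bessel_weight_ge0 ?heat_ge0 ?mulr_gt0.
apply: ge0_le_integral => //.
- move=> t; rewrite /= in_itv/= andbT => t0.
  by rewrite lee_fin mulr_ge0 ?bessel_weight_ge0 ?heat_ge0 ?mul1r.
- by apply: measurable_funTS; exact: measurable_weight_heat.
- apply: measurable_funTS; apply: measurable_mule => //; exact: measurable_weight_heat.
move=> t; rewrite /= in_itv/= andbT => t0.
rewrite -EFinM lee_fin mulrCA ler_wpM2l ?bessel_weight_ge0// mul1r !heatE.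
have -> : (t * kappa) ^- n = l ^+ n * (l * t * kappa) ^- n.
  rewrite -mulrA [(l * _) ^+ n]exprMn invfM mulrA mulfV ?mul1r//.
  by rewrite expf_neq0// gt_eqF.
rewrite -[X in X <= _]mulrA ler_wpM2l// ler_wpM2l//.
  by rewrite invr_ge0 exprn_ge0// !mulr_ge0// ltW.
rewrite /gauss ler_expR lerN2 exprMn.
have -> : enorm z ^+ 2 / (2 * t ^+ 2) = (l * enorm z) ^+ 2 / (2 * (l ^+ 2 * t ^+ 2)).
  by field; rewrite !gt_eqF.
have q0 : 0 <= 2 * (l ^+ 2 * t ^+ 2).
  exact: mulr_ge0 (ler0n _ 2) (mulr_ge0 (sqr_ge0 l) (sqr_ge0 t)).
rewrite ler_wpM2r ?invr_ge0//.
have lz : 0 <= l * enorm z := mulr_ge0 (ltW l0) (sqrtr_ge0 _).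
by rewrite lerXn2r// nnegrE sqrtr_ge0.
Qed.

End bessel_bounds.

(** * The Bessel capacity *)

Section bessel_dyadic.
Context {R : realType} {n : nat}.
Local Notation leb := (@lebesgue_measure R).
Local Notation mu := (@lebesgue_Rn R n).
Variable a : R.
Hypothesis n_gt0 : (0 < n)%N.
Hypothesis a_gt0 : 0 < a.
Hypothesis a_lt : a < n%:R.

Let B : R := 3 ^+ n.
Let D : R := 2 ^+ n.
Let W : R := 4 ^+ n.
Let rho : R := 2 `^ (- a).
Let theta : R := rho * D.
Local Notation Nb k := (@grid_rel R n 1 k).
Local Notation Qb k := (@grid_rel R n 0 k).
Local Notation gpot := (pot mu (fun k => Nb k) W D B rho).
Local Notation gavg := (avg mu (fun k => Nb k) W D B).

Let B_gt0 : 0 < B. Proof. by rewrite exprn_gt0. Qed.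
Let D_gt0 : 0 < D. Proof. by rewrite exprn_gt0. Qed.
Let W_gt0 : 0 < W. Proof. by rewrite exprn_gt0. Qed.
Let rho_gt0 : 0 < rho. Proof. by rewrite powR_gt0. Qed.
Let theta_gt0 : 0 < theta. Proof. by rewrite mulr_gt0. Qed.
Let D_ge1 : 1 <= D. Proof. by rewrite exprn_ege1// ler1n. Qed.
Let B_ge1 : 1 <= B. Proof. by rewrite exprn_ege1// ler1n. Qed.

Let mu_grid (c : int) k x : 0 <= c ->
  mu (grid_rel c k x) = ((2 * c + 1)%:~R ^+ n * (W / D ^+ k))%:E.
Proof.
move=> c0; rewrite measure_grid// exprMn expr_div_n; congr (_ * (_ / _))%:E.
by rewrite /D -!exprM mulnC.
Qed.

Let mu_Q k x : mu (Qb k x) = (W / D ^+ k)%:E.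
Proof. by rewrite mu_grid// mulr0 add0r expr1n mul1r. Qed.

Let mu_N k x : mu (Nb k x) = (B * (W / D ^+ k))%:E.
Proof. by rewrite mu_grid. Qed.

Let mN k : measurable [set z : Rn R n * Rn R n | Nb k z.1 z.2].
Proof. exact: measurable_grid. Qed.

Let mQ k : measurable [set z : Rn R n * Rn R n | Qb k z.1 z.2].
Proof. exact: measurable_grid. Qed.

Lemma nneseriesZr_ge0 (u : nat -> \bar R) (x : \bar R) :
  (forall k, (0 <= u k)%E) -> (0 <= x)%E ->
  (\sum_(0 <= k <oo) (u k * x) = (\sum_(0 <= k <oo) u k) * x)%E.
Proof.
move=> u0; case: x => [r r0| _|//].
  under eq_eseriesr do rewrite muleC.
  by rewrite nneseriesZl ?(muleC _ r%:E).
have [h|/existsNP[k /eqP k0]] := pselect (forall k, u k = 0%E).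
  by rewrite !eseries0 ?mul0e// => k _ _; rewrite h ?mul0e.
have uk : (0 < u k)%E by rewrite lt_def k0 u0.
have ge_term (v : nat -> \bar R) : (forall k, (0 <= v k)%E) -> (v k <= \sum_(0 <= k <oo) v k)%E.
  move=> v0; apply: le_trans (nneseries_lim_ge k.+1 _) => //.
  by rewrite big_nat_recr//= leeDr// sume_ge0.
rewrite gt0_muley; last exact: lt_le_trans uk (ge_term _ u0).
apply/eqP; rewrite -leye_eq.
have := ge_term (fun k => (u k * +oo)%E) (fun k => ltac:(by rewrite mule_ge0)).
by rewrite gt0_muley.
Qed.

(** theta^k is 2^(-a k) divided by the measure 2^(-n k) of one cell, not of the whole neighbourhood;
    this accounts for the factor [B] in [gpotE]. *)
Definition grid_kernel (x y : Rn R n) : \bar R :=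
  (\sum_(0 <= k <oo) ((theta ^+ k)%:E * (\1_(Nb k.+2 x) y)%:E))%E.

Let kterm_ge0 k x y : (0 <= (theta ^+ k)%:E * (\1_(Nb k.+2 x) y)%:E)%E.
Proof. by rewrite mule_ge0// lee_fin exprn_ge0// ltW. Qed.

Let mterm k x : measurable_fun setT (fun y : Rn R n => ((theta ^+ k)%:E * (\1_(Nb k.+2 x) y)%:E)%E).
Proof.
apply: measurable_mule => //; apply/measurable_EFinP; apply: measurable_indic.
exact: (measurable_rel (mN _)).
Qed.

Lemma grid_kernel_ge0 x y : (0 <= grid_kernel x y)%E.
Proof. by apply: nneseries_ge0 => k _ _; exact: kterm_ge0. Qed.

Lemma measurable_grid_kernel x : measurable_fun setT (grid_kernel x).
Proof.
by apply: (@ge0_emeasurable_sum _ _ _ setT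
  (fun k y => ((theta ^+ k)%:E * (\1_(Nb k.+2 x) y)%:E)%E) xpredT).
Qed.

Lemma gpotE f x : measurable_fun setT f -> (forall y, (0 <= f y)%E) ->
  (B%:E * gpot f x = \int[mu]_y (grid_kernel x y * f y))%E.
Proof.
move=> mf f0.
have termE k : (\int[mu]_y ((theta ^+ k)%:E * (\1_(Nb k.+2 x) y)%:E * f y) =
    B%:E * ((rho ^+ k)%:E * gavg k.+2 f x))%E.
  under eq_integral do rewrite -muleA.
  rewrite integralZl_ge0 ?lee_fin ?exprn_ge0 ?(ltW theta_gt0)//; last 2 first.
  - apply: measurable_mule => //; apply/measurable_EFinP; apply: measurable_indic.
    exact: (measurable_rel (mN _)).
  - by move=> y; rewrite mule_ge0.
  rewrite avgE /mass !muleA -!EFinM; congr (_%:E * _)%E.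
  rewrite /theta exprMn.
  have DW : W = D ^+ 2 by rewrite /W /D exprAC; congr (_ ^+ n); ring.
  rewrite DW !exprS; have := gt_eqF D_gt0; have : D ^+ k != 0 by rewrite expf_neq0// gt_eqF.
  have B0 : B != 0 by rewrite gt_eqF.
  move: (D ^+ k) (rho ^+ k) => d r d0 D0; rewrite expr0 mulr1.
  by field; rewrite B0 d0 D0.
rewrite /pot -nneseriesZl; last first.
  move=> k _; rewrite mule_ge0 ?lee_fin ?exprn_ge0 ?(ltW rho_gt0)//.
  by rewrite avgE mule_ge0 ?mass_ge0// lee_fin invr_ge0 !mulr_ge0 ?invr_ge0 ?exprn_ge0 ?ltW.
under eq_integral do rewrite /grid_kernel -nneseriesZr_ge0//.
rewrite integral_nneseries//.
- by apply: eq_eseriesr => k _; rewrite termE.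
- by move=> k; apply: measurable_mule.
- by move=> k y _; rewrite mule_ge0.
Qed.

Lemma gpot_le_potential : exists2 c : R, 0 < c & forall f x,
  measurable_fun setT f -> (forall y, (0 <= f y)%E) ->
  (c%:E * gpot f x <= bessel_potential a f x)%E.
Proof.
have [c c0 hc] := @bessel_spread_lower R n a a_gt0.
have M0 := bessel_mass_gt0 a_gt0.
exists ((bessel_mass a)^-1 * c * B); first by rewrite !mulr_gt0// invr_gt0.
move=> f x mf f0; rewrite bessel_potentialE// EFinM -muleA gpotE// EFinM -muleA.
rewrite lee_wpmul2l ?lee_fin ?invr_ge0 ?(ltW M0)//.
rewrite -integralZl_ge0 ?lee_fin ?(ltW c0)//; last 2 first.
- by apply: measurable_mule => //; exact: measurable_grid_kernel.
- by move=> y; rewrite mule_ge0 ?grid_kernel_ge0.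
apply: le_integral_nonmeas => y _.
  by rewrite !mule_ge0 ?grid_kernel_ge0 ?lee_fin ?(ltW c0).
by rewrite muleA lee_wpmul2r//; exact: hc.
Qed.

Let spread_conv l (f : Rn R n -> \bar R) (w : Rn R n) : \bar R :=
  (\int[mu]_y (bessel_spread a l (subv w y) * f y))%E.

Let spread_conv_ge0 l f w : 0 < l -> (forall y, (0 <= f y)%E) -> (0 <= spread_conv l f w)%E.
Proof. by move=> l0 f0; apply: integral_ge0 => y _; rewrite mule_ge0 ?bessel_spread_ge0. Qed.

Let mpair l f : 0 < l -> measurable_fun setT f ->
  measurable_fun setT (fun p : Rn R n * Rn R n => (bessel_spread a l (subv p.1 p.2) * f p.2)%E).
Proof.
move=> l0 mf; apply: measurable_mule; last exact: measurableT_comp mf measurable_snd.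
exact: measurableT_comp (measurable_bessel_spread a l0) (@measurable_subv_pair R n).
Qed.

Let measurable_spread_conv l f : 0 < l -> measurable_fun setT f -> (forall y, (0 <= f y)%E) ->
  measurable_fun setT (spread_conv l f).
Proof.
move=> l0 mf f0.
apply: (measurable_fun_fubini_tonelli_F
  (fun p : Rn R n * Rn R n => (bessel_spread a l (subv p.1 p.2) * f p.2)%E)).
  exact: mpair.
by move=> p; rewrite mule_ge0 ?bessel_spread_ge0.
Qed.

(** Convolution with an integrable kernel on L^s: Jensen for the density
    [bessel_spread a l (subv w y)], of total mass [bessel_mass a], then Tonelli. *)
Let integral_spread_conv l (s : R) f : 0 < l -> 1 <= s -> measurable_fun setT f ->
  (forall y, (0 <= f y)%E) ->
  (\int[mu]_w spread_conv l f w `^ s <=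
   ((bessel_mass a) `^ (s - 1) * bessel_mass a)%:E * \int[mu]_y f y `^ s)%E.
Proof.
move=> l0 s1 mf f0; have M0 := bessel_mass_gt0 a_gt0.
have mfs : measurable_fun setT (fun y => f y `^ s)%E by exact: measurable_poweR_fun.
have fs0 y : (0 <= f y `^ s)%E by exact: poweR_ge0.
apply: (@le_trans _ _ (\int[mu]_w ((bessel_mass a `^ (s - 1))%:E * spread_conv l (fun y => f y `^ s) w))%E).
  apply: le_integral_nonmeas => w _; first exact: poweR_ge0.
  apply: jensen_poweR => //.
  - exact: measurableT_comp (measurable_bessel_spread a l0) (measurable_subv w).
  - by move=> y; exact: bessel_spread_ge0.
  - by rewrite integral_bessel_spread_subv.
rewrite integralZl_ge0 ?lee_fin ?powR_ge0//; last 2 first.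
- exact: measurable_spread_conv.
- by move=> w; exact: spread_conv_ge0.
rewrite EFinM -muleA lee_wpmul2l ?lee_fin ?powR_ge0//.
rewrite /spread_conv (@fubini_tonelli _ _ _ _ _ mu mu
  (fun p : Rn R n * Rn R n => (bessel_spread a l (subv p.1 p.2) * f p.2 `^ s)%E)); last 2 first.
- exact: (mpair l0 mfs).
- by move=> p; rewrite mule_ge0 ?bessel_spread_ge0 ?poweR_ge0.
rewrite -integralZl_ge0 ?lee_fin ?(ltW M0)//.
apply: le_integral_nonmeas => y _.
  by apply: integral_ge0 => w _; rewrite mule_ge0 ?bessel_spread_ge0 ?poweR_ge0.
rewrite /= [leLHS](_ : _ = \int[mu]_w (f y `^ s * bessel_spread a l (subv y w)))%E; last first.
  by apply: eq_integral => w _; rewrite muleC bessel_spread_subvC.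
rewrite integralZl_ge0//.
- by rewrite integral_bessel_spread_subv// muleC.
- exact: measurableT_comp (measurable_bessel_spread a l0) (measurable_subv y).
- by move=> w; exact: bessel_spread_ge0.
Qed.

(** Cells of generation 2 have side 1, so the coordinates of x - w are at most 2 in size and |w -
    y|^2 <= 2 r^2 + 8 n with r = |x - y|. As r > 1, this is at most (2 + 8 n) r^2, and so at most (2
    + 8 n)^2 r^2. *)
Let enorm_sub_le (x y w : Rn R n) : Nb 2 x w -> 1 < enorm (subv x y) ->
  enorm (subv w y) <= (2 + 8 * n%:R) * enorm (subv x y).
Proof.
move=> xw r1; set r := enorm (subv x y) in r1 *.
have sq (z : Rn R n) : enorm z ^+ 2 = \sum_i (tnth z i : R) ^+ 2.
  by rewrite sqr_sqrtr//; apply: sumr_ge0 => i _; rewrite -expr2 sqr_ge0.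
have h : enorm (subv w y) ^+ 2 <= 2 * r ^+ 2 + 8 * n%:R.
  rewrite /r !sq mulr_sumr (_ : 8 * n%:R = \sum_(i < n) 8); last first.
    by rewrite sumr_const card_ord mulr_natr.
  rewrite -big_split/=; apply: ler_sum => i _; rewrite !tnth_mktuple.
  have [h1 h2] := xw i; have := cell_dist h2 h1.
  rewrite (_ : 8 / 2 ^+ 2 = 2); last by field.
  move: (tnth x i : R) (tnth y i : R) (tnth w i : R) => x1 y1 w1 d.
  have d2 : (x1 - w1) ^+ 2 <= 4.
    by rewrite -real_normK ?num_real// (_ : 4 = 2 ^+ 2) ?lerXn2r ?nnegrE//; ring.
  have := sqr_ge0 (x1 - y1 + (x1 - w1)); lra.
have n0 : 0 <= n%:R :> R by [].
have r0 : 0 < r by lra.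
have l0 : 0 <= 2 + 8 * n%:R :> R by lra.
rewrite -(@ler_pXn2r _ 2)// ?nnegrE ?sqrtr_ge0 ?(mulr_ge0 l0 (ltW r0))//.
apply: le_trans h _; rewrite exprMn.
have r2 : 1 <= r ^+ 2 by rewrite exprn_ege1// ltW.
have : 2 * r ^+ 2 + 8 * n%:R <= (2 + 8 * n%:R) * r ^+ 2.
  by have := ler_wpM2l n0 r2; lra.
move/le_trans; apply; rewrite ler_wpM2r ?sqr_ge0//.
have := mulr_ge0 n0 n0; nra.
Qed.

(** A single term of [grid_kernel] is enough, at the scale 2^-k just above |x - y|, where theta^k
    has the order of |x - y|^(a-n). *)
Let spread_near : exists2 C : R, 0 < C & forall x y : Rn R n,
  0 < enorm (subv x y) <= 1 -> (bessel_spread a 1 (subv x y) <= C%:E * grid_kernel x y)%E.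
Proof.
have [C C0 hC] := @bessel_spread_near R n a a_gt0 a_lt.
exists (C * theta); first exact: mulr_gt0.
move=> x y /andP[r0 r1]; set r := enorm _ in r0 r1.
have [k /andP[kr rk]] := dyadic_scale r0 r1.
apply: le_trans (hC _ r0) _; rewrite -/r.
have xy : Nb k.+2 x y.
  move=> i; have h : `|(tnth x i : R) - tnth y i| <= 4 / 2 ^+ k.+2.
    rewrite (_ : 4 / 2 ^+ k.+2 = 2^-1 ^+ k); last first.
      rewrite exprVn !exprS; have : 2 ^+ k != 0 :> R by rewrite expf_neq0.
      by move: (2 ^+ k) => d d0; field; rewrite d0.
    by apply: le_trans rk; have := tnth_le_enorm (subv x y) i; rewrite tnth_mktuple.
  by split; apply: cell_near => //; rewrite distrC.
have thE : theta = 2 `^ (n%:R - a).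
  by rewrite /theta /rho /D powRD ?pnatr_eq0 ?implybT// powR_mulrn// mulrC.
have h : r `^ (a - n%:R) <= theta ^+ k.+1.
  rewrite -[a - _]opprB powRN thE -powR_mulrn ?powR_ge0// -powRrM mulrC powRrM powR_mulrn//.
  rewrite -[leRHS]invrK lef_pV2 ?posrE ?powR_gt0 ?invr_gt0 ?powR_gt0 ?exprn_gt0//.
  rewrite -powRN -powR_mulrn// -powRrM.
  have -> : 2 `^ (k.+1%:R * - (n%:R - a)) = (2^-1 ^+ k.+1) `^ (n%:R - a).
    by rewrite mulrN -mulNr powRrM powRN powR_mulrn// exprVn.
  by apply: ge0_ler_powR; rewrite ?nnegrE ?subr_ge0 ?exprn_ge0 ?(ltW a_lt) ?(ltW r0) ?(ltW kr).
apply: (@le_trans _ _ ((C * theta)%:E * (theta ^+ k)%:E)%E).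
  by rewrite -EFinM lee_fin -mulrA -exprS ler_wpM2l// ltW.
rewrite lee_wpmul2l ?lee_fin ?(mulr_ge0 (ltW C0) (ltW theta_gt0))//.
have -> : ((theta ^+ k)%:E = (theta ^+ k)%:E * (\1_(Nb k.+2 x) y)%:E)%E.
  by rewrite indicE mem_set// mule1.
apply: le_trans (nneseries_lim_ge k.+1 _) => //.
by rewrite big_nat_recr//= leeDr// sume_ge0.
Qed.

Let ae_neq (x : Rn R n) : {ae mu, forall y, 0 < enorm (subv x y)}.
Proof.
exists [set y : Rn R n | forall i, [set tnth x i] (tnth y i)]; split.
- rewrite (_ : mkset _ = \bigcap_(i in [set: 'I_n]) ((fun y : Rn R n => tnth y i) @^-1` [set tnth x i])).
    apply: fin_bigcap_measurable; first exact: finite_finset.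
    move=> i _; rewrite -[X in measurable X]setTI.
    by apply: (measurable_tnth_Rn i measurableT); exact: measurable_set1.
  by apply/seteqP; split=> y /= H i; [move=> _|]; exact: H.
- rewrite (@measure_box R n (fun i => [set tnth x i]) (fun=> 0)).
  + by rewrite prodr_const card_ord expr0n eqn0Ngt n_gt0.
  + by move=> i; exact: measurable_set1.
  + by move=> i; exact: lebesgue_measure_set1.
- move=> y /= /negP; rewrite -leNgt => h i.
  have := le_trans (tnth_le_enorm (subv x y) i) h; rewrite normr_le0 tnth_mktuple subr_eq0.
  by move=> /eqP.
Qed.

Let measurable_enorm_sub (x : Rn R n) : measurable_fun setT (fun y => enorm (subv x y)).
Proof.
have me : measurable_fun setT (fun z : Rn R n => enorm z).
  apply: (measurableT_comp (f := @Num.sqrt R : measurableTypeR R -> R)).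
    by apply: continuous_measurable_fun => t; exact: sqrt_continuous.
  by apply: measurable_sum => i; apply: measurable_funM; exact: measurable_tnth_Rn.
exact: measurableT_comp me (measurable_subv x).
Qed.

(** The kernel beyond distance 1 is out of reach of [grid_kernel]. There the potential of [f] at [x]
    is at most l^n g(w) for every [w] in [N 2 x], where g is the convolution of [f] with the
    enlarged Gaussians; averaging over [w] bounds it by one term of the dyadic potential of g, and
    the L^s norm of g is controlled by that of [f]. Hence [psi] is a multiple of f + g. *)
Lemma potential_le_gpot (s : R) : 1 <= s -> exists2 C : R, 0 < C & forall f,
  measurable_fun setT f -> (forall y, (0 <= f y)%E) ->
  exists2 psi : Rn R n -> \bar R, measurable_fun setT psi /\ (forall y, (0 <= psi y)%E) &
    (forall x, (bessel_potential a f x <= gpot psi x)%E) /\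
    (\int[mu]_y psi y `^ s <= C%:E * \int[mu]_y f y `^ s)%E.
Proof.
move=> s1; have [C C0 hC] := spread_near; have M0 := bessel_mass_gt0 a_gt0.
have s0 : 0 < s by lra.
pose l : R := 2 + 8 * n%:R.
have l0 : 0 < l by have : 0 <= n%:R :> R by []; rewrite /l; lra.
have ln0 : 0 < l ^+ n by rewrite exprn_gt0.
(* [C] is the loss near [x] and l^n the one far from it; [B] is the factor of [gpotE], and the mass
   normalizes the kernel. *)
pose K := (bessel_mass a)^-1 * (C + l ^+ n) * B.
have K0 : 0 < K by rewrite !mulr_gt0 ?invr_gt0 ?addr_gt0.
pose L := bessel_mass a `^ (s - 1) * bessel_mass a.
have L0 : 0 < L by rewrite mulr_gt0 ?powR_gt0.
exists (K `^ s * (2 `^ s * (1 + L))).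
  by rewrite !mulr_gt0 ?powR_gt0 ?addr_gt0.
move=> f mf f0; pose g := spread_conv l f.
have mg : measurable_fun setT g by exact: measurable_spread_conv.
have g0 y : (0 <= g y)%E by exact: spread_conv_ge0.
have mfg : measurable_fun setT (fun y => f y + g y)%E by exact: emeasurable_funD.
have fg0 y : (0 <= f y + g y)%E by rewrite adde_ge0.
exists (fun y => K%:E * (f y + g y))%E.
  split; first exact: measurable_mule.
  by move=> y; rewrite mule_ge0// lee_fin ltW.
split=> [x|]; last first.
  rewrite (_ : (fun y => _) = fun y => ((K `^ s)%:E * (f y + g y) `^ s)%E); last first.
    apply/funext => y; rewrite poweRM//; last by rewrite lee_fin ltW.
  have mfgs : measurable_fun setT (fun y => (f y + g y) `^ s)%E by exact: measurable_poweR_fun.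
  rewrite integralZl_ge0 ?lee_fin ?powR_ge0//; last by move=> y; exact: poweR_ge0.
  rewrite EFinM -muleA lee_wpmul2l ?lee_fin ?powR_ge0//.
  have mfs : measurable_fun setT (fun y => f y `^ s)%E by exact: measurable_poweR_fun.
  have mgs : measurable_fun setT (fun y => g y `^ s)%E by exact: measurable_poweR_fun.
  apply: (@le_trans _ _ (\int[mu]_y ((2 `^ s)%:E * (f y `^ s + g y `^ s)))%E).
    apply: le_integral_nonmeas => y _; first exact: poweR_ge0.
    by apply: poweR_addl => //; exact: ltW.
  rewrite integralZl_ge0 ?lee_fin ?powR_ge0//; last 2 first.
  - exact: emeasurable_funD.
  - by move=> y; rewrite adde_ge0 ?poweR_ge0.
  rewrite EFinM -muleA lee_wpmul2l ?lee_fin ?powR_ge0//.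
  rewrite ge0_integralD//; [|by move=> y _; exact: poweR_ge0|by move=> y _; exact: poweR_ge0].
  rewrite EFinD ge0_muleDl ?lee_fin ?(ltW L0)// mul1e leeD2l//.
  exact: integral_spread_conv.
have gpot0 h : (forall y, (0 <= h y)%E) -> (0 <= gpot h x)%E.
  by move=> h0; exact: (pot_ge0 mu _ W_gt0 D_ge1 B_ge1 rho_gt0).
have potK : (gpot (fun y => K%:E * (f y + g y)) x = K%:E * (gpot f x + gpot g x))%E.
  rewrite (potZ mu mN W_gt0 D_ge1 B_ge1 rho_gt0 x (ltW K0) mfg fg0).
  by rewrite (potD mu mN W_gt0 D_ge1 B_ge1 rho_gt0 x mf f0 mg g0).
rewrite potK bessel_potentialE// /K -mulrA EFinM -muleA.
rewrite lee_wpmul2l ?lee_fin ?invr_ge0 ?(ltW M0)// EFinM -muleA.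
rewrite (@ge0_muleDr _ B%:E) ?gpot0//.
pose F : set (Rn R n) := [set y | 1 < enorm (subv x y)].
have mF : measurable F.
  rewrite -[F]setTI (_ : F = (fun y => enorm (subv x y)) @^-1` `]1, +oo[).
    by apply: (measurable_enorm_sub x) => //; exact: measurable_itv.
  by apply/seteqP; split=> y; rewrite /F /= in_itv/= andbT.
pose far : \bar R := (\int[mu]_y ((\1_F y)%:E * (bessel_spread a 1 (subv x y) * f y)))%E.
have mspr : measurable_fun setT (fun y => bessel_spread a 1 (subv x y) * f y)%E.
  apply: measurable_mule => //.
  exact: measurableT_comp (measurable_bessel_spread a ltr01) (measurable_subv x).
have spr0 y : (0 <= bessel_spread a 1 (subv x y) * f y)%E.
  by rewrite mule_ge0 ?bessel_spread_ge0.
have mfar : measurable_fun setT (fun y => (\1_F y)%:E * (bessel_spread a 1 (subv x y) * f y))%E.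
  by apply: measurable_mule => //; apply/measurable_EFinP; exact: measurable_indic.
have far0 : (0 <= far)%E by apply: integral_ge0 => y _; rewrite mule_ge0.
have mnear : measurable_fun setT (fun y => C%:E * (grid_kernel x y * f y))%E.
  by apply: measurable_mule => //; apply: measurable_mule => //; exact: measurable_grid_kernel.
have near0 y : (0 <= C%:E * (grid_kernel x y * f y))%E.
  by rewrite !mule_ge0 ?grid_kernel_ge0 ?lee_fin ?(ltW C0).
apply: (@le_trans _ _ (C%:E * (B%:E * gpot f x) + far)%E).
  rewrite gpotE// -integralZl_ge0 ?lee_fin ?(ltW C0)//; last 2 first.
  - by apply: measurable_mule => //; exact: measurable_grid_kernel.
  - by move=> y; rewrite mule_ge0 ?grid_kernel_ge0.
  rewrite /far -ge0_integralD//; last by move=> y _; rewrite mule_ge0.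
  apply: ae_ge0_le_integral => //.
  - by move=> y _; rewrite adde_ge0// mule_ge0.
  - exact: emeasurable_funD.
  have := ae_neq x; apply: filterS => y r0 _.
  have [r1|r1] := leP (enorm (subv x y)) 1.
    apply: (@le_trans _ _ (C%:E * (grid_kernel x y * f y))%E); last first.
      by rewrite leeDl// mule_ge0.
    by rewrite muleA lee_wpmul2r// hC// r0.
  by rewrite indicE mem_set// mul1e leeDr.
have far_le : (far <= (l ^+ n)%:E * (B%:E * gpot g x))%E.
  (* The constant [l] is such that |w - y| <= l |x - y| whenever |x - y| > 1, which is the
     hypothesis of [bessel_spread_far]. *)
  have far_w w : Nb 2 x w -> (far <= (l ^+ n)%:E * g w)%E.
    move=> xw; rewrite /g /spread_conv -integralZl_ge0; last 3 first.
    - by rewrite lee_fin; exact: ltW ln0.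
    - apply: measurable_mule; last exact: mf.
      exact: measurableT_comp (measurable_bessel_spread a l0) (measurable_subv w).
    - by move=> y; rewrite mule_ge0 ?bessel_spread_ge0.
    apply: le_integral_nonmeas => y _; first by rewrite mule_ge0.
    have [/set_mem Fy|Fy] := boolP (y \in F); last first.
      rewrite indicE (negbTE Fy) mul0e !mule_ge0 ?bessel_spread_ge0//.
      by rewrite lee_fin ltW.
    rewrite indicE mem_set// mul1e muleA lee_wpmul2r//.
    by apply: bessel_spread_far => //; exact: enorm_sub_le.
  rewrite gpotE// -integralZl_ge0 ?lee_fin ?(ltW ln0)//; last 2 first.
  - by apply: measurable_mule => //; exact: measurable_grid_kernel.
  - by move=> y; rewrite mule_ge0 ?grid_kernel_ge0.
  have mN2 := measurable_rel (mN 2) x.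
  apply: (@le_trans _ _ (\int[mu]_w (far * (\1_(Nb 2 x) w)%:E))%E).
    rewrite integralZl_ge0//; last by apply/measurable_EFinP; exact: measurable_indic.
    rewrite (integral_indic mu measurableT mN2) setIT [X in (_ <= _ * X)%E]mu_N.
    rewrite -[leLHS]mule1 lee_wpmul2l// lee_fin.
    have -> : W = D ^+ 2 by rewrite /W /D exprAC; congr (_ ^+ n); ring.
    by rewrite divff ?mulr1// expf_neq0// gt_eqF.
  apply: le_integral_nonmeas => w _; first by rewrite mule_ge0.
  have [/set_mem xw|xw] := boolP (w \in Nb 2 x); last first.
    rewrite indicE (negbTE xw) mule0 !mule_ge0 ?grid_kernel_ge0//.
    by rewrite lee_fin ltW.
  rewrite [in leLHS]indicE mem_set// mule1; apply: le_trans (far_w _ xw) _.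
  rewrite lee_wpmul2l ?lee_fin ?(ltW ln0)// -[leLHS]mul1e lee_wpmul2r//.
  apply: le_trans (nneseries_lim_ge 1%N _) => //.
  by rewrite big_nat1 expr0 mul1e indicE mem_set.
apply: le_trans (leeD2l _ far_le) _.
have g1 : (0 <= B%:E * gpot f x)%E by rewrite mule_ge0 ?gpot0// lee_fin ltW.
have g2 : (0 <= B%:E * gpot g x)%E by rewrite mule_ge0 ?gpot0// lee_fin ltW.
rewrite ge0_muleDr// EFinD !ge0_muleDl ?lee_fin ?(ltW C0) ?(ltW ln0)//.
apply: leeD; first by rewrite leeDl// mule_ge0// lee_fin ltW.
by rewrite leeDr// mule_ge0// lee_fin ltW.
Qed.

End bessel_dyadic.

(** * The Bessel capacity and the local maximal function *)

Section bessel_capacity.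
Context {R : realType} {n : nat}.
Local Notation mu := (@lebesgue_Rn R n).
Variables a s : R.
Hypothesis s_gt1 : 1 < s.

Lemma bessel_cap_ge0 (E : set (Rn R n)) : (0 <= bessel_cap a s E)%E.
Proof. by apply: le_ereal_inf_tmp => _ [f _ <-]; exact: poweR_ge0. Qed.

Lemma le_bessel_cap (E F : set (Rn R n)) : E `<=` F ->
  (bessel_cap a s E <= bessel_cap a s F)%E.
Proof.
move=> EF; apply: ereal_inf_le_tmp => _ [f [mf f0 Ff] <-].
by exists f => //; split => // x /EF; exact: Ff.
Qed.

Lemma poweR_Lnorm_ge0 (f : Rn R n -> \bar R) : (forall y, (0 <= f y)%E) ->
  ('N[mu]_s%:E[f] `^ s = \int[mu]_y f y `^ s)%E.
Proof.
move=> f0; rewrite poweR_Lnorm; last by rewrite gt_eqF// (lt_trans ltr01).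
by apply: eq_integral => y _; rewrite gee0_abs.
Qed.

Lemma bessel_cap_le (E : set (Rn R n)) f : measurable_fun setT f ->
  (forall y, (0 <= f y)%E) -> (forall x, E x -> (1 <= bessel_potential a f x)%E) ->
  (bessel_cap a s E <= \int[mu]_y f y `^ s)%E.
Proof.
by move=> mf f0 Ef; apply: ereal_inf_lbound; exists f => //; exact: poweR_Lnorm_ge0.
Qed.

Lemma bessel_cap_adherent (E : set (Rn R n)) (d : R) : 0 < d ->
  (bessel_cap a s E < +oo)%E -> exists2 f : Rn R n -> \bar R,
  [/\ measurable_fun setT f, (forall y, (0 <= f y)%E) &
      (forall x, E x -> (1 <= bessel_potential a f x)%E)] &
  (\int[mu]_y f y `^ s <= bessel_cap a s E + d%:E)%E.
Proof.
move=> d0 Eoo.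
have fin : bessel_cap a s E \is a fin_num by rewrite ge0_fin_numE ?bessel_cap_ge0.
have [_ [f Ef <-] /ltW h] := lb_ereal_inf_adherent d0 fin.
exists f => //; rewrite -poweR_Lnorm_ge0//; by case: Ef.
Qed.

(** For 2^-(k+1) < r <= 2^-k the ball lies in the block of generation [k.+2], of measure (3 *
    2^-k)^n, and has measure at least (r/n)^n, which exceeds (2^-(k+1) / n)^n. The ratio is at most
    (6 n)^n. *)
Lemma loc_maximal_le (D : set (Rn R n)) (f V : Rn R n -> \bar R) x : (0 < n)%N ->
  measurable_fun setT V -> (forall y, (0 <= V y)%E) -> (forall y, D y -> (`|f y| <= V y)%E) ->
  (loc_maximal D f x <= ((6 * n%:R) ^+ n)%:E *
   ereal_sup (range (fun k => avg mu (fun k => @grid_rel R n 1 k) (4 ^+ n) (2 ^+ n) (3 ^+ n) k.+2 V x)))%E.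
Proof.
move=> n0 mV V0 fV; apply: ge_ereal_sup => _ [r /= rI <-].
move: rI; rewrite in_itv/= => /andP[r0 r1].
have nR : 0 < n%:R :> R by rewrite ltr0n.
have [k /andP[kr rk]] := dyadic_scale r0 r1.
have Ngr := eball_grid (x := x) rk.
apply: (@le_trans _ _ (((6 * n%:R) ^+ n)%:E *
  avg mu (fun k => @grid_rel R n 1 k) (4 ^+ n) (2 ^+ n) (3 ^+ n) k.+2 V x)%E); last first.
  by rewrite lee_wpmul2l ?lee_fin ?exprn_ge0 ?mulr_ge0//; apply: ereal_sup_ubound; exists k.
have mN : measurable (grid_rel 1 k.+2 x) := measurable_rel (measurable_grid 1 k.+2) x.
have mb := measurable_eball x r.
have mE : mu (eball x r) \is a fin_num.
  rewrite ge0_fin_numE//; apply: (@le_lt_trans _ _ (mu (grid_rel 1 k.+2 x))).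
    by apply: le_measure; rewrite ?inE.
  by rewrite measure_grid// ltry.
have mge := measure_eball_ge x n0 r0.
have rn0 : 0 < (r / n%:R) ^+ n by rewrite exprn_gt0// divr_gt0.
have [m mM m0] : exists2 m, mu (eball x r) = m%:E & (r / n%:R) ^+ n <= m.
  by exists (fine (mu (eball x r))); rewrite ?fineK// -lee_fin fineK.
have mp : 0 < m by exact: lt_le_trans m0.
rewrite mM inver gt_eqF// avgE muleA.
have le_int : (\int[mu]_(y in eball x r `&` D) `|f y| <= mass mu (grid_rel 1 k.+2) V x)%E.
  rewrite /mass integral_indicM; apply: le_integral_nonmeas => y _; first by rewrite mule_ge0.
  have [/set_mem[yb yD]|h] := boolP (y \in eball x r `&` D); last first.
    by rewrite indicE (negbTE h) mul0e mule_ge0.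
  rewrite !indicE !mem_set// ?mul1e; first exact: fV.
  exact: Ngr.
apply: (@le_trans _ _ ((m^-1)%:E * mass mu (grid_rel 1 k.+2) V x)%E).
  by rewrite lee_wpmul2l// lee_fin invr_ge0 ltW.
apply: lee_wpmul2r; first exact: mass_ge0.
rewrite -EFinM lee_fin.
apply: (@le_trans _ _ ((r / n%:R) ^- n)); first by rewrite lef_pV2.
rewrite -exprVn invf_div.
apply: (@le_trans _ _ ((n%:R / 2^-1 ^+ k.+1) ^+ n)).
  have u0 : 0 < 2^-1 ^+ k.+1 :> R by rewrite exprn_gt0.
  rewrite lerXn2r ?nnegrE ?divr_ge0 ?(ltW r0) ?(ltW u0)//.
  by rewrite ler_pM2l// lef_pV2 ?posrE// ltW.
have -> : (2 ^+ n) ^+ k.+2 = (2 ^+ k.+2) ^+ n :> R by rewrite -!exprM mulnC.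
rewrite -expr_div_n -exprMn -expr_div_n.
rewrite le_eqVlt; apply/orP; left; apply/eqP; congr (_ ^+ n).
rewrite exprVn invrK !exprS; have : 2 ^+ k != 0 :> R by rewrite expf_neq0.
by move: (2 ^+ k) => d d0; field; rewrite d0.
Qed.

End bessel_capacity.

Theorem theorem1p3 (R : realType) (n : nat) (alpha s q : R)
    (hn : (1 <= n)%N) (halpha : 0 < alpha) (hs : 1 < s)
    (halphas : alpha * s <= n%:R)
    (hq : (n%:R - alpha) / n%:R < q) :
  exists A : R, 0 < A /\
    forall (D : set (Rn R n)) (f : Rn R n -> \bar R),
      qe_domain alpha s D ->
      lebesgue_measurable_fun D f ->
      (choquet alpha s setT (fun x => loc_maximal D f x `^ q)
       <= A%:E * choquet alpha s D (fun x => `|f x| `^ q))%E.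
Proof.
have nR : 0 < n%:R :> R by rewrite ltr0n.
have s0 : 0 < s by lra.
have an : alpha < n%:R by apply: lt_le_trans halphas; rewrite ltr_pMr.
have na : 0 < n%:R - alpha by rewrite subr_gt0.
have q0 : 0 < q by apply: lt_trans hq; rewrite divr_gt0.
pose U := n%:R / (n%:R - alpha).
have U1 : 1 < U by rewrite ltr_pdivlMr// mul1r; lra.
have qU : q^-1 < U by rewrite -[U]invrK ltf_pV2 ?posrE ?invr_gt0 ?divr_gt0// invf_div.
(* The exponent p is taken halfway between max(1, 1/q) and n / (n - alpha): it is then admissible
   for [avg_pot_poweR], and q p > 1 leaves room for [m] below s. *)
pose L := Num.max 1 q^-1.
have LU : L < U by rewrite gt_max U1 qU.
have [L1 Lq] : 1 <= L /\ q^-1 <= L by rewrite /L; split; rewrite le_max lexx ?orbT.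
pose p := (L + U) / 2.
have [pL pU] : L < p /\ p < U by rewrite /p; split; lra.
have p1 : 1 < p by lra.
have p0 : 0 < p by lra.
have qp : 1 < q * p by rewrite mulrC -ltr_pdivrMr// mul1r; lra.
(* The first entry ensures m > 1 and the second s/q <= m p; both are below s, the second because q p
   > 1. *)
pose m := Num.max ((1 + s) / 2) (s / (q * p)).
have m1 : 1 < m by rewrite /m lt_max; apply/orP; left; lra.
have ms : m < s.
  rewrite /m gt_max; apply/andP; split; first lra.
  have qp0 : 0 < q * p by rewrite mulr_gt0.
  by rewrite ltr_pdivrMr// ltr_pMr.
have sq : s / q <= m * p.
  rewrite -ler_pdivrMr// -mulrA -invfM; rewrite /m le_max; apply/orP; right.
  by rewrite lexx.
pose rho : R := 2 `^ (- alpha).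
have rho0 : 0 < rho by rewrite powR_gt0.
have pow2 (e : R) : e < 0 -> 2 `^ e < 1.
  by move=> e0; rewrite /powR pnatr_eq0/= expR_lt1 nmulr_rlt0// ln_gt0// ltr1n.
have rho1 : rho < 1 by apply: pow2; lra.
(* The left side is 2 to the power p (n - alpha) - n, which is negative exactly when p < n / (n -
   alpha). *)
have kap : rho `^ p * (2 ^+ n) `^ (p - 1) < 1.
  rewrite -powR_mulrn// -!powRrM -powRD ?pnatr_eq0 ?implybT//.
  apply: pow2; rewrite (_ : - alpha * p + n%:R * (p - 1) = p * (n%:R - alpha) - n%:R); last by ring.
  by rewrite subr_lt0 -ltr_pdivlMr.
have [c c0 hc] := @gpot_le_potential R n alpha halpha.
have [C C0 hC] := potential_le_gpot hn halpha an (ltW hs).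
have c1 : 0 < c^-1 `^ s by rewrite powR_gt0 ?invr_gt0.
have c3 : 0 < (6 * n%:R) ^+ n :> R by rewrite exprn_gt0 ?mulr_gt0.
have mu_grid (i : int) k (x : Rn R n) : 0 <= i ->
    lebesgue_Rn n (grid_rel i k x) = ((2 * i + 1)%:~R ^+ n * (4 ^+ n / (2 ^+ n) ^+ k))%:E.
  by move=> i0; rewrite measure_grid// exprMn expr_div_n -!exprM mulnC.
have H1 E (phi : Rn R n -> \bar R) : measurable_fun setT phi -> (forall y, (0 <= phi y)%E) ->
    (forall x, E x -> (1 <= pot (lebesgue_Rn n) (fun k => @grid_rel R n 1 k)
      (4 ^+ n) (2 ^+ n) (3 ^+ n) rho phi x)%E) ->
    (bessel_cap alpha s E <= (c^-1 `^ s)%:E * \int[lebesgue_Rn n]_x phi x `^ s)%E.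
  move=> mphi phi0 Ephi.
  have ci : (0 <= (c^-1)%:E)%E by rewrite lee_fin invr_ge0 ltW.
  (* Dividing [phi] by [c] makes up for the loss in [gpot_le_potential], so that its Bessel
     potential reaches 1 on [E]; this multiplies the integral by c^-s. *)
  have mpsi : measurable_fun setT (fun y => (c^-1)%:E * phi y)%E by exact: measurable_mule.
  have psi0 y : (0 <= (c^-1)%:E * phi y)%E by rewrite mule_ge0.
  apply: (@le_trans _ _ (\int[lebesgue_Rn n]_y ((c^-1)%:E * phi y) `^ s)%E); last first.
    under eq_integral do rewrite poweRM//.
    rewrite integralZl_ge0 ?poweR_ge0//; last by move=> y; exact: poweR_ge0.
    exact: measurable_poweR_fun.
  apply: bessel_cap_le => // x Ex; apply: le_trans (hc _ x mpsi psi0).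
  rewrite (potZ (lebesgue_Rn n) (measurable_grid 1)) ?exprn_gt0 ?exprn_ege1 ?ler1n ?invr_ge0 ?(ltW c0)//.
  by rewrite muleA -EFinM divff ?gt_eqF// mul1e; exact: Ephi.
have H2 E (d : R) : 0 < d -> (bessel_cap alpha s E < +oo)%E ->
    exists2 phi : Rn R n -> \bar R,
    measurable_fun setT phi /\ (forall y, (0 <= phi y)%E) &
    (forall x, E x -> (1 <= pot (lebesgue_Rn n) (fun k => @grid_rel R n 1 k)
      (4 ^+ n) (2 ^+ n) (3 ^+ n) rho phi x)%E) /\
    (\int[lebesgue_Rn n]_x phi x `^ s <= C%:E * (bessel_cap alpha s E + d%:E))%E.
  move=> d0 Eoo; have [g [mg g0 Eg] gd] := bessel_cap_adherent hs d0 Eoo.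
  have [psi mpsi [hpsi psis]] := hC g mg g0; exists psi => //; split.
    by move=> x /Eg h; apply: le_trans h (hpsi x).
  by apply: le_trans psis _; rewrite lee_wpmul2l// lee_fin ltW.
have W0 : 0 < 4 ^+ n :> R by rewrite exprn_gt0.
have D1 : 1 <= 2 ^+ n :> R by rewrite exprn_ege1// ler1n.
have B1 : 1 <= 3 ^+ n :> R by rewrite exprn_ege1// ler1n.
have mu_Q k x := mu_grid 0 k x isT.
have mu_N k x := mu_grid 1 k x isT.
have {}mu_Q k x : lebesgue_Rn n (@grid_rel R n 0 k x) = (4 ^+ n / (2 ^+ n) ^+ k)%:E.
  by rewrite mu_Q mulr0 add0r expr1n mul1r.
have [A A0 hA] := choquet_maximal (mu := lebesgue_Rn n)
  (measurable_grid 0) (measurable_grid 1)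
  (fun k x y => @grid_sym R n 0 k x y) (fun k x y z => @grid_trans R n 0 k x y z)
  (fun k x y => @grid_nested R n k x y)
  (fun k x => @grid_refl R n 1 k x isT) (fun k x y => @grid_sym R n 1 k x y)
  (fun k x y z => @grid_trans R n 1 k x y z) (fun k x y z => @grid_comp R n k x y z)
  W0 D1 B1
  mu_Q mu_N
  rho0 rho1 (@bessel_cap_ge0 R n alpha s) (@le_bessel_cap R n alpha s)
  hs q0 m1 ms (ltW p1) kap sq c1 C0 c3 H1 H2.
exists A; split => // D f _ _.
have mf0 x : (0 <= loc_maximal D f x)%E.
  apply: (@le_trans _ _ ((lebesgue_Rn n (eball x 1))^-1 *
    \int[lebesgue_Rn n]_(y in eball x 1 `&` D) `|f y|)%E).
    by rewrite mule_ge0 ?inve_ge0 ?measure_ge0// integral_ge0.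
  by apply: ereal_sup_ubound; exists 1; rewrite //= in_itv/= ltr01 lexx.
have := hA D (fun x => `|f x|)%E (loc_maximal D f) (fun x => abse_ge0 _) mf0.
rewrite /choquet => h; under eq_integral do rewrite setTI.
by apply: h => V mV V0 fV x; exact: loc_maximal_le.
Qed.
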